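(* Let $\{\alpha_n\}_{n\in\mathbb{N}}\subset(0,d)$ be such that $\alpha_n\to d^-$ as $n\to+\infty$. Let $u^\infty_0\in L^2(\Omega)$ and let $\{u^n_0\}_{n\in\mathbb{N}}\subset L^2(\Omega)$ be such that $u^n_0\to u^\infty_0$ in $L^2(\Omega)$. Let $T>0$. Then, for each choice of sign $\sigma\in\{+1,-1\}$ the following holds. For every $n\in\mathbb{N}$ there exists a unique solution $u^n\in H^1([0,T];L^2(\Omega))$ to $$\begin{cases}u_t(t)=\dfrac{\sigma}{d-\alpha_n}\Big[(-\Delta)^{-\frac{\alpha_n}{2}}u(t)-2\displaystyle\int_\Omega u(t)\,dy\Big]&\text{for a.e. }t\in(0,T),\\ u(0)=u^n_0.\end{cases}$$ Moreover, $u^n\to u^\infty$ (strongly) in $H^1([0,T];L^2(\Omega))$ as $n\to+\infty$, where $u^\infty\in H^1([0,T];L^2(\Omega))$ is the unique solution to $$\begin{cases}u_t(t)=\sigma(-\Delta)^{-\frac d2}u(t)&\text{for a.e. }t\in(0,T),\\ u(0)=u^\infty_0,\end{cases}$$ and, for every $t\in[0,T]$, $$\|u^n(t)-u^\infty(t)\|_{L^2(\Omega)}\to0\qquad\text{and}\qquad\widetilde{\mathcal{J}}^{\alpha_n}(u^n(t))\to\widetilde{\mathcal{J}}^d(u^\infty(t)).$$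
   Context: Let $d\in\mathbb{N}$ (with $d\ge 1$) and let $\Omega\subset\mathbb{R}^d$ be a bounded open set with Lipschitz continuous boundary. $L^2(\Omega)$ is the space of real-valued square-integrable functions. For $\alpha\in(0,d)$ and $u\in L^2(\Omega)$ set $$\mathcal{J}^\alpha(u):=-\int_\Omega\int_\Omega\frac{u(x)u(y)}{|x-y|^{d-\alpha}}\,dy\,dx,\qquad \mathcal{J}^d(u):=-\Big(\int_\Omega u(x)\,dx\Big)^2,\qquad \widetilde{\mathcal{J}}^\alpha(u):=\frac{\mathcal{J}^\alpha(u)-\mathcal{J}^d(u)}{d-\alpha},$$ $$\widetilde{\mathcal{J}}^d(u):=-\int_\Omega\int_\Omega u(x)u(y)\log\frac{1}{|x-y|}\,dy\,dx.$$ For $\alpha\in(0,d)$ the $\alpha$-Riesz potential of $u\in L^2(\Omega)$ (extended by $0$ outside $\Omega$) is $$(-\Delta)^{-\frac\alpha2}u(x):=2\int_{\Omega}\frac{u(y)}{|x-y|^{d-\alpha}}\,dy,$$ whose restriction to $\Omega$ belongs to $L^2(\Omega)$, and $$(-\Delta)^{-\frac d2}u(x):=2\int_\Omega u(y)\log\frac{1}{|x-y|}\,dy,\qquad x\in\mathbb{R}^d.$$ The evolution equations are equalities in $L^2(\Omega)$, where $\int_\Omega u(t)\,dy$ is regarded as a function on $\Omega$ that is constant in space. Solutions are sought in $H^1([0,T];L^2(\Omega))$, the Sobolev space of $L^2(\Omega)$-valued functions of time, whose elements are identified with their continuous representatives. *)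

(* Defs.v *)
From HB Require Import structures.
From mathcomp Require Import all_boot all_order all_algebra.
From mathcomp Require Import all_classical all_reals all_analysis.
From mathcomp Require Import measurable_realfun.

Set Implicit Arguments.
Unset Strict Implicit.
Unset Printing Implicit Defensive.
Import Order.TTheory GRing.Theory Num.Theory.
Import numFieldTopology.Exports numFieldNormedType.Exports.
Local Open Scope classical_set_scope.
Local Open Scope ring_scope.

(* 'rV[R]_n carries the sigma-algebra generated by its coordinates, as n-tuples
   do in the library. It is the Borel sigma-algebra: its generators are
   preimages of Borel sets by continuous maps, and see open_measurable_rV. *)
Section measurable_rV.
Context (R : realType) (n : nat).

Let coord : 'I_n -> 'rV[R]_n -> R := fun i x => x 0 i.

Let rV_set0 : g_sigma_preimage coord set0.
Proof. exact: sigma_algebra0. Qed.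

Let rV_setC A : g_sigma_preimage coord A -> g_sigma_preimage coord (~` A).
Proof. exact: sigma_algebraC. Qed.

Let rV_bigcup (F : (set 'rV[R]_n)^nat) :
  (forall i, g_sigma_preimage coord (F i)) ->
  g_sigma_preimage coord (\bigcup_i F i).
Proof. exact: sigma_algebra_bigcup. Qed.

HB.instance Definition _ := @isMeasurable.Build default_measure_display
  'rV[R]_n (g_sigma_preimage coord) rV_set0 rV_setC rV_bigcup.

Lemma measurable_coord_rV (i : 'I_n) :
  measurable_fun [set: 'rV[R]_n] (fun x : 'rV[R]_n => x 0 i).
Proof.
move=> _ Y mY; rewrite setTI; apply: sub_sigma_algebra => /=.
rewrite -bigcup_seq/=; exists i => /=; first by rewrite mem_index_enum.
by exists Y => //; rewrite setTI.
Qed.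

Lemma measurable_fun_rVP d (T : measurableType d) (f : T -> 'rV[R]_n) :
  (forall i, measurable_fun [set: T] (fun t => f t 0 i)) ->
  measurable_fun [set: T] f.
Proof.
move=> mf _ A mA; rewrite setTI.
have : (g_sigma_preimage (fun i => coord i \o f)) (f @^-1` A).
  by rewrite g_sigma_preimage_comp; exists A => //; rewrite setTI.
move: (f @^-1` A); apply: smallest_sub; first exact: sigma_algebra_measurable.
rewrite -bigcup_seq; apply: bigcup_sub => i _ B [C mC <-].
exact: mf.
Qed.

Lemma measurable_ball_rV (x : 'rV[R]_n) (r : R) : measurable (ball x r).
Proof.
have [r0|r0] := ltP 0 r; last first.
  suff -> : ball x r = set0 by [].
  by rewrite -subset0 => y [] /lt_le_trans/(_ r0); rewrite ltxx.
have -> : ball x r = \big[setI/setT]_(i < n) (coord i @^-1` ball (x 0 i) r).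
  apply/seteqP; split => y.
    move=> [_ xy]; rewrite -bigcap_seq => i _; exact: xy.
  rewrite -bigcap_seq => xy; split => // i j; rewrite (ord1 i).
  by apply: xy => /=; rewrite mem_index_enum.
apply: bigsetI_measurable => i _.
by rewrite -[X in measurable X]setTI; apply: measurable_coord_rV => //;
  exact: measurable_ball.
Qed.

Lemma open_measurable_rV (A : set 'rV[R]_n) : open A -> measurable A.
Proof.
move=> oA.
pose q (p : 'rV[rat]_n) : 'rV[R]_n := map_mx ratr p.
pose B (p : 'rV[rat]_n * nat) := ball (q p.1) (p.2.+1%:R^-1 : R).
pose P : set ('rV[rat]_n * nat) := [set p | B p `<=` A].
have -> : A = \bigcup_(p in P) B p.
  apply/seteqP; split => [x Ax|x [p Pp Bp]]; last exact: Pp.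
  have /nbhs_ballP[e /= e0 eA] : nbhs x A by exact: open_nbhs_nbhs.
  have [k /andP[_ ke]] : exists k : nat, true && (k.+1%:R^-1 < e / 2 :> R).
    have e20 : 0 < e / 2 by rewrite divr_gt0.
    have [k _ /(_ _ (leqnn k)) ke] := near_infty_natSinv_lt (PosNum e20).
    by exists k.
  have k0 : 0 < k.+1%:R^-1 :> R by rewrite invr_gt0.
  have [p xp] : exists p : 'rV[rat]_n,
      forall i, `|x 0 i - ratr (p 0 i)| < k.+1%:R^-1.
    have : forall i, exists r : rat, `|x 0 i - ratr r| < k.+1%:R^-1.
      move=> i; have : x 0 i - k.+1%:R^-1 < x 0 i + k.+1%:R^-1.
        by rewrite ltrBlDr -addrA ltrDl addr_gt0.
      move/rat_in_itvoo => [r]; rewrite in_itv/= => /andP[r1 r2].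
      exists r; rewrite ltr_distlC; apply/andP; split => //.
    move/choice => [f hf]; exists (\row_i f i) => i; rewrite mxE; exact: hf.
  exists (p, k); last first.
    by split => // i j; rewrite (ord1 i) mxE /ball/= distrC.
  move=> y [_ yp]; apply: eA; split => // i j; rewrite (ord1 i).
  rewrite /ball/=; have := yp 0 j; have := xp j; rewrite /ball/= mxE => h1 h2.
  rewrite (splitr e) (le_lt_trans (ler_distD (ratr (p 0 j)) _ _))//.
  by rewrite ltrD// (lt_trans _ ke).
rewrite bigcup_mkcond.
apply: countable_bigcupT_measurable => [|p]; first exact: countableP.
by case: ifPn => _; [exact: measurable_ball_rV|exact: measurable0].
Qed.

End measurable_rV.

Section lebesgue_rV.
Context {R : realType}.

Definition rV_cons n (p : 'rV[R]_n * measurableTypeR R) : 'rV[R]_n.+1 :=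
  row_mx ((p.2 : R)%:M : 'rV_1) p.1.

Lemma measurable_rV_cons n :
  measurable_fun [set: 'rV[R]_n * measurableTypeR R] (@rV_cons n).
Proof.
apply: measurable_fun_rVP => i.
have [j ij|j ij] := @split_ordP 1 n i.
- rewrite (_ : (fun _ => _) = snd)//.
  by apply/funext => p; rewrite ij (row_mxEl (p.2%:M : 'rV_1)) (ord1 j) mxE.
- rewrite (_ : (fun _ => _) = (fun x : 'rV[R]_n => x 0 j) \o fst).
    exact: measurableT_comp (@measurable_coord_rV R n j) measurable_fst.
  by apply/funext => p; rewrite ij (row_mxEr (p.2%:M : 'rV_1)).
Qed.

Section step.
Local Open Scope ereal_scope.
Variables (n : nat) (m : {measure set 'rV[R]_n -> \bar R}).

Definition lebesgue_cons : set 'rV[R]_n.+1 -> \bar R :=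
  pushforward (m \x @lebesgue_measure R) (@rV_cons n).

HB.instance Definition _ := Measure.copy lebesgue_cons
  (measure_function_pushforward__canonical__measure_function_Measure
    (m \x @lebesgue_measure R) (@measurable_rV_cons n)).

End step.

Fixpoint lebesgue_rV n : {measure set 'rV[R]_n -> \bar R} :=
  if n is n'.+1 then lebesgue_cons (lebesgue_rV n') else \d_(0 : 'rV[R]_0).

Lemma lebesgue_rV_box n (A : 'I_n -> set R) : (forall i, measurable (A i)) ->
  lebesgue_rV n [set x | forall i, A i (x 0 i)] =
  (\prod_(i < n) lebesgue_measure (A i))%E.
Proof.
elim: n A => [|n IHn] A mA.
  by rewrite big_ord0 /= diracE mem_set// => -[].
rewrite big_ord_recl /= /lebesgue_cons /pushforward.
set B := [set x : 'rV[R]_n | forall i, A (lift ord0 i) (x 0 i)].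
have mB : measurable B.
  have -> : B = \big[setI/setT]_(i < n)
      ((fun x : 'rV[R]_n => x 0 i) @^-1` A (lift ord0 i)).
    rewrite -bigcap_seq; apply/seteqP; split => x Bx i //; first by move=> _.
    by apply: Bx => /=; rewrite mem_index_enum.
  apply: bigsetI_measurable => i _.
  by rewrite -[X in measurable X]setTI; apply: measurable_coord_rV.
rewrite (_ : _ @^-1` _ = B `*` A ord0).
  rewrite product_measure1E; [|exact: mB|exact: mA].
  by rewrite muleC; congr (_ * _)%E; exact: IHn.
apply/seteqP; split => -[x y] /=.
  move=> H; split => /= [i|].
    have := H (lift ord0 i); rewrite /rV_cons /=.
    have -> : lift ord0 i = rshift 1 i by apply/val_inj.
    by rewrite (row_mxEr (y%:M : 'rV_1)).
  have := H ord0; rewrite /rV_cons /=.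
  have -> : ord0 = lshift n (ord0 : 'I_1) by apply/val_inj.
  by rewrite (row_mxEl (y%:M : 'rV_1)) mxE.
move=> [H1 H2] i; rewrite /rV_cons /=.
have [j ij|j ij] := @split_ordP 1 n i.
  rewrite ij (row_mxEl (y%:M : 'rV_1)) (ord1 j) mxE eqxx mulr1n.
  by rewrite (_ : lshift n 0 = ord0)//; apply/val_inj.
rewrite ij (row_mxEr (y%:M : 'rV_1)).
by rewrite (_ : rshift 1 j = lift ord0 j)//; apply/val_inj.
Qed.

End lebesgue_rV.

Section domain.
Context {R : realType}.

(* Euclidean norm; `|x| is the sup norm on 'rV[R]_n. *)
Definition enorm n (x : 'rV[R]_n) : R := Num.sqrt (\sum_i x 0 i ^+ 2).

Definition ebounded d (Omega : set 'rV[R]_d) :=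
  exists M : R, forall x, Omega x -> enorm x <= M.

(* Near each boundary point Omega is, in rotated coordinates x *m Q, the set
   above the graph of a Lipschitz function of the coordinates other than i. *)
Definition lipschitz_boundary d (Omega : set 'rV[R]_d) :=
  forall x0 : 'rV[R]_d, (closure Omega `\` interior Omega) x0 ->
  exists (r : R) (Q : 'M[R]_d) (i : 'I_d) (gamma : 'rV[R]_d.-1 -> R) (L : R),
    [/\ 0 < r,
        Q *m Q^T = 1%:M,
        forall y z, `|gamma y - gamma z| <= L * enorm (y - z) &
        forall x : 'rV[R]_d, enorm (x - x0) < r ->
          (Omega x <-> gamma (col' i (x *m Q)) < (x *m Q) 0 i)].

Definition lebesgue_on d (Omega : set 'rV[R]_d) (oO : open Omega) :
    {measure set 'rV[R]_d -> \bar R} :=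
  mrestr (lebesgue_rV d) (open_measurable_rV oO).

End domain.

(* Elements of L^2 are represented by functions: equality in L^2 is always
   written u = v %[ae mu], never as Leibniz equality. *)
Notation L2 mu := (LfunType mu (lee1n 2)).

Section L2_valued_functions_of_time.
Context d (X : measurableType d) (R : realType).
Variable mu : {measure set X -> \bar R}.
Implicit Types (D : set R) (f u v : R -> L2 mu).

Notation leb := (@lebesgue_measure R).

Definition L2norm (u : L2 mu) : R := fine ('N[mu]_2%:E [EFin \o u])%E.

Record simple_fun D := SimpleFun {
  sf_size : nat ;
  sf_set : 'I_sf_size -> set R ;
  sf_val : 'I_sf_size -> L2 mu ;
  sf_sub : forall i, sf_set i `<=` D ;
  sf_measurable : forall i, measurable (sf_set i) ;
  sf_finite : forall i, (leb (sf_set i) < +oo)%E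
}.
Arguments sf_set {D} s i.
Arguments sf_val {D} s i.

Definition sf_eval D (s : simple_fun D) (t : R) : L2 mu :=
  \sum_i (\1_(sf_set s i) t : R) *: sf_val s i.

Definition sf_integral D (s : simple_fun D) : L2 mu :=
  \sum_i fine (leb (sf_set s i)) *: sf_val s i.

Definition strongly_measurable D f :=
  exists s : nat -> simple_fun D,
    {ae leb, forall t, D t ->
      L2norm (f t - sf_eval (s n) t) @[n --> \oo] --> (0 : R)}.

Definition is_bochner_integral D f (I : L2 mu) :=
  strongly_measurable D f /\
  exists s : nat -> simple_fun D,
    (\int[leb]_(t in D) (L2norm (f t - sf_eval (s n) t))%:E)%E
      @[n --> \oo] --> (0 : \bar R)%E /\
    L2norm (sf_integral (s n) - I) @[n --> \oo] --> (0 : R).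

Definition L2_in_time D f :=
  strongly_measurable D f /\
  (\int[leb]_(t in D) (L2norm (f t) ^+ 2)%:E < +oo)%E.

Definition test_function (T : R) (phi : R -> R) :=
  (forall (n : nat) (t : R), derivable (derive1n n phi) t 1) /\
  exists a b : R,
    [/\ 0 < a, b < T & forall t, t \notin `[a, b] -> phi t = 0].

Definition weak_derivative (T : R) u v :=
  forall phi, test_function T phi ->
  exists I : L2 mu,
    is_bochner_integral `[0, T] (fun t => derive1 phi t *: u t) I /\
    is_bochner_integral `[0, T] (fun t => phi t *: v t) (- I).

Definition L2_continuous_on D u :=
  forall t, D t -> L2norm (u s - u t) @[s --> within D (nbhs t)] --> (0 : R).

(* An element of H^1([0,T]; L^2(mu)): its continuous representative on [0,T],
   together with (a representative of) its weak derivative. *)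
Record H1 (T : R) := MkH1 {
  H1_val :> R -> L2 mu ;
  H1_deriv : R -> L2 mu ;
  H1_val_L2 : L2_in_time `[0, T] H1_val ;
  H1_deriv_L2 : L2_in_time `[0, T] H1_deriv ;
  H1_weak_derivative : weak_derivative T H1_val H1_deriv ;
  H1_continuous : L2_continuous_on `[0, T] H1_val
}.

Definition H1_dist (T : R) (u w : H1 T) : \bar R :=
  ((\int[leb]_(t in `[0%R, T]) (L2norm (u t - w t) ^+ 2)%:E +
    \int[leb]_(t in `[0%R, T])
      (L2norm (H1_deriv u t - H1_deriv w t) ^+ 2)%:E) `^ 2^-1)%E.

Definition is_solution (T : R) (F : (X -> R) -> (X -> R)) (u0 : L2 mu)
    (u : H1 T) :=
  {ae leb, forall t, t \in `]0, T[ -> H1_deriv u t = F (u t) %[ae mu]} /\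
  u 0 = u0 %[ae mu].

Definition is_unique_solution (T : R) (F : (X -> R) -> (X -> R)) (u0 : L2 mu)
    (u : H1 T) :=
  is_solution F u0 u /\
  forall w : H1 T, is_solution F u0 w ->
    forall t, t \in `[0, T] -> w t = u t %[ae mu].

End L2_valued_functions_of_time.

Section riesz.
Context {R : realType} (d : nat).
Variable Omega : set 'rV[R]_d.
Implicit Types (alpha : R) (u : 'rV[R]_d -> R) (x y : 'rV[R]_d).

Notation leb := (lebesgue_rV d).

Definition riesz_potential alpha u x : R :=
  2 * \int[leb]_(y in Omega) (u y / enorm (x - y) `^ (d%:R - alpha)).

Definition log_potential u x : R :=
  2 * \int[leb]_(y in Omega) (u y * ln (1 / enorm (x - y))).

Definition J alpha u : R :=
  - \int[leb]_(x in Omega) \int[leb]_(y in Omega)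
      (u x * u y / enorm (x - y) `^ (d%:R - alpha)).

Definition J_d u : R := - (\int[leb]_(x in Omega) u x) ^+ 2.

Definition Jtilde alpha u : R := (J alpha u - J_d u) / (d%:R - alpha).

Definition Jtilde_d u : R :=
  - \int[leb]_(x in Omega) \int[leb]_(y in Omega)
      (u x * u y * ln (1 / enorm (x - y))).

End riesz.

(* Main.v *)
Require Import Defs.
From HB Require Import structures.
From mathcomp Require Import all_boot all_order all_algebra.
From mathcomp Require Import all_classical all_reals all_analysis.
From mathcomp Require Import measurable_realfun.
From mathcomp Require Import ring lra.

Set Implicit Arguments.
Unset Strict Implicit.
Unset Printing Implicit Defensive.
Import Order.TTheory GRing.Theory Num.Theory.
Import numFieldTopology.Exports numFieldNormedType.Exports.
Local Open Scope classical_set_scope.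
Local Open Scope ring_scope.

(** Put [b = d - alpha], [r = |x - y|] and [l = ln (1 / r)]. The right-hand side
    of the n-th equation is the integral operator [A_n] with kernel
    [2 * sigma * (r^(-b) - 1) / b], and [r^(-b) = exp (b * l)], so that formally
    the kernel tends to [2 * sigma * l], the kernel of the limit operator [A].
    The point of the proof is that this convergence holds in operator norm on
    L2(Omega): since [|(exp (b * l) - 1) / b - l| <= b * l^2 * exp (b * |l|)],
    the difference of the two kernels is at most [b * K * (1 + r^(-1/2))] on the
    bounded set Omega as soon as [b <= 1/4] ([riesz_sub_log_le],
    [schur_difference]). The function [r^(-g)] with [0 < g < d] has a bounded
    integral over Omega, uniformly in [x] ([integral_inv_powR_le]), and Schur's
    test ([schur_test]) turns uniform bounds on the integrals of symmetric
    kernels into bounds on operator norms. Hence all the operators are bounded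
    and [A_n - A] has norm [O(d - alpha_n)].

    Everything else is the theory of [u' = A u] for a bounded operator [A].
    The solution is the exponential series [sum_k t^k / k! A^k u0]. It converges
    in L2 because absolutely convergent series do ([L2_series_cvg]), uniformly
    for [t] in [[0, T]], and its weak derivative is obtained by integrating by
    parts the monomials [t^k / k!] against a test function
    ([exp_weak_derivative]). Comparing the series of [A_n] and [A] term by term
    shows that solutions and their derivatives converge uniformly in time
    ([exp_perturbation], [exp_image_perturbation]), which gives convergence in
    H1 and for every [t].

    For uniqueness, let [z] be the difference of two solutions with the same
    initial value. Testing the weak derivative with smooth approximations of the
    indicator function of [[a, b]] shows that [|z b - z a|] is at most
    [c * m * (b - a)] when [c] bounds [A] and [m] bounds [|z|] on [[a, b]]
    ([weak_derivative_le], [solution_lipschitz]); on intervals shorter than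
    [1 / (2 * c)] this forces [z = 0], and finitely many such steps cover
    [[0, T]] ([solution_unique]).

    Finally both energies are quadratic forms of the same operators: with [B_n]
    and [B] the operators of sign [+1], [Jtilde] and [Jtilde_d] equal
    [- <B_n u, u> / 2] and [- <B u, u> / 2] ([Jtilde_ip], [Jtilde_d_ip]), and
    they converge because [B_n (u_n t)] and [u_n t] do.

    An element of L2 is a function and [L2norm] is only a seminorm, so that
    linearity of operators, equality of solutions and so on are stated as the
    vanishing of the seminorm of a difference. *)

(** * The semi-inner product of L2 *)
Section L2_inner_product.
Context d (X : measurableType d) (R : realType).
Variable mu : {measure set X -> \bar R}.
Implicit Types u v w g : L2 mu.

Definition ip u v : R := \int[mu]_x (u x * v x).

Lemma measurable_L2 u : measurable_fun [set: X] (u : X -> R).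
Proof. exact: measurable_funPT. Qed.

Lemma L2_mem u : (u : X -> R) \in Lfun mu 2%:E.
Proof. exact: LfunP. Qed.

Lemma L2D_apply u v x : (u + v) x = u x + v x. Proof. by []. Qed.
Lemma L2Z_apply (a : R) u x : (a *: u) x = a * u x. Proof. by []. Qed.

Lemma L2_mul_integrable u v :
  mu.-integrable [set: X] (EFin \o (fun x => u x * v x)).
Proof. by apply/Lfun1_integrable; exact: Lfun2_mul_Lfun1 (L2_mem _) (L2_mem _). Qed.

Lemma ipC u v : ip u v = ip v u.
Proof. by apply: eq_Rintegral => x _; rewrite mulrC. Qed.

Lemma ipDl u v w : ip (u + v) w = ip u w + ip v w.
Proof.
rewrite /ip -RintegralD//; try exact: L2_mul_integrable.
by apply: eq_Rintegral => x _; rewrite L2D_apply mulrDl.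
Qed.

Lemma ipZl a u w : ip (a *: u) w = a * ip u w.
Proof.
rewrite /ip -RintegralZl//; last exact: L2_mul_integrable.
by apply: eq_Rintegral => x _; rewrite L2Z_apply mulrA.
Qed.

Lemma ipNl u w : ip (- u) w = - ip u w.
Proof. by rewrite -scaleN1r ipZl mulN1r. Qed.

Lemma ipBl u v w : ip (u - v) w = ip u w - ip v w.
Proof. by rewrite ipDl ipNl. Qed.

Lemma ip0l w : ip 0 w = 0.
Proof. by rewrite -(scale0r 0) ipZl mul0r. Qed.

Lemma ip_suml (I : Type) (r : seq I) (P : pred I) (F : I -> L2 mu) w :
  ip (\sum_(i <- r | P i) F i) w = \sum_(i <- r | P i) ip (F i) w.
Proof.
by apply: (big_morph (ip^~ w)) => [u v|]; [exact: ipDl|exact: ip0l].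
Qed.

Lemma L2norm_EFin u : (L2norm u)%:E = ('N[mu]_2%:E [EFin \o u])%E.
Proof. exact: finite_norm_fine. Qed.

Lemma L2norm_ge0 u : 0 <= L2norm u.
Proof. by rewrite -lee_fin L2norm_EFin Lnorm_ge0. Qed.

Lemma L2norm_sqrE u : (L2norm u ^+ 2)%:E = (\int[mu]_x (u x ^+ 2)%:E)%E.
Proof.
rewrite -powR_mulrn ?L2norm_ge0// -poweR_EFin L2norm_EFin poweR_Lnorm//.
apply: eq_integral => x _ /=.
by rewrite powR_mulrn// real_normK// num_real.
Qed.

Lemma L2norm_sqr u : L2norm u ^+ 2 = ip u u.
Proof.
apply: EFin_inj; rewrite L2norm_sqrE /ip /Rintegral fineK.
  by apply: eq_integral => x _; rewrite expr2.
by apply: integrable_fin_num => //; exact: L2_mul_integrable.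
Qed.

Lemma ip_abs_le u v : \int[mu]_x `|u x * v x| <= L2norm u * L2norm v.
Proof.
have := @hoelder _ _ _ mu u v 2 2 (measurable_L2 u) (measurable_L2 v).
rewrite Lnorm1 -!L2norm_EFin => /(_ _ _ _); rewrite -EFinM => H.
have {}H := H (ltr0n _ 2) (ltr0n _ 2) _.
have i := integrable_abse (L2_mul_integrable u v).
rewrite -lee_fin /Rintegral fineK; last exact: integrable_fin_num.
by apply: H; lra.
Qed.

Lemma ip_le u v : `|ip u v| <= L2norm u * L2norm v.
Proof.
apply: le_trans (ip_abs_le u v); apply: le_normr_Rintegral => //.
exact: L2_mul_integrable.
Qed.

Lemma L2normD u v : L2norm (u + v) <= L2norm u + L2norm v.
Proof. exact: ler_LnormD. Qed.

Lemma L2normN u : L2norm (- u) = L2norm u.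
Proof. exact: LnormrN. Qed.

Lemma L2normZ a u : L2norm (a *: u) = `|a| * L2norm u.
Proof. by apply: EFin_inj; rewrite EFinM !L2norm_EFin -LnormZ. Qed.

Lemma L2norm0 : L2norm (0 : L2 mu) = 0.
Proof. by rewrite -(scale0r 0) L2normZ normr0 mul0r. Qed.

Lemma L2normB u v : L2norm (u - v) <= L2norm u + L2norm v.
Proof. by rewrite -(L2normN v) L2normD. Qed.

Lemma L2normBC u v : L2norm (u - v) = L2norm (v - u).
Proof. by rewrite -opprB L2normN. Qed.

Lemma L2norm_tri w u v : L2norm (u - v) <= L2norm (u - w) + L2norm (w - v).
Proof. by rewrite (_ : u - v = (u - w) + (w - v)) ?L2normD// addrA subrK. Qed.

Lemma L2norm_le_dist u v : L2norm u <= L2norm v + L2norm (u - v).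
Proof. by have := L2normD v (u - v); rewrite addrC subrK. Qed.

Lemma L2norm_sum (I : Type) (r : seq I) (P : pred I) (F : I -> L2 mu) :
  L2norm (\sum_(i <- r | P i) F i) <= \sum_(i <- r | P i) L2norm (F i).
Proof.
elim/big_rec2: _ => [|i x y _ h]; first by rewrite L2norm0.
by rewrite (le_trans (L2normD _ _))// lerD2l.
Qed.

Lemma L2norm_eq0 u : L2norm u = 0 <-> u = (0 : X -> R) %[ae mu].
Proof.
split=> [u0|u0]; first exact: fine_Lnormr_eq0.
apply/eqP; rewrite -sqrf_eq0; apply/eqP/EFin_inj; rewrite L2norm_sqrE.
rewrite (ae_eq_integral (cst 0%E)) ?integral0//.
  by apply/measurable_EFinP; apply: measurable_funX; exact: measurable_L2.
by apply: filterS u0 => x /(_ I) /= -> _; rewrite expr0n.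
Qed.

Lemma L2norm_sub_eq0 u v : L2norm (u - v) = 0 <-> u = v %[ae mu].
Proof.
rewrite L2norm_eq0; split; apply: filterS => x /(_ I) h _.
  by apply/eqP; rewrite -subr_eq0; apply/eqP.
by transitivity (u x - v x) => //; rewrite h subrr.
Qed.

(** Duality: it is enough to test a vector against all vectors [g], because [u]
    itself is an admissible [g]. *)
Lemma ip_bound_L2norm u c :
  0 <= c -> (forall g, ip u g <= c * L2norm g) -> L2norm u <= c.
Proof.
move=> c0 /(_ u); rewrite -L2norm_sqr expr2.
have := L2norm_ge0 u; rewrite le_eqVlt => /predU1P[<-//|u0].
by rewrite ler_pM2r.
Qed.

Lemma ip_cvg (F : nat -> L2 mu) u g :
  L2norm (F n - u) @[n --> \oo] --> (0 : R) -> ip (F n) g @[n --> \oo] --> ip u g.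
Proof.
move=> Fu; apply/cvgrPdist_le => e e0.
have g1 : 0 < L2norm g + 1 by rewrite ltr_wpDl// L2norm_ge0.
have /cvgrPdist_le/(_ (e / (L2norm g + 1))) := Fu.
rewrite divr_gt0// => /(_ isT); apply: filterS => n.
rewrite sub0r normrN ger0_norm ?L2norm_ge0// ler_pdivlMr// => h.
rewrite distrC -ipBl (le_trans (ip_le _ _))// (le_trans _ h)//.
by rewrite ler_wpM2l ?L2norm_ge0// lerDl.
Qed.

Lemma L2_of_sqr_integrable (f : X -> R) : measurable_fun [set: X] f ->
  (\int[mu]_x (f x ^+ 2)%:E < +oo)%E -> exists u : L2 mu, u =1 f.
Proof.
move=> mf fi; suff Pf : f \in Lfun mu 2%:E by exists (Lfun_Sub (lee1n 2) Pf).
apply/andP; split; rewrite inE//= /finite_norm unlock.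
apply: poweR_lty; under eq_integral => x _.
  rewrite /= powR_mulrn// real_normK ?num_real//; over.
exact: fi.
Qed.

End L2_inner_product.

Lemma cvg0_of_sqr (R : realType) (T : Type) (F : set_system T) {FF : Filter F}
    (f : T -> R) :
  f x ^+ 2 @[x --> F] --> (0 : R) -> f x @[x --> F] --> (0 : R).
Proof.
move=> /cvgrPdist_lt f0; apply/cvgrPdist_lt => e e0.
have /f0 : 0 < e ^+ 2 by rewrite exprn_gt0.
apply: filterS => x; rewrite !sub0r !normrN normrX.
by rewrite ltr_pXn2r// nnegrE ltW.
Qed.

Section L2_completeness.
Context d (X : measurableType d) (R : realType).
Variable mu : {measure set X -> \bar R}.

Lemma L2_abs (u : L2 mu) : exists2 v : L2 mu, (forall x, v x = `|u x|) &
  L2norm v = L2norm u.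
Proof.
have mu_abs : measurable_fun [set: X] (fun x => `|u x|).
  by apply: measurableT_comp => //; exact: measurable_L2.
have [|v vE] := L2_of_sqr_integrable (mu := mu) mu_abs.
  under eq_integral do rewrite real_normK ?num_real//.
  by rewrite -L2norm_sqrE ltry.
exists v => //; apply/eqP.
rewrite -(eqrXn2 (n := 2)) ?L2norm_ge0//; apply/eqP/EFin_inj.
rewrite !L2norm_sqrE; apply: eq_integral => x _.
by rewrite vE real_normK ?num_real.
Qed.

Lemma sum_L2_apply (g : nat -> L2 mu) n x :
  (\sum_(k < n) g k) x = \sum_(k < n) g k x.
Proof.
elim: n => [|n ih]; first by rewrite !big_ord0.
by rewrite !big_ord_recr /= -ih.
Qed.

(** Absolutely convergent series converge in L2 (Riesz-Fischer). By monotone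
    convergence the square of [sum_k |g_k|] is integrable, hence finite almost
    everywhere; there the series converges in R, and its partial sums are
    dominated, so that they also converge in L2. *)
Lemma L2_series_cvg (g : nat -> L2 mu) (M : R) :
  (forall n, \sum_(k < n) L2norm (g k) <= M) ->
  exists G : L2 mu, L2norm (\sum_(k < n) g k - G) @[n --> \oo] --> (0 : R).
Proof.
move=> gM.
pose s n x := \sum_(k < n) `|g k x|.
have s_ge0 n x : 0 <= s n x by apply: sumr_ge0.
have ms n : measurable_fun [set: X] (s n).
  by apply: measurable_sum => k; exact: measurableT_comp.
have nds x : {homo s^~ x : n m / (n <= m)%N >-> n <= m}.
  apply/nondecreasing_seqP => n; rewrite /s big_ord_recr/=.
  by rewrite lerDl.
have s2M n : (\int[mu]_x (s n x ^+ 2)%:E <= (M ^+ 2)%:E)%E.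
  have [f fP] : {f : nat -> L2 mu & forall k, (forall x, f k x = `|g k x|) /\
      L2norm (f k) = L2norm (g k)}.
    apply: (@choice _ _ (fun k (v : L2 mu) => (forall x, v x = `|g k x|) /\
      L2norm v = L2norm (g k))) => k.
    by have [v v1 v2] := L2_abs (g k); exists v.
  rewrite (_ : (\int[mu]_x _)%E = (L2norm (\sum_(k < n) f k) ^+ 2)%:E).
    rewrite lee_fin lerXn2r ?nnegrE ?L2norm_ge0//.
      by rewrite (le_trans _ (gM 0%N))// big_ord0.
    rewrite (le_trans (L2norm_sum _ _ _))//.
    by under eq_bigr do rewrite (fP _).2.
  rewrite L2norm_sqrE; apply: eq_integral => x _; congr (_ ^+ 2)%:E.
  by rewrite sum_L2_apply; apply: eq_bigr => k _; rewrite (fP k).1.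
pose h n x := (s n x ^+ 2)%:E.
have ndh x : {homo h^~ x : n m / (n <= m)%N >-> (n <= m)%E}.
  by move=> n m nm; rewrite lee_fin lerXn2r ?nnegrE//; exact: nds.
have mh n : measurable_fun [set: X] (h n).
  by apply/measurable_EFinP; exact: measurable_funX.
pose S x := ereal_sup (range (h^~ x)).
have hS x : h n x @[n --> \oo] --> S x by exact: ereal_nondecreasing_cvgn.
have leS n x : (h n x <= S x)%E by apply: ereal_sup_ubound; exists n.
have S0 x : (0 <= S x)%E by rewrite (le_trans _ (leS 0%N x))// lee_fin sqr_ge0.
have mS : measurable_fun [set: X] S by apply: emeasurable_fun_cvg mh _ => x _.
have iS : mu.-integrable [set: X] S.
  apply/integrableP; split => //.
  under eq_integral do rewrite gee0_abs//.
  rewrite (_ : (\int[mu]_x S x)%E = limn (fun n => \int[mu]_x h n x)%E).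
    apply: (@le_lt_trans _ _ (M ^+ 2)%:E); last exact: ltry.
    apply: lime_le; last by apply: nearW => n; exact: s2M.
    apply: ereal_nondecreasing_is_cvgn => n m nm.
    apply: ge0_le_integral => // x _; first by rewrite lee_fin sqr_ge0.
    exact: ndh.
  rewrite -monotone_convergence//; last first.
    by move=> n x _; rewrite lee_fin sqr_ge0.
  by apply: eq_integral => x _; apply/esym/cvg_lim => //.
pose E := [set x | S x \is a fin_num].
have mE : measurable E.
  by rewrite -[E]setTI; exact: emeasurable_fin_num.
pose F n x := \1_E x * \sum_(k < n) g k x.
have mF n : measurable_fun [set: X] (F n).
  apply: measurable_funM => //.
  by apply: measurable_sum => k; exact: measurable_L2.
have cF x : cvgn (F^~ x).
  rewrite /F indicE; have [Ex|_] := boolP (x \in E); last first.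
    rewrite (_ : (fun n => _) = cst 0); first exact: is_cvg_cst.
    by apply/funext => n; rewrite mul0r.
  rewrite (_ : (fun n => _) = series (fun k => g k x)).
    apply: normed_cvg; rewrite (_ : [normed _] = s^~ x); last first.
      by apply/funext => n; rewrite /= seriesEord.
    apply: nondecreasing_is_cvgn; first exact: nds.
    exists (1 + fine (S x)) => _ [n _ <-].
    have : s n x ^+ 2 <= fine (S x).
      by rewrite -lee_fin fineK; [exact: leS|rewrite inE in Ex].
    have := s_ge0 n x; nra.
  by apply/funext => n; rewrite /series/= mul1r big_mkord.
pose G x := limn (F^~ x).
have FG x : F n x @[n --> \oo] --> G x by exact: cF.
have mG : measurable_fun [set: X] G by apply: measurable_fun_cvg mF _ => x _.
have F2 m n x : (n <= m)%N -> `|F m x - F n x| <= s m x.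
  move=> nm; rewrite /F -mulrBr normrM.
  apply: (@le_trans _ _ `|\sum_(k < m) g k x - \sum_(k < n) g k x|).
    rewrite -[leRHS]mul1r ler_wpM2r// indicE.
    by case: (_ \in _); rewrite /= ?normr1 ?normr0.
  rewrite -!(big_mkord xpredT (fun k => g k x)) (big_cat_nat (leq0n n) nm)//= addrAC subrr.
  rewrite add0r (le_trans (ler_norm_sum _ _ _))//.
  rewrite /s -(big_mkord xpredT (fun k => `|g k x|)) [leRHS](big_cat_nat (leq0n n) nm)//=.
  by rewrite lerDr sumr_ge0.
have FGS n x : (((F n x - G x) ^+ 2)%:E <= S x)%E.
  have c : ((F m x - F n x) ^+ 2)%:E @[m --> \oo] --> ((G x - F n x) ^+ 2)%:E.
    apply: cvg_EFin; first exact: nearW.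
    rewrite /comp/=; under eq_fun do rewrite expr2; rewrite expr2.
    by apply: cvgM; apply: cvgB => //; exact: cvg_cst.
  rewrite -sqrrN opprB -(cvg_lim _ c)//.
  apply: lime_le; first by apply/cvg_ex; eexists; exact: c.
  near=> m; apply: le_trans (leS m x); rewrite lee_fin.
  rewrite -[leLHS]real_normK ?num_real// lerXn2r ?nnegrE//.
  by apply: F2; near: m; exists n.
have mFG n : measurable_fun [set: X] (fun x => ((F n x - G x) ^+ 2)%:E).
  apply/measurable_EFinP; apply: measurable_funX; exact: measurable_funB.
have mg n : measurable_fun [set: X] (fun x => \sum_(k < n) g k x).
  exact: measurable_sum.
have cFG x : ((F n x - G x) ^+ 2)%:E @[n --> \oo] --> 0%E.
  apply: cvg_EFin; first exact: nearW.
  have c0 : F n x - G x @[n --> \oo] --> (0 : R).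
    by rewrite -(subrr (G x)); apply: cvgB => //; exact: cvg_cst.
  suff : (F n x - G x) * (F n x - G x) @[n --> \oo] --> (0 * 0 : R).
    by rewrite mulr0; under eq_fun do rewrite -expr2.
  exact: cvgM.
have [||||_ _ cI] := @dominated_convergence _ _ _ mu _ measurableT
  (fun n x => ((F n x - G x) ^+ 2)%:E) (cst 0%E) S mFG.
- exact: measurable_cst.
- by apply: aeW => x _; exact: cFG.
- exact: iS.
- by apply: aeW => x n _; rewrite gee0_abs ?lee_fin ?sqr_ge0//; exact: FGS.
rewrite integral0 in cI.
have [|G' G'E] := L2_of_sqr_integrable (mu := mu) mG.
  apply: (@le_lt_trans _ _ (\int[mu]_x S x)%E); last exact: integrable_lty.
  apply: ge0_le_integral => //.
  - by move=> x _; rewrite lee_fin sqr_ge0.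
  - by apply/measurable_EFinP; exact: measurable_funX.
  - by move=> x _; have := FGS 0%N x; rewrite /F big_ord0 mulr0 sub0r sqrrN.
exists G'; apply: cvg0_of_sqr; apply: cvg_trans (fine_cvg cI); apply: near_eq_cvg; apply: nearW => n /=.
rewrite -[RHS]/(fine (L2norm (\sum_(k < n) g k - G') ^+ 2)%:E) L2norm_sqrE.
congr fine; apply: ae_eq_integral => //.
  by apply/measurable_EFinP; exact: measurable_funX.
apply: filterS (integrable_ae measurableT iS) => x /(_ I) Sx _.
congr ((_ ^+ 2)%:E); transitivity ((\sum_(k < n) g k) x - G' x) => //.
by rewrite G'E sum_L2_apply /F indicE mem_set// mul1r.
Unshelve. all: by end_near. Qed.

End L2_completeness.

(** * Bochner integration of L2-valued functions of time *)
Section lower_integral.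
Context d (X : measurableType d) (R : realType).
Variable mu : {measure set X -> \bar R}.
Local Open Scope ereal_scope.

(** The integral of a nonnegative function is a supremum over the simple functions
    below it, so it is monotone even for functions that are not measurable. This
    is needed because Bochner integrands are only almost everywhere equal to
    measurable functions. *)
Lemma integral_patch_le (A B : set X) (f g : X -> \bar R) :
  (forall x, A x -> 0 <= f x) -> (forall x, B x -> 0 <= g x) ->
  (forall x, (f \_ A) x <= (g \_ B) x) ->
  \int[mu]_(x in A) f x <= \int[mu]_(x in B) g x.
Proof.
move=> f0 g0 fg; rewrite !ge0_integralE//=; apply: ereal_sup_le => _ [h hf <-].
by exists h => // x; exact: le_trans (hf x) (fg x).
Qed.

Lemma le_integral_nonmeasurable (A : set X) (f g : X -> \bar R) :
  (forall x, A x -> 0 <= f x) -> (forall x, A x -> f x <= g x) ->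
  \int[mu]_(x in A) f x <= \int[mu]_(x in A) g x.
Proof.
move=> f0 fg; apply: integral_patch_le => // x.
  by move=> Ax; exact: le_trans (f0 _ Ax) (fg _ Ax).
by rewrite !patchE; case: ifPn => // /[!inE]; exact: fg.
Qed.

Lemma ae_le_integral_nonmeasurable (A : set X) (f g : X -> \bar R) :
  measurable A -> measurable_fun A f ->
  (forall x, A x -> 0 <= f x) -> (forall x, A x -> 0 <= g x) ->
  {ae mu, forall x, A x -> f x <= g x} ->
  \int[mu]_(x in A) f x <= \int[mu]_(x in A) g x.
Proof.
move=> mA mf f0 g0 [N [mN N0 fgN]].
rewrite (ge0_negligible_integral mN)//; apply: integral_patch_le => //.
  by move=> x [/f0].
move=> x; rewrite !patchE; case: ifPn => [/[!inE] -[Ax Nx]|_].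
  rewrite ifT ?inE//; apply: contrapT => fg; apply: Nx; apply: fgN => /=.
  by move=> /(_ Ax).
by case: ifPn => // /[!inE]; exact: g0.
Qed.

End lower_integral.

Section lebesgue_almost_everywhere.
Context (R : realType).
Notation leb := (@lebesgue_measure R).

Lemma ae_lebW (P : R -> Prop) : (forall t, P t) -> {ae leb, forall t, P t}.
Proof. by move=> h; exists set0; split => // t /= /(_ (h t)). Qed.

Lemma ae_lebS (P Q : R -> Prop) : (forall t, P t -> Q t) ->
  {ae leb, forall t, P t} -> {ae leb, forall t, Q t}.
Proof.
move=> PQ [N [mN N0 h]]; exists N; split => // t /= nQ; apply: h => /= Pt.
exact/nQ/PQ.
Qed.

End lebesgue_almost_everywhere.

Section Bochner.
Context d (X : measurableType d) (R : realType).
Variable mu : {measure set X -> \bar R}.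
Notation leb := (@lebesgue_measure R).
Implicit Types (D : set R) (f : R -> L2 mu).

Local Arguments sf_set {d X R mu D} s i.
Local Arguments sf_val {d X R mu D} s i.

Lemma ip_sf_eval D (s : simple_fun mu D) t g :
  ip (sf_eval s t) g = \sum_i \1_(sf_set s i) t * ip (sf_val s i) g.
Proof. by rewrite /sf_eval ip_suml; apply: eq_bigr => i _; rewrite ipZl. Qed.

Lemma integrable_sf_indic D (s : simple_fun mu D) i : measurable D ->
  leb.-integrable D (fun t => (\1_(sf_set s i) t)%:E).
Proof.
move=> mD; have mS : measurable (sf_set s i) by exact: sf_measurable.
apply/integrableP; split.
  by apply/measurable_EFinP; exact: measurable_indic.
under eq_integral do rewrite gee0_abs ?lee_fin//.
rewrite integral_indic//.
by rewrite setIidl; [exact: sf_finite|exact: sf_sub].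
Qed.

Lemma integrable_sf_term D (s : simple_fun mu D) g i : measurable D ->
  leb.-integrable D (EFin \o (fun t => \1_(sf_set s i) t * ip (sf_val s i) g)).
Proof.
move=> mD; rewrite (_ : _ \o _ =
    (fun t => (ip (sf_val s i) g)%:E * (\1_(sf_set s i) t)%:E)%E); last first.
  by apply/funext => t /=; rewrite mulrC EFinM.
apply: integrableZl => //; apply: integrable_sf_indic => //.
Qed.

Lemma integrable_ip_sf_eval D (s : simple_fun mu D) g : measurable D ->
  leb.-integrable D (EFin \o (fun t => ip (sf_eval s t) g)).
Proof.
move=> mD; rewrite (_ : _ \o _ = (fun t =>
    \sum_i (\1_(sf_set s i) t * ip (sf_val s i) g)%:E)%E); last first.
  by apply/funext => t; rewrite /= ip_sf_eval sumEFin.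
by apply: integrable_sum => // i _; exact: integrable_sf_term.
Qed.

Lemma Rintegral_ip_sf_eval D (s : simple_fun mu D) g : measurable D ->
  \int[leb]_(t in D) ip (sf_eval s t) g = ip (sf_integral s) g.
Proof.
move=> mD; rewrite /sf_integral ip_suml.
apply: EFin_inj; rewrite fineK; last first.
  by apply: integrable_fin_num => //; exact: integrable_ip_sf_eval.
under eq_integral do rewrite ip_sf_eval -sumEFin.
rewrite integral_sum//; last by move=> i; exact: integrable_sf_term.
rewrite -sumEFin; apply: eq_bigr => i _.
rewrite ipZl mulrC; under eq_integral do rewrite mulrC EFinM.
rewrite integralZl//; last exact: integrable_sf_indic.
rewrite integral_indic//; last exact: sf_measurable.
rewrite setIidl; last exact: sf_sub.
rewrite EFinM; congr (_ * _)%E.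
by rewrite fineK// ge0_fin_numE//; exact: sf_finite.
Qed.

(** A Bochner integral is computed weakly, by integrating inner products. The
    integrand may be replaced by an almost everywhere equal one: weak derivatives
    are known only up to null sets of times. *)
Lemma bochner_ip D f f' (I g : L2 mu) : measurable D ->
  is_bochner_integral D f I ->
  {ae leb, forall t, D t -> L2norm (f t - f' t) = 0} ->
  leb.-integrable D (EFin \o (fun t => ip (f' t) g)) ->
  ip I g = \int[leb]_(t in D) ip (f' t) g.
Proof.
move=> mD [_ [s [sf sI]]] ff' if'.
have c0 : 0 < L2norm g + 1 by rewrite ltr_wpDl// L2norm_ge0.
have h n : ((`|ip (sf_integral (s n)) g - \int[leb]_(t in D) ip (f' t) g| /
    (L2norm g + 1))%:E <=
    \int[leb]_(t in D) (L2norm (f t - sf_eval (s n) t))%:E)%E.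
  have i1 := integrable_ip_sf_eval (s n) g mD.
  rewrite -Rintegral_ip_sf_eval// -RintegralB//.
  set k := (fun t => ip (sf_eval (s n) t) g - ip (f' t) g).
  have ik : leb.-integrable D (EFin \o k).
    by rewrite (_ : _ \o _ = (EFin \o (fun t => ip (sf_eval (s n) t) g)) \-
      (EFin \o (fun t => ip (f' t) g)))%E//; exact: integrableB.
  have ikc : leb.-integrable D (EFin \o (fun t => k t * (L2norm g + 1)^-1)).
    rewrite (_ : _ \o _ = (fun t => (EFin \o k) t * ((L2norm g + 1)^-1)%:E)%E)//.
    exact: integrableZr.
  rewrite -[X in (_ / X)%:E](gtr0_norm c0) -normfV -normrM -RintegralZr//.
  rewrite EFin_normr_Rintegral//.
  have mkc := measurable_int _ ikc.
  apply: le_trans; first exact: le_abse_integral.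
  apply: ae_le_integral_nonmeasurable => //.
  - by exact: measurableT_comp.
  - by move=> t _; rewrite lee_fin L2norm_ge0.
  apply: ae_lebS ff' => t /[apply] ft; rewrite lee_fin normrM normfV.
  rewrite (gtr0_norm c0) ler_pdivrMr// /k -ipBl (le_trans (ip_le _ _))//.
  apply: ler_pM; rewrite ?L2norm_ge0// ?lerDl//.
  by rewrite (le_trans (L2norm_tri (f t) _ _))// ft addr0 L2normBC.
have l1 : ip (sf_integral (s n)) g @[n --> \oo] --> ip I g by exact: ip_cvg.
suff : ip (sf_integral (s n)) g @[n --> \oo] --> \int[leb]_(t in D) ip (f' t) g.
  by move/(cvg_unique _ l1); apply.
apply/cvgrPdist_le => e e0.
have e1 : 0 < e / (L2norm g + 1) by rewrite divr_gt0.
have /fine_cvgP[_ /cvgrPdist_le/(_ _ e1)] := sf.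
have /fine_cvgP[+ _] := sf; apply: filterS2 => n fn.
rewrite sub0r normrN ger0_norm ?fine_ge0 ?integral_ge0//; last first.
  by move=> t _; rewrite lee_fin L2norm_ge0.
rewrite -lee_fin fineK// => /(le_trans (h n)); rewrite lee_fin.
by rewrite ler_pM2r ?invr_gt0// distrC.
Qed.

Lemma bochner_unique_ip D f (I g : L2 mu) : measurable D ->
  is_bochner_integral D f I ->
  leb.-integrable D (EFin \o (fun t => ip (f t) g)) ->
  ip I g = \int[leb]_(t in D) ip (f t) g.
Proof.
move=> mD fI fint; have ff : {ae leb, forall t, D t -> L2norm (f t - f t) = 0}.
  by apply: ae_lebW => t _; rewrite subrr L2norm0.
exact: bochner_ip mD fI ff fint.
Qed.

End Bochner.

Section integrals_of_continuous_functions.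
Variables (R : realType) (T : R).
Hypothesis T_gt0 : 0 < T.
Notation leb := (@lebesgue_measure R).
Implicit Types f g : R -> R.

Lemma measurable_itv_continuous (phi : R -> R) :
  {within `[0, T], continuous phi} -> measurable_fun `[0, T] phi.
Proof. by move=> cphi; exact: subspace_continuous_measurable_fun. Qed.

Lemma integrable_itv_continuous (phi : R -> R) :
  {within `[0, T], continuous phi} -> leb.-integrable `[0, T] (EFin \o phi).
Proof. by apply: continuous_compact_integrable; exact: segment_compact. Qed.

Lemma leb_itv_lty : (leb `[0%R, T] < +oo)%E.
Proof. by rewrite lebesgue_measure_itv/=; case: ifP => _; rewrite -?EFinD ltry. Qed.

Lemma fine_leb_itv : fine (leb `[0%R, T]) = T.
Proof. by rewrite lebesgue_measure_itv/= lte_fin T_gt0/= subr0. Qed.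

Lemma Rintegral_itvD f g :
  {within `[0, T], continuous f} -> {within `[0, T], continuous g} ->
  \int[leb]_(t in `[0, T]) (f t + g t) =
  \int[leb]_(t in `[0, T]) f t + \int[leb]_(t in `[0, T]) g t.
Proof.
move=> /integrable_itv_continuous cf /integrable_itv_continuous cg.
exact: RintegralD.
Qed.

Lemma Rintegral_itvZr f c : {within `[0, T], continuous f} ->
  \int[leb]_(t in `[0, T]) (f t * c) = \int[leb]_(t in `[0, T]) f t * c.
Proof. by move=> /integrable_itv_continuous cf; exact: RintegralZr. Qed.

Lemma Rintegral_itv_sub f g :
  {within `[0, T], continuous f} -> {within `[0, T], continuous g} ->
  \int[leb]_(t in `[0, T]) (f t - g t) =
  \int[leb]_(t in `[0, T]) f t - \int[leb]_(t in `[0, T]) g t.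
Proof.
move=> /integrable_itv_continuous cf /integrable_itv_continuous cg.
exact: RintegralB.
Qed.

Lemma le_Rintegral_itv f b : {within `[0, T], continuous f} ->
  (forall t, t \in `[0, T] -> `|f t| <= b) ->
  `|\int[leb]_(t in `[0, T]) f t| <= b * T.
Proof.
move=> /integrable_itv_continuous ih hb.
apply: le_trans; first exact: le_normr_Rintegral.
have -> : b * T = \int[leb]_(t in `[0, T]) b.
  by rewrite Rintegral_cst//; congr (_ * _); exact/esym/fine_leb_itv.
apply: le_Rintegral => //; first exact: integrable_norm.
apply: integrable_itv_continuous; apply: continuous_subspaceT => x.
exact: cvg_cst.
Qed.

End integrals_of_continuous_functions.

Section continuous_curves.
Context d (X : measurableType d) (R : realType).
Variable mu : {measure set X -> \bar R}.
Notation leb := (@lebesgue_measure R).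
Variables (T : R) (T_gt0 : 0 < T).
Implicit Types (f : R -> L2 mu).

Local Arguments sf_set {d X R mu D} s i.
Local Arguments sf_val {d X R mu D} s i.

(** Composition of a continuous curve with a Lipschitz functional. *)
Lemma L2_continuous_within (D : set R) f (phi : L2 mu -> R) (c : R) :
  L2_continuous_on D f ->
  (forall u v, `|phi u - phi v| <= c * L2norm (u - v)) ->
  {within D, continuous (fun t => phi (f t))}.
Proof.
move=> fc phic; apply/subspace_continuousP => t Dt.
have c1 : 0 < `|c| + 1 by rewrite ltr_wpDl.
apply/cvgrPdist_le => e e0.
have /cvgrPdist_le/(_ (e / (`|c| + 1))) := fc t Dt.
rewrite divr_gt0// => /(_ isT); apply: filterS => s.
rewrite sub0r normrN ger0_norm ?L2norm_ge0// ler_pdivlMr// => h.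
rewrite distrC (le_trans (phic _ _))// (le_trans _ h)// mulrC.
rewrite ler_wpM2l ?L2norm_ge0// (le_trans (ler_norm _))// lerDl//.
Qed.

Lemma continuous_ip (D : set R) f g : L2_continuous_on D f ->
  {within D, continuous (fun t => ip (f t) g)}.
Proof.
move=> fc; apply: (L2_continuous_within (phi := fun u => ip u g) fc) => u v.
by rewrite -ipBl mulrC; exact: ip_le.
Qed.

Lemma L2norm_dist (u v : L2 mu) : `|L2norm u - L2norm v| <= L2norm (u - v).
Proof.
rewrite ler_norml lerBlDl lerBrDl L2norm_le_dist andbT.
have := L2norm_le_dist v u; rewrite L2normBC => h.
by rewrite lerBlDr.
Qed.

Lemma continuous_L2norm_sub (D : set R) f v : L2_continuous_on D f ->
  {within D, continuous (fun t => L2norm (f t - v))}.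
Proof.
move=> fc; pose phi := fun u : L2 mu => L2norm (u - v).
apply: (L2_continuous_within (phi := phi) (c := 1) fc) => u w.
rewrite mul1r (le_trans (L2norm_dist _ _))// opprB addrA subrK lexx//.
Qed.

Lemma continuous_L2norm (D : set R) f : L2_continuous_on D f ->
  {within D, continuous (fun t => L2norm (f t))}.
Proof.
move=> fc; have := continuous_L2norm_sub (v := 0) fc.
by under eq_fun do rewrite subr0.
Qed.

Lemma L2_continuous_bounded f : L2_continuous_on `[0, T] f ->
  exists2 M : R, 0 <= M & forall t, t \in `[0, T] -> L2norm (f t) <= M.
Proof.
move=> /continuous_L2norm /(EVT_max (ltW T_gt0)) [c _ cM].
by exists (L2norm (f c)); first exact: L2norm_ge0.
Qed.

Let h n : R := T / n.+1%:R.

Let h_gt0 n : 0 < h n. Proof. by rewrite divr_gt0. Qed.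

Let cell n (i : nat) : set R := `[0, T] `&` `[i%:R * h n, i.+1%:R * h n[.

Let mcell n i : measurable (cell n i). Proof. exact: measurableI. Qed.

Let cell_finite n i : (leb (cell n i) < +oo)%E.
Proof.
apply: (@le_lt_trans _ _ (leb `[0%R, T])); last exact: leb_itv_lty.
by apply: le_measure; rewrite ?inE//; [exact: mcell|exact: subIsetl].
Qed.

(** The step function of [f] on the grid of mesh [T / n.+1]. There is one cell
    more than [n.+1], which contains only the end point [T]. *)
Definition riemann_sf f n : simple_fun mu `[0, T] :=
  @SimpleFun _ _ _ mu `[0, T] n.+2 (fun i => cell n i) (fun i => f (i%:R * h n))
    (fun i => @subIsetl _ _ _) (fun i => mcell n i) (fun i => cell_finite n i).

(** The index of the cell that contains [t], and below the node at its left end. *)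
Let idx n t : nat := Num.trunc (t / h n).

Let cellP n i t : t \in `[0, T] -> (t \in cell n i) = (i == idx n t).
Proof.
move=> tT; have /andP[t0 tT'] : 0 <= t <= T by rewrite in_itv in tT.
rewrite eq_sym /idx truncn_eq; last by rewrite divr_ge0// ltW.
rewrite ler_pdivlMr// ltr_pdivrMr//; apply/idP/idP.
  by rewrite inE => -[_] /=; rewrite in_itv.
by move=> H; rewrite inE; split => //=; rewrite in_itv.
Qed.

Let idx_lt n t : t \in `[0, T] -> (idx n t < n.+2)%N.
Proof.
rewrite in_itv/= => /andP[t0 tT]; rewrite ltnS -(ler_nat R).
apply: (@le_trans _ _ (t / h n)).
  by have /andP[] := @truncn_itv _ (t / h n) (divr_ge0 t0 (ltW (h_gt0 n))).
by rewrite ler_pdivrMr// /h mulrCA divff ?mulr1// pnatr_eq0.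
Qed.

Let node n t : R := (idx n t)%:R * h n.

Let node_bounds n t : t \in `[0, T] -> 0 <= node n t <= t /\ t - node n t <= h n.
Proof.
rewrite in_itv/= => /andP[t0 tT].
have /andP[] := @truncn_itv _ (t / h n) (divr_ge0 t0 (ltW (h_gt0 n))).
rewrite ler_pdivlMr// ltr_pdivrMr// -/(idx n t) -/(node n t) => h1 h2.
split; first by rewrite h1 andbT mulr_ge0// ltW.
by rewrite lerBlDl; move: h2; rewrite -natr1 mulrDl mul1r => /ltW.
Qed.

Let node_cvg t : t \in `[0, T] ->
  node n t @[n --> \oo] --> within `[0, T] (nbhs t).
Proof.
move=> tT U; rewrite /within/= => -[e /= e0 eU].
have : h n @[n --> \oo] --> (0 : R).
  by rewrite -(mulr0 T); apply: cvgMr; exact: cvg_harmonic.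
move=> /cvgrPdist_lt/(_ _ e0); apply: filterS => n.
rewrite sub0r normrN ger0_norm ?ltW// => hn.
have [/andP[n0 nt] tn] := node_bounds n tT.
apply: eU => /=; last first.
  by move: tT; rewrite !in_itv/= n0 => /andP[_] /(le_trans nt).
by rewrite ger0_norm ?subr_ge0// (le_lt_trans tn).
Qed.

Let sum_cell (V : lmodType R) n t (F : nat -> V) : t \in `[0, T] ->
  \sum_(i < n.+2) \1_(cell n i) t *: F i = F (idx n t).
Proof.
move=> tT; rewrite (bigD1 (Ordinal (idx_lt n tT)))//= big1 => [|i].
  by rewrite indicE cellP// eqxx scale1r addr0.
rewrite -val_eqE/= indicE cellP// => /negbTE ->.
by rewrite scale0r.
Qed.

Let riemann_sf_eval f n t : t \in `[0, T] ->
  sf_eval (riemann_sf f n) t = f (node n t).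
Proof. by move=> tT; exact: (sum_cell n (fun i => f (i%:R * h n))). Qed.

Let riemann_sf_cvg f t : L2_continuous_on `[0, T] f -> t \in `[0, T] ->
  L2norm (f t - sf_eval (riemann_sf f n) t) @[n --> \oo] --> (0 : R).
Proof.
move=> fc tT; under eq_fun do rewrite riemann_sf_eval// L2normBC.
exact: cvg_comp (node_cvg tT) (fc t tT).
Qed.

Let measurable_riemann_sf f n : L2_continuous_on `[0, T] f ->
  measurable_fun `[0, T] (fun t => L2norm (f t - sf_eval (riemann_sf f n) t)).
Proof.
move=> fc; apply: (@eq_measurable_fun _ _ _ _ _ (fun t =>
    \sum_(i < n.+2) \1_(cell n i) t * L2norm (f t - f (i%:R * h n)))).
  move=> t; rewrite inE => tT.
  rewrite riemann_sf_eval//.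
  exact: (sum_cell (V := R^o) n (fun i => L2norm (f t - f (i%:R * h n)))).
apply: measurable_sum => i; apply: measurable_funM.
  by apply: measurable_indic; exact: mcell.
by apply: measurable_itv_continuous; exact: continuous_L2norm_sub.
Qed.

Lemma continuous_strongly_measurable f : L2_continuous_on `[0, T] f ->
  strongly_measurable `[0, T] f.
Proof.
move=> fc; exists (riemann_sf f); apply: ae_lebW => t tT.
exact: riemann_sf_cvg.
Qed.

Lemma continuous_L2_in_time f : L2_continuous_on `[0, T] f ->
  L2_in_time `[0, T] f.
Proof.
move=> fc; split; first exact: continuous_strongly_measurable.
have [M M0 fM] := L2_continuous_bounded fc.
apply: (@le_lt_trans _ _ (\int[leb]_(t in `[0%R, T]) (M ^+ 2)%:E)%E).
  apply: le_integral_nonmeasurable => t tT; first by rewrite lee_fin sqr_ge0.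
  by rewrite lee_fin lerXn2r ?nnegrE ?L2norm_ge0// fM.
rewrite integral_cst//; apply: lte_mul_pinfty => //; first exact: sqr_ge0.
exact: leb_itv_lty.
Qed.

(** A continuous curve has a Bochner integral as soon as some vector [I] is a weak
    integral: the Riemann sums approximate the curve in mean by dominated
    convergence, and by duality their integrals are as close to [I]. *)
Lemma bochner_of_weak f (I : L2 mu) : L2_continuous_on `[0, T] f ->
  (forall g, ip I g = \int[leb]_(t in `[0, T]) ip (f t) g) ->
  is_bochner_integral `[0, T] f I.
Proof.
move=> fc fI; split; first exact: continuous_strongly_measurable.
exists (riemann_sf f).
have [M M0 fM] := L2_continuous_bounded fc.
pose e n t := L2norm (f t - sf_eval (riemann_sf f n) t).
have e2M n t : t \in `[0, T] -> e n t <= M *+ 2.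
  move=> tT; rewrite /e riemann_sf_eval// (le_trans (L2normB _ _))//.
  rewrite mulr2n lerD ?fM//.
  have [/andP[n0 nt] tn] := node_bounds n tT.
  by move: tT; rewrite !in_itv/= n0 => /andP[_] /(le_trans nt).
have me n : measurable_fun `[0, T] (EFin \o e n).
  by apply/measurable_EFinP; exact: measurable_riemann_sf.
have icst : leb.-integrable `[0, T] (EFin \o cst (M *+ 2)).
  apply: integrable_itv_continuous; apply: continuous_subspaceT => x.
  exact: cvg_cst.
have [||||_ _ cI] := @dominated_convergence _ _ _ leb `[0, T]
  (measurable_itv _) (fun n => EFin \o e n) (cst 0%E) (EFin \o cst (M *+ 2)) me.
- exact: measurable_cst.
- apply: ae_lebW => t tT; apply: cvg_EFin; first exact: nearW.
  exact: riemann_sf_cvg.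
- exact: icst.
- apply: ae_lebW => t n tT.
  by rewrite /= lee_fin ger0_norm ?L2norm_ge0//; exact: e2M.
rewrite integral0 in cI; split; first exact: cI.
have ie n : leb.-integrable `[0, T] (EFin \o e n).
  apply: (le_integrable _ _ _ icst) => //; first exact: me.
  move=> t tT.
  rewrite /= lee_fin ger0_norm ?L2norm_ge0// (le_trans (e2M n _ tT))//.
  exact: ler_norm.
have Ie n : L2norm (sf_integral (riemann_sf f n) - I) <=
    \int[leb]_(t in `[0, T]) e n t.
  apply: ip_bound_L2norm.
    by apply: Rintegral_ge0 => t _; exact: L2norm_ge0.
  move=> g.
  have i1 := integrable_ip_sf_eval (riemann_sf f n) g (measurable_itv `[0, T]).
  have i2 : leb.-integrable `[0, T] (EFin \o (fun t => ip (f t) g)).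
    by apply: integrable_itv_continuous; exact: continuous_ip.
  rewrite ipBl fI -Rintegral_ip_sf_eval// -RintegralB// -RintegralZr//.
  apply: le_Rintegral => //.
  - rewrite (_ : _ \o _ = (EFin \o (fun t => ip (sf_eval (riemann_sf f n) t) g))
      \- (EFin \o (fun t => ip (f t) g)))%E//; exact: integrableB.
  - rewrite (_ : _ \o _ = (fun t => (EFin \o e n) t * (L2norm g)%:E)%E)//.
    exact: integrableZr.
  - move=> t _; rewrite -ipBl (le_trans (ler_norm _))// (le_trans (ip_le _ _))//.
    by rewrite L2normBC.
apply: (squeeze_cvgr (f := cst 0) (h := fun n => \int[leb]_(t in `[0, T]) e n t)).
- by apply: nearW => n; rewrite L2norm_ge0 Ie.
- exact: cvg_cst.
- exact: (fine_cvg cI).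
Qed.

End continuous_curves.

(** * Exponentials of bounded operators *)
Section exp_series.
Variable R : realType.

(** The coefficient of the exponential series at time [t]. *)
Definition mono (k : nat) (t : R) : R := t ^+ k / k`!%:R.

Lemma mono_ge0 k t : 0 <= t -> 0 <= mono k t.
Proof. by move=> t0; rewrite divr_ge0// exprn_ge0. Qed.

Lemma le_mono k s t : 0 <= s -> s <= t -> mono k s <= mono k t.
Proof.
move=> s0 st; rewrite ler_pM2r ?invr_gt0 ?ltr0n ?fact_gt0//.
by rewrite lerXn2r// nnegrE (le_trans s0).
Qed.

Lemma sum_mono_le_expR n (t : R) : 0 <= t -> \sum_(k < n) mono k t <= expR t.
Proof.
move=> t0; rewrite -(big_mkord xpredT (fun k => mono k t)).
have := @nondecreasing_cvgn_le R (series (exp_coeff t)) _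
  (is_cvg_series_exp_coeff t) n.
rewrite /series/= /exp_coeff; apply.
apply/nondecreasing_seqP => m.
by rewrite /= big_nat_recr//= lerDl; exact: exp_coeff_ge0.
Qed.

Lemma sum_mono_cvg (t : R) : \sum_(k < n) mono k t @[n --> \oo] --> expR t.
Proof.
under eq_fun do rewrite -(big_mkord xpredT (fun k => mono k t)).
exact: is_cvg_series_exp_coeff.
Qed.

Lemma continuous_mono k : continuous (mono k).
Proof.
by move=> t; apply: cvgMl; exact: exprn_continuous.
Qed.

End exp_series.

Section analytic_curves.
Context d (X : measurableType d) (R : realType).
Variable mu : {measure set X -> \bar R}.
Notation leb := (@lebesgue_measure R).
Variables (T : R) (T_gt0 : 0 < T).
Implicit Types (w : nat -> L2 mu) (U : R -> L2 mu).

Definition taylor w n t : L2 mu := \sum_(k < n) mono k t *: w k.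

(** [w k] is the k-th derivative at 0 of the curve [U], which is the sum of its
    Taylor series on [[0, T]]. *)
Definition has_taylor w U := forall t, t \in `[0, T] ->
  L2norm (taylor w n t - U t) @[n --> \oo] --> (0 : R).

Lemma L2norm_lim_le (F : nat -> L2 mu) (u v : L2 mu) b :
  L2norm (F n - u) @[n --> \oo] --> (0 : R) ->
  (\forall n \near \oo, L2norm (F n - v) <= b) -> L2norm (u - v) <= b.
Proof.
move=> Fu Fv; rewrite -[b]add0r.
have c : L2norm (F n - u) + b @[n --> \oo] --> 0 + b.
  by apply: cvgD => //; exact: cvg_cst.
rewrite -(cvg_lim _ c)//; apply: limr_ge.
  by apply/cvg_ex; exists (0 + b).
apply: filterS Fv => n Fn; rewrite (le_trans (L2norm_tri (F n) _ _))//.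
by rewrite L2normBC lerD.
Qed.

Lemma L2norm_lim_le0 (F : nat -> L2 mu) (u : L2 mu) b :
  L2norm (F n - u) @[n --> \oo] --> (0 : R) ->
  (\forall n \near \oo, L2norm (F n) <= b) -> L2norm u <= b.
Proof.
move=> Fu Fb; rewrite -[u]subr0; apply: L2norm_lim_le Fu _.
by apply: filterS Fb => n; rewrite subr0.
Qed.

Section with_bound.
Variables (w : nat -> L2 mu) (K c : R) (c_ge0 : 0 <= c) (K_ge0 : 0 <= K).
Hypothesis w_le : forall k, L2norm (w k) <= K * c ^+ k.

Lemma L2norm_term_le k t : 0 <= t <= T ->
  L2norm (mono k t *: w k) <= K * mono k (c * T).
Proof.
move=> /andP[t0 tT]; rewrite L2normZ ger0_norm ?mono_ge0//.
apply: (@le_trans _ _ (mono k T * (K * c ^+ k))).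
  by rewrite ler_pM ?mono_ge0 ?L2norm_ge0// le_mono.
by rewrite /mono exprMn [leRHS](_ : _ = T ^+ k / k`!%:R * (K * c ^+ k))//; ring.
Qed.

Lemma sum_L2norm_le n t : 0 <= t <= T ->
  \sum_(k < n) L2norm (mono k t *: w k) <= K * expR (c * T).
Proof.
move=> tT; apply: (@le_trans _ _ (K * \sum_(k < n) mono k (c * T))).
  by rewrite mulr_sumr ler_sum// => k _; exact: L2norm_term_le.
by rewrite ler_wpM2l// sum_mono_le_expR// mulr_ge0// ltW.
Qed.

Lemma taylor_limit_exists : exists U, has_taylor w U.
Proof.
have : forall t, exists u : L2 mu, t \in `[0, T] ->
    L2norm (taylor w n t - u) @[n --> \oo] --> (0 : R).
  move=> t; have [tT|tT] := boolP (t \in `[0, T]); last by exists 0.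
  have [u uP] := @L2_series_cvg _ X R mu (fun k => mono k t *: w k) _
    (fun n => sum_L2norm_le n tT).
  by exists u.
by move=> /choice[U UP]; exists U => t; exact: UP.
Qed.

Variables (U : R -> L2 mu) (wU : has_taylor w U).

(** The remainder after [n] terms of [K * expR (c * T)], which dominates the
    remainder of the Taylor series uniformly in time. *)
Definition taylor_tail n := K * (expR (c * T) - \sum_(k < n) mono k (c * T)).

Lemma taylor_tail_cvg : taylor_tail n @[n --> \oo] --> (0 : R).
Proof.
rewrite -(mulr0 K) -(subrr (expR (c * T))).
apply: cvgMr; apply: cvgB; first exact: cvg_cst.
exact: sum_mono_cvg.
Qed.

Lemma taylor_error n t : t \in `[0, T] ->
  L2norm (U t - taylor w n t) <= taylor_tail n.
Proof.
move=> tT; apply: L2norm_lim_le (wU tT) _.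
near=> m.
have nm : (n <= m)%N by near: m; exists n.
rewrite /taylor -!(big_mkord xpredT (fun k => mono k t *: w k)).
rewrite (big_cat_nat (leq0n n) nm)//= addrAC subrr add0r.
rewrite (le_trans (L2norm_sum _ _ _))//.
apply: (@le_trans _ _ (\sum_(n <= k < m) K * mono k (c * T))).
  by apply: ler_sum => k _; exact: L2norm_term_le.
rewrite -mulr_sumr /taylor_tail ler_wpM2l// lerBrDl.
rewrite -(big_mkord xpredT (fun k => mono k (c * T))).
rewrite -big_cat_nat//= big_mkord sum_mono_le_expR// mulr_ge0// ltW//.
Unshelve. all: by end_near. Qed.

Lemma L2norm_taylor_limit t : t \in `[0, T] -> L2norm (U t) <= K * expR (c * T).
Proof.
move=> tT; apply: L2norm_lim_le0 (wU tT) _; apply: nearW => n.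
by rewrite (le_trans (L2norm_sum _ _ _))// sum_L2norm_le//.
Qed.

Lemma taylor_continuous n t :
  L2norm (taylor w n s - taylor w n t) @[s --> t] --> (0 : R).
Proof.
apply: (squeeze_cvgr (f := cst 0)
  (h := fun s => \sum_(k < n) `|mono k s - mono k t| * L2norm (w k))).
- apply: nearW => s; rewrite L2norm_ge0/= /taylor -sumrB.
  rewrite (le_trans (L2norm_sum _ _ _))// ler_sum// => k _.
  by rewrite -scalerBl L2normZ.
- exact: cvg_cst.
- rewrite [X in _ --> X](_ : _ = \sum_(k < n) `|mono k t - mono k t| * L2norm (w k)).
    apply: cvg_big => [|k _]; first exact: add_continuous.
    apply: cvgMl; apply: cvg_norm.
    by apply: cvgB; [exact: continuous_mono|exact: cvg_cst].
  by rewrite big1// => k _; rewrite subrr normr0 mul0r.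
Qed.

(** A uniform limit of polynomials in [t]. *)
Lemma taylor_limit_continuous : L2_continuous_on `[0, T] U.
Proof.
move=> t tT; apply/cvgrPdist_le => e e0.
have e3 : 0 < e / 3 by rewrite divr_gt0.
have /cvgrPdist_le/(_ _ e3) := taylor_tail_cvg.
move=> [n _ /(_ n (leqnn n))]; rewrite sub0r normrN => tn.
have {}tn : taylor_tail n <= e / 3 by rewrite (le_trans (ler_norm _)).
have /cvgrPdist_le/(_ _ e3) := taylor_continuous n t.
rewrite /within/=; apply: filterS => s.
rewrite !sub0r !normrN !(ger0_norm (L2norm_ge0 _)) => st sT.
rewrite (le_trans (L2norm_tri (taylor w n s) _ _))//.
have h1 := le_trans (taylor_error n sT) tn.
have h2 := le_trans (taylor_error n tT) tn.
have h3 := L2norm_tri (taylor w n t) (taylor w n s) (U t).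
rewrite L2normBC in h2; lra.
Qed.

Lemma taylor_L2_continuous n : L2_continuous_on `[0, T] (taylor w n).
Proof. by move=> t _; apply: cvg_within_filter; exact: taylor_continuous. Qed.

Variables (phi : R -> R) (M : R).
Hypothesis cphi : {within `[0, T], continuous phi}.
Hypothesis phiM : forall t, t \in `[0, T] -> `|phi t| <= M.

Definition moment k := \int[leb]_(t in `[0, T]) (phi t * mono k t).

Lemma continuous_mul_mono k :
  {within `[0, T], continuous (fun t => phi t * mono k t)}.
Proof.
move=> t; apply: cvgM; first exact: cphi.
by apply: continuous_subspaceT; exact: continuous_mono.
Qed.

Lemma continuous_mul_ip (W : R -> L2 mu) g : L2_continuous_on `[0, T] W ->
  {within `[0, T], continuous (fun t => phi t * ip (W t) g)}.
Proof. by move=> cW t; apply: cvgM; [exact: cphi|exact: continuous_ip]. Qed.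

Lemma ip_moments n g : ip (\sum_(k < n) moment k *: w k) g =
  \int[leb]_(t in `[0, T]) (phi t * ip (taylor w n t) g).
Proof.
elim: n => [|n ih].
  rewrite big_ord0 ip0l; under eq_Rintegral => t _.
    rewrite /taylor big_ord0 ip0l mulr0; over.
  by rewrite Rintegral_cst// mul0r.
have c1 := continuous_mul_ip (g := g) (@taylor_L2_continuous n).
have c2 : {within `[0, T], continuous (fun t => phi t * mono n t * ip (w n) g)}.
  by move=> t; apply: cvgMl; exact: continuous_mul_mono.
rewrite big_ord_recr/= ipDl ih ipZl /moment.
rewrite -(Rintegral_itvZr _ (@continuous_mul_mono n)) -(Rintegral_itvD c1 c2).
apply: eq_Rintegral => t _.
by rewrite /taylor big_ord_recr/= ipDl ipZl; ring.
Qed.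

Lemma ip_moments_cvg g : ip (\sum_(k < n) moment k *: w k) g @[n --> \oo] -->
  \int[leb]_(t in `[0, T]) (phi t * ip (U t) g).
Proof.
have c1 n := continuous_mul_ip (g := g) (@taylor_L2_continuous n).
have c2 := continuous_mul_ip (g := g) taylor_limit_continuous.
have M0 : 0 <= M.
  have := phiM (t := 0); rewrite in_itv/= lexx (ltW T_gt0) => /(_ isT).
  exact: le_trans.
apply/cvgrPdist_le => e e0.
have : taylor_tail n * (M * L2norm g * T) @[n --> \oo] --> 0 * (M * L2norm g * T).
  by apply: cvgMl; exact: taylor_tail_cvg.
rewrite mul0r => /cvgrPdist_le/(_ _ e0); apply: filterS => n.
rewrite sub0r normrN => /(le_trans (ler_norm _)); apply: le_trans.
rewrite ip_moments -(Rintegral_itv_sub c2 (c1 n)) mulrA.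
apply: le_Rintegral_itv => //.
  by move=> t; apply: cvgB; [exact: c2|exact: c1].
move=> t tT; rewrite -mulrBr -ipBl normrM mulrC.
rewrite (mulrCA _ M) mulrC ler_pM// ?phiM// (le_trans (ip_le _ _))//.
by rewrite ler_wpM2r ?L2norm_ge0// taylor_error.
Qed.

(** The integral of [phi * U] can be computed term by term; the L2 vector that it
    defines is the sum of the series of moments of [phi]. *)
Lemma moments_cvg : exists2 I : L2 mu,
  L2norm (\sum_(k < n) moment k *: w k - I) @[n --> \oo] --> (0 : R) &
  forall g, ip I g = \int[leb]_(t in `[0, T]) (phi t * ip (U t) g).
Proof.
have M0 : 0 <= M.
  have := phiM (t := 0); rewrite in_itv/= lexx (ltW T_gt0) => /(_ isT).
  exact: le_trans.
have mk k : `|moment k| <= M * T * mono k T.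
  rewrite mulrAC; apply: le_Rintegral_itv => //.
    exact: continuous_mul_mono.
  move=> t tT; rewrite normrM ler_pM ?phiM//.
  move: tT; rewrite in_itv/= => /andP[t0 tT].
  by rewrite ger0_norm ?mono_ge0// le_mono.
have [n|I IP] := @L2_series_cvg _ X R mu (fun k => moment k *: w k)
    (M * T * (K * expR (c * T))).
  apply: (@le_trans _ _ (M * T * \sum_(k < n) K * mono k (c * T))).
    rewrite mulr_sumr ler_sum// => k _; rewrite L2normZ.
    apply: (@le_trans _ _ (M * T * mono k T * (K * c ^+ k))).
      by rewrite ler_pM ?L2norm_ge0.
    by rewrite /mono exprMn [leRHS](_ : _ =
      M * T * (T ^+ k / k`!%:R) * (K * c ^+ k))//; ring.
  rewrite -mulr_sumr !ler_wpM2l ?mulr_ge0 ?(ltW T_gt0)//.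
  by rewrite sum_mono_le_expR// mulr_ge0// ltW.
exists I => // g.
by move: (@ip_moments_cvg g) => /(cvg_unique _ (@ip_cvg _ _ _ _ _ _ g IP)); apply.
Qed.

End with_bound.

End analytic_curves.

(** * The linear evolution equation driven by a bounded operator *)
Section bounded_operators.
Context d (X : measurableType d) (R : realType).
Variable mu : {measure set X -> \bar R}.
Notation leb := (@lebesgue_measure R).

Record bounded_op (A : L2 mu -> L2 mu) (c : R) : Prop := BoundedOp {
  bop_ge0 : 0 <= c ;
  bop_add : forall u v, L2norm (A (u + v) - (A u + A v)) = 0 ;
  bop_scale : forall a u, L2norm (A (a *: u) - a *: A u) = 0 ;
  bop_le : forall u, L2norm (A u) <= c * L2norm u
}.

Variables (A : L2 mu -> L2 mu) (c : R) (Ac : bounded_op A c).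

(** Linearity holds only up to null functions, hence the triangle inequality. *)
Lemma bop_dist u v : L2norm (A u - A v) <= c * L2norm (u - v).
Proof.
have E := bop_add Ac v (u - v); rewrite [v + (u - v)]addrC subrK in E.
rewrite (le_trans (L2norm_tri (A v + A (u - v)) _ _))// E add0r.
by rewrite addrAC subrr add0r (bop_le Ac).
Qed.

Lemma bop0 : L2norm (A 0) = 0.
Proof.
apply/eqP; rewrite eq_le L2norm_ge0 andbT (le_trans (bop_le Ac _))//.
by rewrite L2norm0 mulr0.
Qed.

Lemma bop_sum n (a : nat -> R) (w : nat -> L2 mu) :
  L2norm (A (\sum_(k < n) a k *: w k) - \sum_(k < n) a k *: A (w k)) = 0.
Proof.
apply/eqP; rewrite eq_le L2norm_ge0 andbT.
elim: n => [|n ih]; first by rewrite !big_ord0 subr0 bop0.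
rewrite !big_ord_recr/=; set S := \sum_(k < n) _; set S' := \sum_(k < n) _.
rewrite (le_trans (L2norm_tri (A S + A (a n *: w n)) _ _))// (bop_add Ac) add0r.
rewrite [X in L2norm X](_ : _ = (A S - S') + (A (a n *: w n) - a n *: A (w n))).
  by rewrite (le_trans (L2normD _ _))// (bop_scale Ac) addr0.
by rewrite opprD addrACA.
Qed.

Lemma L2norm_iter_le k u : L2norm (iter k A u) <= L2norm u * c ^+ k.
Proof.
elim: k => [|k ih]; first by rewrite mulr1.
rewrite (le_trans (bop_le Ac _))// exprS mulrCA ler_wpM2l//.
exact: bop_ge0 Ac.
Qed.

Variables (T : R) (T_gt0 : 0 < T).

(** If [U] is the exponential curve of [u], then [A \o U] is that of [A u]: this
    is [U' = A U] at the level of Taylor coefficients. *)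
Lemma has_taylor_image (u : L2 mu) U :
  has_taylor T (fun k => iter k A u) U ->
  has_taylor T (fun k => iter k A (A u)) (A \o U).
Proof.
move=> uU t tT.
apply: (squeeze_cvgr (f := cst 0)
  (h := fun n => c * L2norm (taylor (fun k => iter k A u) n t - U t))).
- apply: nearW => n; rewrite L2norm_ge0/=.
  apply: le_trans (bop_dist _ _).
  have := bop_sum n (fun k => mono k t) (fun k => iter k A u).
  rewrite [X in _ - X](_ : _ = taylor (fun k => iter k A (A u)) n t); last first.
    by apply: eq_bigr => k _; rewrite -iterSr.
  move=> E.
  rewrite (le_trans (L2norm_tri (A (taylor (fun k => iter k A u) n t)) _ _))//.
  by rewrite L2normBC E add0r.
- exact: cvg_cst.
- by rewrite -(mulr0 c); apply: cvgMr; exact: uU.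
Qed.

Lemma L2norm_iter_le_shift k u : L2norm (iter k A (A u)) <= c * L2norm u * c ^+ k.
Proof.
apply: le_trans (L2norm_iter_le _ _) _; apply: ler_wpM2r.
  by rewrite exprn_ge0// (bop_ge0 Ac).
exact: bop_le Ac _.
Qed.

Lemma has_taylor_at0 (u : L2 mu) U :
  has_taylor T (fun k => iter k A u) U -> L2norm (U 0 - u) = 0.
Proof.
move=> uU; apply/eqP; rewrite eq_le L2norm_ge0 andbT.
have t0 : 0 \in `[0, T] by rewrite in_itv/= lexx ltW.
apply: L2norm_lim_le (uU _ t0) _; exists 1%N => // -[//|n] _.
rewrite /taylor big_ord_recl/= big1 => [|i _]; last first.
  by rewrite /mono expr0n/= mul0r scale0r.
by rewrite /mono expr0 fact0 invr1 mulr1 scale1r addr0 subrr L2norm0.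
Qed.

End bounded_operators.

(** * The exponential curve solves the equation, stably *)
Section weak_derivative_of_exponential.
Context (R : realType).
Notation leb := (@lebesgue_measure R).

Lemma is_derive_mono k (t : R) : is_derive t 1 (@mono R k.+1) (mono k t).
Proof.
rewrite (_ : @mono R k.+1 = (k.+1`!%:R^-1) \*: (@id R ^+ k.+1)); last first.
  by apply/funext => s; rewrite /mono /= exprfctE mulrC.
apply: is_derive_eq; rewrite /mono factS natrM /GRing.scale/=.
by field; rewrite ?nat1r !pnatr_eq0 -lt0n fact_gt0.
Qed.

Lemma derivable_continuous (f : R -> R) :
  (forall t : R, derivable f t 1) -> continuous f.
Proof.
by move=> df t; apply: differentiable_continuous; exact/derivable1_diffP.
Qed.

Section integration_by_parts.
Variables (T : R) (T_gt0 : 0 < T) (phi : R -> R).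
Hypothesis dphi : forall t : R, derivable phi t 1.
Hypothesis cphi' : continuous (derive1 phi).
Hypothesis phi0 : phi 0 = 0.
Hypothesis phiT : phi T = 0.

Lemma derivable_LRcontinuous (f : R -> R) :
  (forall t : R, derivable f t 1) -> derivable_oo_LRcontinuous f 0 T.
Proof.
move=> df; have cf := derivable_continuous df; split => //.
- exact/cvg_at_right_filter/cf.
- exact/cvg_at_left_filter/cf.
Qed.

Lemma derive_mono k : {in `]0, T[, derive1 (@mono R k.+1) =1 mono k}.
Proof. by move=> t _; rewrite derive1E; apply: derive_val; exact: is_derive_mono. Qed.

Lemma moment_derive0 : moment T (derive1 phi) 0 = 0.
Proof.
rewrite /moment; under eq_Rintegral do rewrite /mono expr0 fact0 divr1 mulr1.
apply: EFin_inj; rewrite fineK.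
  rewrite (continuous_FTC2 (F := phi) T_gt0).
  - by rewrite phi0 phiT -EFinB subrr.
  - exact: continuous_subspaceT.
  - exact: derivable_LRcontinuous.
  - by move=> t _.
apply: integrable_fin_num => //; apply: integrable_itv_continuous.
exact: continuous_subspaceT.
Qed.

(** Integration by parts; as [mono k.+1] is a primitive of [mono k], the moments
    of [derive1 phi] are those of [phi] with the opposite sign and shifted
    by one. *)
Lemma moment_deriveS k : moment T (derive1 phi) k.+1 = - moment T phi k.
Proof.
have ibp := @Rintegration_by_parts R (@mono R k.+1) phi (mono k) (derive1 phi)
  0 T T_gt0 (continuous_subspaceT (@continuous_mono R k))
  (derivable_LRcontinuous (fun t => @ex_derive _ _ _ _ _ _ _ (is_derive_mono k t)))
  (@derive_mono k) (continuous_subspaceT cphi')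
  (derivable_LRcontinuous dphi) (fun t _ => erefl).
rewrite phi0 phiT !mulr0 subrr sub0r in ibp.
rewrite /moment; under eq_Rintegral do rewrite mulrC.
by rewrite ibp; congr (- _); apply: eq_Rintegral => t _; rewrite mulrC.
Qed.

End integration_by_parts.
End weak_derivative_of_exponential.

Section exponential_solution.
Context d (X : measurableType d) (R : realType).
Variable mu : {measure set X -> \bar R}.
Notation leb := (@lebesgue_measure R).
Variables (T : R) (T_gt0 : 0 < T).
Variables (A : L2 mu -> L2 mu) (c : R) (Ac : bounded_op A c).
Variables (u : L2 mu) (U : R -> L2 mu).
Hypothesis uU : has_taylor T (fun k => iter k A u) U.

Lemma continuous_bounded_itv (f : R -> R) : {within `[0, T], continuous f} ->
  exists M, forall t, t \in `[0, T] -> `|f t| <= M.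
Proof.
move=> cf; have cn : {within `[0, T], continuous (fun t => `|f t|)}.
  by move=> t; apply: cvg_norm; exact: cf.
by have [s _ sM] := EVT_max (ltW T_gt0) cn; exists `|f s|.
Qed.

Let wle k : L2norm (iter k A u) <= L2norm u * c ^+ k.
Proof. exact: L2norm_iter_le. Qed.

Let wle' k : L2norm (iter k A (A u)) <= c * L2norm u * c ^+ k.
Proof. exact: L2norm_iter_le_shift. Qed.

Let c0 : 0 <= c. Proof. exact: (bop_ge0 Ac). Qed.

Let K0 : 0 <= c * L2norm u. Proof. by rewrite mulr_ge0// L2norm_ge0. Qed.

Let uU' : has_taylor T (fun k => iter k A (A u)) (A \o U).
Proof. exact: (has_taylor_image Ac). Qed.

Lemma exp_continuous : L2_continuous_on `[0, T] U.
Proof. exact: (taylor_limit_continuous T_gt0 c0 (L2norm_ge0 u) wle uU). Qed.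

Lemma exp_image_continuous : L2_continuous_on `[0, T] (A \o U).
Proof. exact: (taylor_limit_continuous T_gt0 c0 K0 wle' uU'). Qed.

Lemma L2_continuous_scale (f : R -> R) (W : R -> L2 mu) :
  {within `[0, T], continuous f} -> L2_continuous_on `[0, T] W ->
  L2_continuous_on `[0, T] (fun t => f t *: W t).
Proof.
move=> cf cW t tT; have [M M0 WM] := L2_continuous_bounded T_gt0 cW.
have cft : f s @[s --> within `[0, T] (nbhs t)] --> f t.
  by move/subspace_continuousP : cf; exact.
have FF : Filter (within `[0, T]%classic (nbhs t)) by exact: within_filter.
have c1 : `|f s - f t| * M + `|f t| * L2norm (W s - W t)
    @[s --> within `[0, T] (nbhs t)] --> `|f t - f t| * M + `|f t| * 0.
  apply: cvgD; last by apply: cvgMr; exact: cW.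
  by apply: cvgMl; apply: cvg_norm; apply: cvgB => //; exact: cvg_cst.
rewrite subrr normr0 mul0r mulr0 addr0 in c1.
apply: (squeeze_cvgr _ (cvg_cst 0) c1).
rewrite near_withinE; apply: nearW => s sT; rewrite L2norm_ge0/=.
rewrite (_ : f s *: W s - f t *: W t = (f s - f t) *: W s + f t *: (W s - W t)).
  rewrite (le_trans (L2normD _ _))// !L2normZ lerD2r ler_wpM2l//; exact: WM.
by rewrite scalerBl scalerBr addrA subrK.
Qed.

(** Integrating term by term, the shift of the moments of [derive1 phi] matches
    the shift of the Taylor coefficients from [U] to [A \o U]. *)
Lemma exp_weak_derivative : weak_derivative T U (A \o U).
Proof.
move=> phi [dphi [a [b [a0 bT supp]]]].
have d0 : forall t : R, derivable phi t 1 by exact: (dphi 0%N).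
have d1 : forall t : R, derivable (derive1 phi) t 1 by exact: (dphi 1%N).
have c0' := derivable_continuous d0; have c1' := derivable_continuous d1.
have phi0 : phi 0 = 0 by apply: supp; rewrite in_itv/= leNgt a0.
have phiT : phi T = 0.
  by apply: supp; rewrite in_itv/= negb_and orbC -ltNge bT.
have cw0 := continuous_subspaceT (A := `[0, T]) c0'.
have cw1 := continuous_subspaceT (A := `[0, T]) c1'.
have [M0 phiM0] := continuous_bounded_itv cw0.
have [M1 phiM1] := continuous_bounded_itv cw1.
have [I cI ipI] := moments_cvg T_gt0 c0 (L2norm_ge0 u) wle uU cw1 phiM1.
exists I; split; apply: (bochner_of_weak T_gt0).
- exact: L2_continuous_scale exp_continuous.
- by move=> g; rewrite ipI; apply: eq_Rintegral => t _; rewrite ipZl.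
- exact: L2_continuous_scale exp_image_continuous.
move=> g; under eq_Rintegral do rewrite ipZl.
have l1 := @ip_moments_cvg _ _ _ _ _ T_gt0 _ _ _ c0 K0 wle' _ uU' _ _ cw0 phiM0 g.
suff : ip (\sum_(k < n) moment T phi k *: iter k A (A u)) g @[n --> \oo] -->
    ip (- I) g by move/(cvg_unique _ l1) => /(_ (@norm_hausdorff _ _)) ->.
have l2 := @ip_cvg _ _ _ _ _ _ g cI.
have E n : ip (\sum_(k < n) moment T phi k *: iter k A (A u)) g =
    - ip (\sum_(k < n.+1) moment T (derive1 phi) k *: iter k A u) g.
  rewrite big_ord_recl/= moment_derive0// scale0r add0r -ipNl -sumrN.
  congr (ip _ g); apply: eq_bigr => k _.
  by rewrite -scaleNr (moment_deriveS T_gt0)// opprK -iterS iterSr.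
under eq_fun do rewrite E; rewrite ipNl; apply: cvgN.
by rewrite -cvg_shiftS in l2.
Qed.

Definition exp_H1 : H1 mu T :=
  MkH1 (continuous_L2_in_time T_gt0 exp_continuous)
    (continuous_L2_in_time T_gt0 exp_image_continuous)
    exp_weak_derivative exp_continuous.

End exponential_solution.

Section perturbation.
Context d (X : measurableType d) (R : realType).
Variable mu : {measure set X -> \bar R}.
Variables (T : R) (T_gt0 : 0 < T).
Variables (A B : L2 mu -> L2 mu) (C eps : R).
Hypotheses (AC : bounded_op A C) (BC : bounded_op B C).
Hypothesis eps_ge0 : 0 <= eps.
Hypothesis AB : forall v, L2norm (A v - B v) <= eps * L2norm v.
Variables (u v : L2 mu) (U V : R -> L2 mu).
Hypothesis uU : has_taylor T (fun k => iter k A u) U.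
Hypothesis vV : has_taylor T (fun k => iter k B v) V.

Let C0 : 0 <= C. Proof. exact: (bop_ge0 AC). Qed.

Let delta := L2norm (u - v) + eps * L2norm v.

Let delta_ge0 : 0 <= delta.
Proof. by rewrite addr_ge0 ?mulr_ge0 ?L2norm_ge0. Qed.

Let delta_eps : eps * L2norm v <= delta.
Proof. by rewrite lerDr L2norm_ge0. Qed.

(** With [C + 1] in place of the natural [C], one more power of [C + 1] absorbs
    both the propagated error and the error made at the new step, so that the
    induction closes with a constant independent of [k]. *)
Lemma iter_perturbation k :
  L2norm (iter k A u - iter k B v) <= delta * (C + 1) ^+ k.
Proof.
elim: k => [|k ih]; first by rewrite mulr1 lerDl mulr_ge0 ?L2norm_ge0.
rewrite !iterS (le_trans (L2norm_tri (A (iter k B v)) _ _))//.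
apply: (@le_trans _ _ (C * (delta * (C + 1) ^+ k) + delta * (C + 1) ^+ k)).
  apply: lerD.
    by rewrite (le_trans (bop_dist AC _ _))// ler_wpM2l.
  rewrite (le_trans (AB _))//.
  apply: (@le_trans _ _ (eps * (L2norm v * C ^+ k))).
    by rewrite ler_wpM2l//; exact: L2norm_iter_le.
  rewrite mulrA ler_pM ?mulr_ge0 ?L2norm_ge0 ?exprn_ge0//.
  by rewrite lerXn2r ?nnegrE ?addr_ge0// lerDl.
by rewrite exprS [leRHS](_ : _ = C * (delta * (C + 1) ^+ k) + delta * (C + 1) ^+ k)//; ring.
Qed.

(** The difference of the two curves is again a curve with a Taylor series, whose
    coefficients are bounded by the previous lemma. *)
Lemma exp_perturbation t : t \in `[0, T] ->
  L2norm (U t - V t) <= delta * expR ((C + 1) * T).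
Proof.
move=> tT; pose w k := iter k A u - iter k B v.
have wUV : has_taylor T w (fun t => U t - V t).
  move=> s sT; apply: (squeeze_cvgr (f := cst 0)
    (h := fun n => L2norm (taylor (fun k => iter k A u) n s - U s) +
      L2norm (taylor (fun k => iter k B v) n s - V s))).
  - apply: nearW => n; rewrite L2norm_ge0/=.
    rewrite (_ : taylor w n s = taylor (fun k => iter k A u) n s -
      taylor (fun k => iter k B v) n s); last first.
      by rewrite /taylor -sumrB; apply: eq_bigr => k _; rewrite -scalerBr.
    by apply: le_trans (L2normB _ _); rewrite !opprD addrACA.
  - exact: cvg_cst.
  - by rewrite -(addr0 0); apply: cvgD; [exact: uU|exact: vV].
have C1 : 0 <= C + 1 by rewrite addr_ge0.
exact: (L2norm_taylor_limit T_gt0 C1 delta_ge0 iter_perturbation wUV tT).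
Qed.

Lemma exp_image_perturbation t : t \in `[0, T] ->
  L2norm (A (U t) - B (V t)) <=
  C * (delta * expR ((C + 1) * T)) + eps * (L2norm v * expR (C * T)).
Proof.
move=> tT; rewrite (le_trans (L2norm_tri (A (V t)) _ _))// lerD//.
  by rewrite (le_trans (bop_dist AC _ _))// ler_wpM2l// exp_perturbation.
rewrite (le_trans (AB _))// ler_wpM2l//.
exact: (L2norm_taylor_limit T_gt0 C0 (L2norm_ge0 v) (fun k => L2norm_iter_le BC k v) vV tT).
Qed.

End perturbation.

(** * Smooth cut-off functions *)
Section smooth.
Context (R : realType).
Implicit Types f g : R -> R.

(** Differentiable [n] times. By recursion on the first derivative, closure under
    sums, products, inverses and affine changes of variable are one-line
    inductions. *)
Fixpoint Cn (n : nat) f : Prop :=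
  if n is m.+1 then (forall t : R, derivable f t 1) /\ Cn m (derive1 f)
  else True.

Definition smooth f := forall n, Cn n f.

Lemma smooth_derivable f : smooth f ->
  forall n (t : R), derivable (derive1n n f) t 1.
Proof.
move=> sf n t; elim: n f sf => [|n ih] f sf; first by have [] := sf 1%N.
by rewrite derive1Sn; apply: ih => m; have [] := sf m.+1.
Qed.

Lemma CnS n f : Cn n.+1 f -> Cn n f.
Proof.
by elim: n f => // n ih f [df Cf]; split => //; exact: ih.
Qed.

Lemma Cn_eq n f g : f =1 g -> Cn n f -> Cn n g.
Proof. by move=> /funext ->. Qed.

Lemma Cn_derive n f f' : (forall t : R, is_derive t 1 f (f' t)) ->
  Cn n f' -> Cn n.+1 f.
Proof.
move=> ff' Cf'; split=> [t|]; first by have [] := ff' t.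
by apply: Cn_eq Cf' => t; rewrite derive1E; exact/esym/derive_val.
Qed.

Lemma Cn_is_derive n f : Cn n.+1 f -> forall t : R, is_derive t 1 f (derive1 f t).
Proof. by move=> [df _] t; apply: DeriveDef => //; rewrite derive1E. Qed.

Lemma Cn_cst n (c : R) : Cn n (cst c).
Proof.
by elim: n c => // n ih c; apply: (Cn_derive (f' := cst 0)).
Qed.

Lemma CnD n f g : Cn n f -> Cn n g -> Cn n (fun t => f t + g t).
Proof.
elim: n f g => // n ih f g Cf Cg.
have df := Cn_is_derive Cf; have dg := Cn_is_derive Cg.
apply: (Cn_derive (f' := fun t => derive1 f t + derive1 g t)).
by apply: ih; [case: Cf|case: Cg].
Qed.

Lemma CnM n f g : Cn n f -> Cn n g -> Cn n (fun t => f t * g t).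
Proof.
elim: n f g => // n ih f g Cf Cg.
have df := Cn_is_derive Cf; have dg := Cn_is_derive Cg.
apply: (Cn_derive (f' := fun t => f t * derive1 g t + derive1 f t * g t)) => [t|].
  by apply: is_derive_eq; rewrite /GRing.scale/= [derive1 f t * _]mulrC.
by apply: CnD; apply: ih; (try exact: CnS); [case: Cg|case: Cf].
Qed.

Lemma CnZ n (c : R) f : Cn n f -> Cn n (fun t => c * f t).
Proof. by move=> Cf; apply: CnM => //; exact: Cn_cst. Qed.

Lemma CnV n f : (forall t, f t != 0) -> Cn n f -> Cn n (fun t => (f t)^-1).
Proof.
move=> f0; elim: n f f0 => // n ih f f0 Cf.
have df := Cn_is_derive Cf.
apply: (Cn_derive (f' := fun t => (-1) * ((f t)^-1 * (f t)^-1 * derive1 f t))) => [t|].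
  apply: (is_derive_eq (is_deriveV (f0 t) (df t))).
  by rewrite /GRing.scale/= expr2 invfM; ring.
apply: CnZ; apply: CnM; last by case: Cf.
by apply: CnM; apply: ih => //; exact: CnS.
Qed.

Lemma Cn_affine n (c e : R) f : Cn n f -> Cn n (fun t => f (c * t + e)).
Proof.
elim: n f => // n ih f Cf; have df := Cn_is_derive Cf.
apply: (Cn_derive (f' := fun t => c * derive1 f (c * t + e))) => [t|].
  rewrite mulrC; apply: (is_derive1_comp (f := f) (g := fun t => c * t + e)).
  by apply: is_derive_eq; rewrite /GRing.scale/= mulr1 addr0.
by apply: CnZ; apply: ih; case: Cf.
Qed.

(** The classical flat function [exp (- 1 / t)], with the factors [t^-k] that its
    derivatives produce. *)
Definition flat k (t : R) := if 0 < t then t^-1 ^+ k * expR (- t^-1) else 0.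

Lemma flat_ge0 k t : 0 <= flat k t.
Proof.
rewrite /flat; case: ifPn => // t0.
by rewrite mulr_ge0 ?expR_ge0// exprn_ge0// invr_ge0 ltW.
Qed.

Lemma flat_gt0 k t : 0 < t -> 0 < flat k t.
Proof.
by move=> t0; rewrite /flat t0 mulr_gt0 ?expR_gt0// exprn_gt0// invr_gt0.
Qed.

Lemma flat_eq0 k t : t <= 0 -> flat k t = 0.
Proof. by rewrite leNgt /flat => /negbTE ->. Qed.

(** From [x^(k+1) / (k+1)! <= exp x] at [x = 1 / t]. *)
Lemma flat_le k t : 0 <= t -> flat k t <= k.+1`!%:R * t.
Proof.
rewrite le_eqVlt => /predU1P[<-|t0]; first by rewrite mulr0 flat_eq0.
have := @expR_ge1Dxn R t^-1 k; rewrite invr_ge0 ltW// => /(_ isT) h.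
rewrite /flat t0 expRN ler_pdivrMr ?expR_gt0//.
apply: (@le_trans _ _ (k.+1`!%:R * t * (t^-1 ^+ k.+1 / k.+1`!%:R))); last first.
  rewrite ler_pM2l ?mulr_gt0 ?ltr0n ?fact_gt0// (le_trans _ h)//.
  by rewrite lerDr.
rewrite exprS; rewrite [leRHS](_ : _ = (t * t^-1) * (t^-1 ^+ k) *
    (k.+1`!%:R / k.+1`!%:R)); last by ring.
by rewrite !divff ?mulr1 ?mul1r// ?gt_eqF// ltr0n fact_gt0.
Qed.

(** The family is stable under derivation. At 0 the difference quotient of
    [flat k] is [flat k.+1], which vanishes there. *)
Lemma is_derive_flat k (t : R) :
  is_derive t 1 (flat k) (flat k.+2 t - k%:R * flat k.+1 t).
Proof.
have [t0|t0|->] := ltgtP t 0.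
- rewrite !flat_eq0 ?ltW// mulr0 subr0.
  apply: (near_eq_is_derive (f := cst 0)).
  by near=> s; rewrite flat_eq0// ltW//; near: s; exact: lt_nbhsl.
- suff : is_derive t 1 (fun s : R => s^-1 ^+ k * expR (- s^-1))
      (flat k.+2 t - k%:R * flat k.+1 t).
    apply: near_eq_is_derive; near=> s; rewrite /flat ifT//.
    by near: s; exact: lt_nbhsr.
  have tn0 : t != 0 by rewrite gt_eqF.
  have dV : is_derive t 1 (fun s : R => s^-1) (- t ^- 2).
    apply: (is_derive_eq (is_deriveV (f := id) tn0 (is_derive_id t 1))).
    by rewrite /GRing.scale/= mulr1.
  have dN : is_derive t 1 (fun s : R => - s^-1) (t ^- 2).
    by rewrite -[_ ^- 2]opprK; exact: is_deriveN.
  have dE := is_derive1_comp (f := expR) (g := fun s : R => - s^-1)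
    (is_derive_expR (- t^-1)) dN.
  have dX : is_derive t 1 (fun s : R => s^-1 ^+ k) (k%:R * t^-1 ^+ k.-1 * (- t ^- 2)).
    case: k => [|k] /=; first by rewrite !mul0r; exact: is_derive_cst.
    rewrite (_ : (fun s => _) = (fun s : R => s^-1) ^+ k.+1); last first.
      by apply/funext => s; rewrite exprfctE.
    by apply: is_derive_eq; rewrite /GRing.scale/=.
  have dM := is_deriveM dX dE; apply: (is_derive_eq dM).
  rewrite /flat t0 /GRing.scale/= !exprS expr0 !mulr1 invfM.
  case: k {dX dM} => [|k] /=; first by ring.
  by rewrite exprS; ring.
- rewrite !flat_eq0// mulr0 subr0.
  have d0 : h^-1 *: (flat k (h + 0) - flat k 0) @[h --> 0^'] --> (0 : R).
    apply/cvgrPdist_le => e e0; near=> h.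
    rewrite sub0r normrN addr0 (flat_eq0 k (lexx 0)) subr0.
    have [h0|h0] := leP h 0; first by rewrite flat_eq0// scaler0 normr0 ltW.
    have -> : h^-1 *: flat k h = flat k.+1 h.
      by rewrite /flat h0 /GRing.scale/= exprS mulrA.
    rewrite ger0_norm ?flat_ge0// (le_trans (flat_le _ (ltW h0)))//.
    rewrite -ler_pdivlMl ?ltr0n ?fact_gt0// mulrC (le_trans (ler_norm _))//.
    rewrite -[h]subr0 distrC; near: h.
    apply: (@cvgr_dist_le _ _ _ (0^') _ id).
      exact: cvg_within.
    by rewrite divr_gt0// ltr0n fact_gt0.
  have E : (fun h : R => h^-1 *: (flat k (h *: 1 + 0) - flat k 0)) =
      (fun h => h^-1 *: (flat k (h + 0) - flat k 0)).
    by apply/funext => h; rewrite /GRing.scale/= mulr1.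
  apply: DeriveDef; first by apply/cvg_ex; exists 0; rewrite E.
  by rewrite /derive E; exact: cvg_lim.
Unshelve. all: by end_near. Qed.

Lemma Cn_flat n k : Cn n (flat k).
Proof.
elim: n k => // n ih k; apply: (Cn_derive (is_derive_flat k)).
rewrite (_ : (fun t => _) = (fun t => flat k.+2 t + (- k%:R) * flat k.+1 t)).
  by apply: CnD => //; exact: CnZ.
by apply/funext => t; rewrite mulNr.
Qed.

(** A smooth step from 0 at the left of [[0, 1]] to 1 at its right. *)
Definition step (t : R) := flat 0 t * (flat 0 t + flat 0 (1 - t))^-1.

Let den_gt0 (t : R) : 0 < flat 0 t + flat 0 (1 - t).
Proof.
have [t0|t0] := leP t 0; last by rewrite ltr_pwDl ?flat_gt0 ?flat_ge0.
by rewrite ltr_wpDl ?flat_ge0// flat_gt0// subr_gt0 (le_lt_trans t0).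
Qed.

Lemma step_ge0 t : 0 <= step t.
Proof. by rewrite mulr_ge0 ?flat_ge0// invr_ge0 ltW. Qed.

Lemma step_le1 t : step t <= 1.
Proof. by rewrite ler_pdivrMr// mul1r lerDl flat_ge0. Qed.

Lemma step0 t : t <= 0 -> step t = 0.
Proof. by move=> t0; rewrite /step flat_eq0// mul0r. Qed.

Lemma step1 t : 1 <= t -> step t = 1.
Proof.
move=> t1; rewrite /step (flat_eq0 _ (_ : 1 - t <= 0)) ?subr_le0// addr0 divff//.
by rewrite gt_eqF// flat_gt0// (lt_le_trans ltr01).
Qed.

Lemma smooth_step : smooth step.
Proof.
move=> n; apply: CnM; first exact: Cn_flat.
apply: CnV => [t|]; first by rewrite gt_eqF.
apply: CnD; first exact: Cn_flat.
apply: Cn_eq (Cn_affine (-1) 1 (@Cn_flat n 0)) => t.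
by rewrite mulN1r addrC.
Qed.

Lemma derive1_locally_cst (f : R -> R) (c t : R) :
  (\forall s \near t, f s = c) -> derive1 f t = 0.
Proof.
move=> fc; rewrite derive1E; apply: derive_val.
apply: (near_eq_is_derive (f := cst c)).
by apply: filterS fc => s ->.
Qed.

Lemma derive1_step_eq0 t : t \notin `[0, 1] -> derive1 step t = 0.
Proof.
rewrite in_itv/= negb_and -!ltNge => /orP[t0|t1].
  apply: (@derive1_locally_cst _ 0); near=> s; rewrite step0// ltW//.
  by near: s; exact: lt_nbhsl.
apply: (@derive1_locally_cst _ 1); near=> s; rewrite step1// ltW//.
by near: s; exact: lt_nbhsr.
Unshelve. all: by end_near. Qed.

End smooth.

(** * A weak derivative controls the increments *)
Section du_Bois_Reymond.
Context (R : realType).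
Notation leb := (@lebesgue_measure R).
Variables (T : R) (T_gt0 : 0 < T).

(** The bound involves the length of the support, not that of [[0, T]]. *)
Lemma le_Rintegral_supported (f : R -> R) a b B : 0 <= a -> a <= b -> b <= T ->
  {within `[0, T], continuous f} ->
  (forall t, t \notin `[a, b] -> f t = 0) ->
  (forall t, t \in `[a, b] -> `|f t| <= B) ->
  `|\int[leb]_(t in `[0, T]) f t| <= B * (b - a).
Proof.
move=> a0 ab bT cf f0 fB.
have sub : `[a, b]%classic `<=` (`[0, T]%classic : set R).
  by move=> t /=; rewrite !in_itv/= => /andP[h1 h2]; rewrite (le_trans a0)// (le_trans h2).
have -> : \int[leb]_(t in `[0, T]) f t = \int[leb]_(t in `[a, b]) f t.
  rewrite Rintegral_mkcond [RHS]Rintegral_mkcond; apply: eq_Rintegral => t _.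
  rewrite !patchE; case: ifPn => [_|tT].
    by case: ifPn => // /negP tab; apply: f0; apply/negP => h; apply: tab; rewrite inE.
  rewrite ifN//; apply: contra tT; rewrite !inE; exact: sub.
have cab : {within `[a, b], continuous f} by exact: continuous_subspaceW sub cf.
have iab : leb.-integrable `[a, b] (EFin \o f).
  by apply: continuous_compact_integrable => //; exact: segment_compact.
apply: le_trans; first exact: le_normr_Rintegral.
have lab : fine (leb `[a, b]) = b - a.
  rewrite lebesgue_measure_itv/= lte_fin; move: ab.
  by rewrite le_eqVlt => /predU1P[->|->]; rewrite ?ltxx ?subrr.
have -> : B * (b - a) = \int[leb]_(t in `[a, b]) B.
  by rewrite Rintegral_cst//; congr (_ * _); rewrite -lab.
apply: le_Rintegral => //; first exact: integrable_norm.
apply: continuous_compact_integrable; first exact: segment_compact.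
by apply: continuous_subspaceT => x; exact: cvg_cst.
Qed.

Lemma derive1_step_bounded : exists M : R, forall t, `|derive1 (@step R) t| <= M.
Proof.
have cs : continuous (derive1 (@step R)).
  apply: derivable_continuous => t.
  exact: (@smooth_derivable _ _ (@smooth_step R) 1%N t).
have cn : {within `[0, 1], continuous (fun t => `|derive1 (@step R) t|)}.
  by apply: continuous_subspaceT => t; apply: cvg_norm; exact: cs.
have [s _ sM] := EVT_max ler01 cn; exists `|derive1 (@step R) s| => t.
have [t01|t01] := boolP (t \in `[0, 1]); first exact: sM.
by rewrite derive1_step_eq0// normr0.
Qed.

(** Rises from 0 to 1 on [[s, s + eps]]. *)
Definition ramp (s eps t : R) := step (eps^-1 * t + - (eps^-1 * s)).

Lemma smooth_ramp s eps : smooth (ramp s eps).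
Proof. by move=> n; apply: Cn_affine; exact: smooth_step. Qed.

Lemma ramp0 s eps t : 0 < eps -> t <= s -> ramp s eps t = 0.
Proof.
by move=> e0 ts; rewrite /ramp step0// -mulrBr mulr_ge0_le0 ?subr_le0// invr_ge0 ltW.
Qed.

Lemma ramp1 s eps t : 0 < eps -> s + eps <= t -> ramp s eps t = 1.
Proof.
move=> e0 ts; rewrite /ramp step1// -mulrBr ler_pdivlMl// mulr1.
by rewrite lerBrDl.
Qed.

Lemma derive1_ramp s eps t :
  derive1 (ramp s eps) t = eps^-1 * derive1 (@step R) (eps^-1 * t + - (eps^-1 * s)).
Proof.
rewrite [LHS]derive1E /ramp; move: (- _) => e; apply: derive_val; rewrite mulrC.
have ds (x : R) : is_derive x 1 (@step R) (derive1 (@step R) x).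
  by apply: Cn_is_derive; exact: (@smooth_step R 1%N).
apply: (is_derive1_comp (f := @step R) (g := fun t => eps^-1 * t + e)).
by apply: is_derive_eq; rewrite /GRing.scale/= mulr1 addr0.
Qed.

Lemma smooth_continuous (f : R -> R) : smooth f -> continuous f.
Proof.
by move=> sf; apply: derivable_continuous => t; exact: (@smooth_derivable _ _ sf 0%N t).
Qed.

Lemma smooth_derive1 (f : R -> R) : smooth f -> smooth (derive1 f).
Proof. by move=> sf n; have [] := sf n.+1. Qed.

Lemma derive1_ramp_supported s eps t : 0 < eps ->
  t \notin `[s, s + eps] -> derive1 (ramp s eps) t = 0.
Proof.
move=> e0; rewrite derive1_ramp => tn; rewrite derive1_step_eq0 ?mulr0//.
apply: contra tn; rewrite !in_itv/= -mulrBr.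
by rewrite pmulr_rge0 ?invr_gt0// subr_ge0 ler_pdivrMl// mulr1 lerBlDl.
Qed.

(** The derivative of the ramp has integral 1 and is at most [M / eps] on an
    interval of length [eps], so it averages [phi] over [[s, s + eps]]. *)
Lemma ramp_average (phi : R -> R) s eps y delta M :
  0 < eps -> 0 <= s -> s + eps <= T -> {within `[0, T], continuous phi} ->
  (forall t, `|derive1 (@step R) t| <= M) ->
  (forall t, t \in `[s, s + eps] -> `|phi t - y| <= delta) ->
  `|\int[leb]_(t in `[0, T]) (derive1 (ramp s eps) t * phi t) - y| <= M * delta.
Proof.
move=> e0 s0 sT cphi dM phiy.
have cq : continuous (derive1 (ramp s eps)).
  exact/smooth_continuous/smooth_derive1/smooth_ramp.
have cq' := continuous_subspaceT (A := `[0, T]) cq.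
have int1 : \int[leb]_(t in `[0, T]) derive1 (ramp s eps) t = 1.
  apply: EFin_inj; rewrite fineK.
    rewrite (continuous_FTC2 (F := ramp s eps) T_gt0) => //.
    - by rewrite ramp1// ramp0// -EFinB subr0.
    - apply: derivable_LRcontinuous => t.
      exact: (@smooth_derivable _ _ (@smooth_ramp s eps) 0%N t).
  by apply: integrable_fin_num => //; exact: integrable_itv_continuous.
have c1 : {within `[0, T], continuous (fun t => derive1 (ramp s eps) t * phi t)}.
  by move=> t; apply: cvgM; [exact: cq'|exact: cphi].
have c2 : {within `[0, T], continuous (fun t => derive1 (ramp s eps) t * y)}.
  by move=> t; apply: cvgMl; exact: cq'.
rewrite -[y in X in _ - X]mul1r -int1 -(Rintegral_itvZr y cq').
rewrite -(Rintegral_itv_sub c1 c2).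
have -> : M * delta = eps^-1 * M * delta * (s + eps - s).
  by rewrite addrAC subrr add0r; field; rewrite gt_eqF.
apply: le_Rintegral_supported => //.
- by rewrite lerDl ltW.
- by move=> t; apply: cvgB; [exact: c1|exact: c2].
- by move=> t ts; rewrite derive1_ramp_supported// !mul0r subrr.
- move=> t ts; rewrite -mulrBr normrM ler_pM ?phiy//.
  have ei : 0 < eps^-1 by rewrite invr_gt0.
  by rewrite derive1_ramp normrM (gtr0_norm ei) ler_pM2l.
Qed.

(** The difference of a ramp that rises near [a] and of a ramp that rises near
    [b] approximates the indicator function of [[a, b]]: tested against it,
    [phi] gives [phi a - phi b] up to a small error, while the integral of
    [psi] is at most [B * (b - a)]. *)
Lemma weak_derivative_le (phi psi : R -> R) a b B :
  {within `[0, T], continuous phi} -> {within `[0, T], continuous psi} ->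
  (forall eta, test_function T eta ->
    \int[leb]_(t in `[0, T]) (derive1 eta t * phi t) =
    - \int[leb]_(t in `[0, T]) (eta t * psi t)) ->
  0 < a -> a < b -> b < T ->
  (forall t, t \in `[a, b] -> `|psi t| <= B) ->
  `|phi b - phi a| <= B * (b - a).
Proof.
move=> cphi cpsi weak a0 ab bT psiB.
have [M dM] := derive1_step_bounded.
have M0 : 0 <= M by exact: le_trans (normr_ge0 _) (dM 0).
suff h (delta : R) : 0 < delta -> `|phi b - phi a| <= B * (b - a) + delta.
  by apply/ler_addgt0Pr => e /h.
move=> d0; pose dl := delta / (M *+ 2 + 1).
have M21 : 0 < M *+ 2 + 1 by rewrite ltr_wpDl// mulrn_wge0.
have dl0 : 0 < dl by rewrite divr_gt0.
have near_phi s : s \in `[a, b] -> \forall t \near s, t \in `[0, T] -> `|phi t - phi s| <= dl.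
  move=> sab; have sT : s \in `[0, T].
    by move: sab; rewrite !in_itv/= => /andP[h1 h2]; apply/andP; split; lra.
  move/subspace_continuousP : cphi => /(_ s sT) /cvgrPdist_le/(_ _ dl0).
  by rewrite near_withinE; apply: filterS => t h tT; rewrite distrC; exact: h.
have aab : a \in `[a, b] by rewrite in_itv/= lexx ltW.
have bab : b \in `[a, b] by rewrite in_itv/= lexx ltW.
have /nbhs_ballP[ea /= ea0 Ha] := near_phi a aab.
have /nbhs_ballP[eb /= eb0 Hb] := near_phi b bab.
pose eps := Num.min (b - a) (Num.min (ea / 2) (eb / 2)).
have eps0 : 0 < eps by rewrite !lt_min subr_gt0 ab !divr_gt0.
have epsab : eps <= b - a by rewrite ge_min lexx.
have epsa : eps < ea.
  by rewrite (@le_lt_trans _ _ (ea / 2))//; [rewrite !ge_min lexx orbT|lra].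
have epsb : eps < eb.
  by rewrite (@le_lt_trans _ _ (eb / 2))//; [rewrite !ge_min lexx !orbT|lra].
pose eta t := ramp a eps t + (-1) * ramp (b - eps) eps t.
have seta : smooth eta.
  move=> n; apply: CnD; first exact: smooth_ramp.
  by apply: CnZ; exact: smooth_ramp.
have eta_supp t : t \notin `[a, b] -> eta t = 0.
  rewrite in_itv/= negb_and -!ltNge /eta => /orP[ta|tb].
    by rewrite !ramp0 ?mulr0 ?addr0//; lra.
  by rewrite !ramp1//; lra.
have teta : test_function T eta.
  by split; [exact: smooth_derivable|exists a, b].
have deta t : derive1 eta t = derive1 (ramp a eps) t - derive1 (ramp (b - eps) eps) t.
  rewrite [LHS]derive1E; apply: derive_val; rewrite -mulN1r.
  have d1 : is_derive t 1 (ramp a eps) (derive1 (ramp a eps) t).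
    by apply: Cn_is_derive; exact: (@smooth_ramp a eps 1%N).
  have d2 : is_derive t 1 (ramp (b - eps) eps) (derive1 (ramp (b - eps) eps) t).
    by apply: Cn_is_derive; exact: (@smooth_ramp (b - eps) eps 1%N).
  by apply: is_derive_eq; rewrite /GRing.scale/=; ring.
have cr s : {within `[0, T], continuous (fun t => derive1 (ramp s eps) t * phi t)}.
  move=> t; apply: cvgM; last exact: cphi.
  apply: continuous_subspaceT.
  exact/smooth_continuous/smooth_derive1/smooth_ramp.
have := weak _ teta; under eq_Rintegral do rewrite deta mulrBl.
rewrite (Rintegral_itv_sub (cr a) (cr (b - eps))).
set Ia := \int[leb]_(t in `[0, T]) (derive1 (ramp a eps) t * phi t).
set Ib := \int[leb]_(t in `[0, T]) (derive1 (ramp (b - eps) eps) t * phi t).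
have hA : `|Ia - phi a| <= M * dl.
  apply: ramp_average => //; [lra|lra|move=> t].
  rewrite in_itv/= => /andP[t1 t2]; apply: Ha; last by rewrite in_itv/=; lra.
  by rewrite /ball/= distrC ger0_norm ?subr_ge0//; lra.
have hB : `|Ib - phi b| <= M * dl.
  apply: ramp_average => //; [lra|lra|move=> t].
  rewrite in_itv/= => /andP[t1 t2]; apply: Hb; last by rewrite in_itv/=; lra.
  by rewrite /ball/= ger0_norm ?subr_ge0//; lra.
have hI : `|\int[leb]_(t in `[0, T]) (eta t * psi t)| <= B * (b - a).
  apply: le_Rintegral_supported; [lra|lra|lra| | |].
  - move=> t; apply: cvgM; last exact: cpsi.
    by apply: continuous_subspaceT; exact: smooth_continuous.
  - by move=> t /eta_supp ->; rewrite mul0r.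
  - move=> t tab; rewrite normrM -[B]mul1r ler_pM ?psiB//.
    have h1 := step_ge0 (eps^-1 * t + - (eps^-1 * a)).
    have h2 := step_le1 (eps^-1 * t + - (eps^-1 * a)).
    have h3 := step_ge0 (eps^-1 * t + - (eps^-1 * (b - eps))).
    have h4 := step_le1 (eps^-1 * t + - (eps^-1 * (b - eps))).
    by rewrite ler_norml /eta /ramp; lra.
have dlE : M * dl + M * dl <= delta.
  rewrite /dl -mulr2n -mulrnAl mulrA ler_pdivrMr// mulrC ler_pM2l//.
  by rewrite lerDl.
move=> E; move: hA hB hI; rewrite -[X in `|X| <= B * _]opprK -E normrN => hA hB hI.
have -> : phi b - phi a = (Ia - phi a) - (Ib - phi b) - (Ia - Ib) by ring.
rewrite (le_trans (ler_normB _ _))// (le_trans (lerD (ler_normB _ _) (lexx _)))//.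
by rewrite addrC lerD// (le_trans (lerD hA hB)).
Qed.

End du_Bois_Reymond.

(** * Uniqueness of solutions *)
Section uniqueness.
Context d (X : measurableType d) (R : realType).
Variable mu : {measure set X -> \bar R}.
Notation leb := (@lebesgue_measure R).
Variables (T : R) (T_gt0 : 0 < T).
Variables (A : L2 mu -> L2 mu) (c : R) (Ac : bounded_op A c).

Lemma bop_continuous (D : set R) (U : R -> L2 mu) :
  L2_continuous_on D U -> L2_continuous_on D (A \o U).
Proof.
move=> cU t Dt; have FF : Filter (within D (nbhs t)) by exact: within_filter.
apply: (squeeze_cvgr (f := cst 0) (h := fun s => c * L2norm (U s - U t))).
- by apply: nearW => s; rewrite L2norm_ge0 (bop_dist Ac).
- exact: cvg_cst.
- by rewrite -(mulr0 c); apply: cvgMr; exact: cU.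
Qed.

Definition solves (w : H1 mu T) :=
  {ae leb, forall t, t \in `]0, T[ -> L2norm (H1_deriv w t - A (w t)) = 0}.

(** The end points 0 and [T], where the equation is not assumed, are harmless
    because test functions vanish there. *)
Lemma solves_weak (w : H1 mu T) g : solves w ->
  forall eta, test_function T eta ->
  \int[leb]_(t in `[0, T]) (derive1 eta t * ip (w t) g) =
  - \int[leb]_(t in `[0, T]) (eta t * ip (A (w t)) g).
Proof.
move=> sw eta teta; have [I [I1 I2]] := H1_weak_derivative w teta.
case: teta => deta [a [b [a0 bT supp]]].
have cw := @H1_continuous _ _ _ _ _ w.
have ceta := derivable_continuous (deta 0%N).
have ceta' := derivable_continuous (deta 1%N).
have c1 : {within `[0, T], continuous (fun t => derive1 eta t * ip (w t) g)}.
  by apply: continuous_mul_ip cw; exact: continuous_subspaceT.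
have c2 : {within `[0, T], continuous (fun t => eta t * ip (A (w t)) g)}.
  by apply: continuous_mul_ip (bop_continuous cw); exact: continuous_subspaceT.
have mI : measurable (`[0, T]%classic : set R) by exact: measurable_itv.
have E1 : (fun t => ip (derive1 eta t *: w t) g) = fun t => derive1 eta t * ip (w t) g.
  by apply/funext => t; rewrite ipZl.
have E2 : (fun t => ip (eta t *: A (w t)) g) = fun t => eta t * ip (A (w t)) g.
  by apply/funext => t; rewrite ipZl.
rewrite -E1 -(bochner_unique_ip mI I1); last first.
  by rewrite E1; exact: integrable_itv_continuous.
rewrite -E2 -(bochner_ip (f' := fun t => eta t *: A (w t)) mI I2).
- by rewrite ipNl opprK.
- apply: ae_lebS sw => t h; rewrite /= in_itv/= => tT.
  rewrite -scalerBr L2normZ.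
  have [/andP[t0 tT']|tn] := boolP (0 < t < T); first by rewrite h ?mulr0// in_itv/= t0.
  rewrite supp ?normr0 ?mul0r//; apply: contra tn; rewrite in_itv/= => /andP[h1 h2].
  by rewrite (lt_le_trans a0 h1) (le_lt_trans h2 bT).
- by rewrite E2; exact: integrable_itv_continuous.
Qed.

Variables (w u : H1 mu T) (sw : solves w) (su : solves u).
Let z t := w t - u t.

Let cz : L2_continuous_on `[0, T] z.
Proof.
move=> t tT; have FF : Filter (within `[0, T]%classic (nbhs t)) by exact: within_filter.
apply: (squeeze_cvgr (f := cst 0)
  (h := fun s => L2norm (w s - w t) + L2norm (u s - u t))).
- apply: nearW => s; rewrite L2norm_ge0 /z/=.
  by apply: le_trans (L2normB _ _); rewrite !opprD addrACA.
- exact: cvg_cst.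
- have := cvgD (@H1_continuous _ _ _ _ _ w t tT) (@H1_continuous _ _ _ _ _ u t tT).
  by rewrite addr0; exact.
Qed.

(** [z b - z a] is tested against itself. *)
Lemma solution_lipschitz_open a b m : 0 < a -> a < b -> b < T ->
  (forall t, t \in `[a, b] -> L2norm (z t) <= m) ->
  L2norm (z b - z a) <= c * m * (b - a).
Proof.
move=> a0 ab bT zm; have c0 := bop_ge0 Ac.
have m0 : 0 <= m.
  by rewrite (le_trans (L2norm_ge0 (z a)))// zm// in_itv/= lexx ltW.
apply: ip_bound_L2norm; first by rewrite !mulr_ge0// subr_ge0 ltW.
move=> g; rewrite ipBl (le_trans (ler_norm _))// mulrAC.
have cAB : {within `[0, T], continuous (fun t => ip (A (w t) - A (u t)) g)}.
  have cAw := continuous_ip (g := g) (bop_continuous (@H1_continuous _ _ _ _ _ w)).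
  have cAu := continuous_ip (g := g) (bop_continuous (@H1_continuous _ _ _ _ _ u)).
  rewrite (_ : (fun t => _) = fun t => ip (A (w t)) g - ip (A (u t)) g).
    by move=> t; apply: cvgB; [exact: cAw|exact: cAu].
  by apply/funext => t; rewrite ipBl.
apply: (weak_derivative_le T_gt0 (continuous_ip cz) cAB _ a0 ab bT).
  move=> eta teta.
  have ceta := derivable_continuous (teta.1 0%N).
  have ceta' := derivable_continuous (teta.1 1%N).
  have cs1 := continuous_subspaceT (A := `[0, T]) ceta'.
  have cs := continuous_subspaceT (A := `[0, T]) ceta.
  have l1 := continuous_mul_ip (g := g) cs1 (@H1_continuous _ _ _ _ _ w).
  have l2 := continuous_mul_ip (g := g) cs1 (@H1_continuous _ _ _ _ _ u).
  have r1 := continuous_mul_ip (g := g) cs (bop_continuous (@H1_continuous _ _ _ _ _ w)).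
  have r2 := continuous_mul_ip (g := g) cs (bop_continuous (@H1_continuous _ _ _ _ _ u)).
  under eq_Rintegral do rewrite ipBl mulrBr.
  rewrite (Rintegral_itv_sub l1 l2) (solves_weak g sw teta) (solves_weak g su teta).
  under [in RHS]eq_Rintegral do rewrite ipBl mulrBr.
  by rewrite (Rintegral_itv_sub r1 r2) opprB addrC opprK.
move=> t tab; rewrite (le_trans (ip_le _ _))// ler_wpM2r ?L2norm_ge0//.
by rewrite (le_trans (bop_dist Ac _ _))// ler_wpM2l// zm.
Qed.

Lemma solution_lipschitz a b m : 0 <= a -> a < b -> b <= T ->
  (forall t, t \in `[a, b] -> L2norm (z t) <= m) ->
  L2norm (z b - z a) <= c * m * (b - a).
Proof.
move=> a0 ab bT zm; have c0 := bop_ge0 Ac.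
have m0 : 0 <= m.
  by rewrite (le_trans (L2norm_ge0 (z a)))// zm// in_itv/= lexx ltW.
apply/ler_addgt0Pr => e e0; have e2 : 0 < e / 2 by rewrite divr_gt0.
have near_z s : s \in `[0, T] -> \forall t \near s, t \in `[0, T] -> L2norm (z t - z s) <= e / 2.
  move=> sT; have := cz sT => /cvgrPdist_le/(_ _ e2).
  rewrite near_withinE; apply: filterS => t h tT.
  by have := h tT; rewrite sub0r normrN ger0_norm ?L2norm_ge0.
have aT : a \in `[0, T] by rewrite in_itv/= a0 ltW// (lt_le_trans ab).
have bT' : b \in `[0, T] by rewrite in_itv/= bT ltW// (le_lt_trans a0).
have /nbhs_ballP[ea /= ea0 Ha] := near_z a aT.
have /nbhs_ballP[eb /= eb0 Hb] := near_z b bT'.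
pose r := Num.min ((b - a) / 3) (Num.min (ea / 2) (eb / 2)).
have r0 : 0 < r by rewrite !lt_min !divr_gt0 ?subr_gt0.
have rab : r <= (b - a) / 3 by rewrite ge_min lexx.
have ra : r <= ea / 2 by rewrite !ge_min lexx orbT.
have rb : r <= eb / 2 by rewrite !ge_min lexx !orbT.
have h1 : L2norm (z (a + r) - z a) <= e / 2.
  apply: Ha; last by rewrite in_itv/=; apply/andP; split; lra.
  by rewrite /ball/= opprD addrA subrr add0r normrN gtr0_norm//; lra.
have h2 : L2norm (z (b - r) - z b) <= e / 2.
  apply: Hb; last by rewrite in_itv/=; apply/andP; split; lra.
  by rewrite /ball/= opprB addrC subrK gtr0_norm//; lra.
have h3 : L2norm (z (b - r) - z (a + r)) <= c * m * (b - r - (a + r)).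
  apply: solution_lipschitz_open; [lra|lra|lra|move=> t].
  by rewrite in_itv/= => /andP[t1 t2]; apply: zm; rewrite in_itv/=; apply/andP; split; lra.
have h4 : c * m * (b - r - (a + r)) <= c * m * (b - a).
  by apply: ler_wpM2l; [rewrite mulr_ge0|lra].
have h5 := L2norm_tri (z (b - r)) (z b) (z a).
have h6 := L2norm_tri (z (a + r)) (z (b - r)) (z a).
rewrite L2normBC in h2; lra.
Qed.

(** Cut [[0, T]] into steps of length [h] with [c * h <= 1 / 2]. If [z] vanishes
    at the beginning of a step, its maximum over the step is at most half of
    itself. *)
Lemma solution_unique : L2norm (z 0) = 0 ->
  forall t, t \in `[0, T] -> L2norm (z t) = 0.
Proof.
move=> z0; have c0 := bop_ge0 Ac.
pose h := (2 * (c + 1))^-1; have h0 : 0 < h by rewrite invr_gt0 mulr_gt0// ltr_wpDl.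
have ch : c * h <= 1 / 2.
  rewrite /h invfM mulrCA mul1r ler_piMr//.
  by rewrite ler_pdivrMr ?ltr_wpDl// mul1r lerDl.
suff claim k t : t \in `[0, T] -> t <= k%:R * h -> L2norm (z t) = 0.
  move=> t tT; apply: (claim (Num.trunc (t / h)).+1) => //.
  have /andP[t0 _] : 0 <= t <= T by rewrite in_itv in tT.
  rewrite -ler_pdivrMr//.
  by have /andP[_ /ltW] := @truncn_itv _ (t / h) (divr_ge0 t0 (ltW h0)).
elim: k t => [|k ih] t tT.
  rewrite mul0r => t0; suff -> : t = 0 by [].
  by apply/eqP; rewrite eq_le t0; move: tT; rewrite in_itv/= => /andP[].
move=> tk; have [/ih|st] := leP t (k%:R * h); first exact.
set s := k%:R * h in st ih.
have s0 : 0 <= s by rewrite mulr_ge0// ltW.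
have tT' : t <= T by move: tT; rewrite in_itv/= => /andP[].
have zs : L2norm (z s) = 0 by apply: ih => //; rewrite in_itv/= s0 ltW// (lt_le_trans st).
have sub : `[s, t]%classic `<=` (`[0, T]%classic : set R).
  move=> r /=; rewrite !in_itv/= => /andP[r1 r2].
  by rewrite (le_trans s0 r1) (le_trans r2 tT').
have cN := continuous_subspaceW sub (continuous_L2norm cz).
have [r rst rmax] := EVT_max (ltW st) cN.
suff zr : L2norm (z r) <= 0.
  apply/eqP; rewrite eq_le L2norm_ge0 andbT (le_trans _ zr)// rmax//.
  by rewrite in_itv/= lexx ltW.
move: (rst); rewrite in_itv/= le_eqVlt => /andP[/predU1P[<- _|sr rt]]; first by rewrite zs.
have := @solution_lipschitz s r (L2norm (z r)) s0 sr (le_trans rt tT').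
have := L2norm_le_dist (z r) (z s); rewrite zs add0r => h1 h2.
have {}h2 : L2norm (z r - z s) <= c * L2norm (z r) * (r - s).
  apply: h2 => q; rewrite in_itv/= => /andP[q1 q2]; apply: rmax.
  by rewrite in_itv/= q1 (le_trans q2).
have rs : r - s <= h.
  by rewrite lerBlDl (le_trans rt)// (le_trans tk)// -natr1 mulrDl mul1r.
have h3 : c * L2norm (z r) * (r - s) <= c * h * L2norm (z r).
  by rewrite mulrAC ler_wpM2r ?L2norm_ge0// ler_wpM2l.
have := L2norm_ge0 (z r); nra.
Qed.

End uniqueness.

(** * Convergence in H1 from uniform convergence *)
Section H1_convergence.
Context d (X : measurableType d) (R : realType).
Variable mu : {measure set X -> \bar R}.
Notation leb := (@lebesgue_measure R).
Variables (T : R) (T_gt0 : 0 < T).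

Lemma integral_sqr_le (f : R -> R) b : (forall t, t \in `[0, T] -> 0 <= f t <= b) ->
  (\int[leb]_(t in `[0%R, T]) (f t ^+ 2)%:E <= (b ^+ 2 * T)%:E)%E.
Proof.
move=> fb; apply: (@le_trans _ _ (\int[leb]_(t in `[0%R, T]) (b ^+ 2)%:E)%E).
  apply: le_integral_nonmeasurable => t tT; first by rewrite lee_fin sqr_ge0.
  have /andP[f0 h] := fb t tT.
  by rewrite lee_fin lerXn2r ?nnegrE// (le_trans f0).
have lT : leb `[0%R, T] = T%:E.
  by rewrite -[in RHS](fine_leb_itv T_gt0) fineK// ge0_fin_numE// leb_itv_lty.
by rewrite integral_cst// (EFinM (b ^+ 2) T) le_eqVlt; apply/orP; left; apply/eqP; congr (_ * _)%E.
Qed.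

(** The two integrals in the distance are bounded by [T * (b n)^2]. *)
Lemma H1_dist_cvg (un : nat -> H1 mu T) (u : H1 mu T) (b : nat -> R) :
  (\forall n \near \oo, forall t, t \in `[0, T] ->
     L2norm (un n t - u t) <= b n /\
     L2norm (H1_deriv (un n) t - H1_deriv u t) <= b n) ->
  b n @[n --> \oo] --> (0 : R) ->
  H1_dist (un n) u @[n --> \oo] --> 0%E.
Proof.
move=> ub b0.
apply: (squeeze_cvge (f := cst 0%E)
  (h := fun n => (Num.sqrt (T *+ 2) * `|b n|)%:E)).
- apply: filterS ub => n ubn; rewrite poweR_ge0/=.
  have -> : (Num.sqrt (T *+ 2) * `|b n|)%:E = ((b n ^+ 2 * T + b n ^+ 2 * T)%:E `^ 2^-1)%E.
    have -> : b n ^+ 2 * T + b n ^+ 2 * T = T *+ 2 * b n ^+ 2.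
      by rewrite mulr2n mulrDl mulrC.
    have T2 : 0 <= T *+ 2 by rewrite mulrn_wge0// ltW.
    rewrite poweR_EFin powR12_sqrt; last by rewrite mulr_ge0// sqr_ge0.
    by rewrite sqrtrM// sqrtr_sqr.
  apply: gt0_ler_poweR => //.
  + by rewrite in_itv/= leey andbT adde_ge0// integral_ge0// => t _; rewrite lee_fin sqr_ge0.
  + by rewrite in_itv/= leey andbT lee_fin addr_ge0// mulr_ge0 ?sqr_ge0 ?ltW.
  rewrite (EFinD (b n ^+ 2 * T)) leeD//; apply: integral_sqr_le => t /ubn[h1 h2].
    by rewrite L2norm_ge0.
  by rewrite L2norm_ge0.
- exact: cvg_cst.
- apply: cvg_EFin; first exact: nearW.
  rewrite -(mulr0 (Num.sqrt (T *+ 2))) -[X in _ * X](normr0 R).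
  by apply: cvgMr; apply: cvg_norm.
Qed.

End H1_convergence.

(** * Integral operators: Schur's test *)
Section finite_fubini.
Context d (X : measurableType d) (R : realType).
Variable mu : {measure set X -> \bar R}.
Hypothesis mu_fin : (mu [set: X] < +oo)%E.
Local Open Scope ereal_scope.

Let fin_mu : fin_num_fun mu.
Proof.
move=> A mA; rewrite ge0_fin_numE// (le_lt_trans _ mu_fin)//.
by apply: le_measure; rewrite ?inE.
Qed.

Let sigma_finite_mu : sigma_finite [set: X] mu.
Proof. by apply: fin_num_fun_sigma_finite => //; rewrite measure0. Qed.

Let mu_finite := isFinite.Build d X R mu fin_mu.

Let mu_sfinite :=
  isSFinite.Build d X R mu (sfinite_measure_sigma_finite sigma_finite_mu).

Let mu_sigma_finite := isSigmaFinite.Build d X R mu sigma_finite_mu.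

Let muf : FiniteMeasure.type X R :=
  HB.pack_for (FiniteMeasure.type X R) (Measure.sort mu)
    mu_finite mu_sfinite mu_sigma_finite.

(** Fubini-Tonelli needs sigma-finite measures; a measure of finite total mass
    is given that structure by [muf]. *)
Lemma measurable_partial_integral (k : X * X -> \bar R) :
  measurable_fun setT k -> (forall z, 0 <= k z) ->
  measurable_fun setT (fun x => \int[mu]_y k (x, y)).
Proof.
move=> mk k0; exact: (@measurable_fun_fubini_tonelli_F _ _ _ _ _ muf k mk k0).
Qed.

Lemma tonelli (k : X * X -> \bar R) :
  measurable_fun setT k -> (forall z, 0 <= k z) ->
  \int[mu]_x \int[mu]_y k (x, y) = \int[mu]_y \int[mu]_x k (x, y).
Proof.
move=> mk k0; exact: (@fubini_tonelli _ _ _ _ _ muf muf k mk k0).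
Qed.
End finite_fubini.

Section schur.
Context d (X : measurableType d) (R : realType).
Variable mu : {measure set X -> \bar R}.
Hypothesis mu_fin : (mu [set: X] < +oo)%E.
Implicit Types (k : X * X -> R) (u v : L2 mu).

(** A symmetric kernel, so that one bound on the sections controls both variables
    in Schur's test. *)
Record schur_kernel k (C : R) : Prop := SchurKernel {
  schur_measurable : measurable_fun [set: X * X] k ;
  schur_sym : forall x y, k (x, y) = k (y, x) ;
  schur_ge0 : 0 <= C ;
  schur_bound : {ae mu, forall x, (\int[mu]_y `|k (x, y)|%:E <= C%:E)%E}
}.

(** For a kernel that passes Schur's test the integral converges absolutely for
    almost every [x]. *)
Definition kop k (u : X -> R) (x : X) : R := \int[mu]_y (k (x, y) * u y).

Definition kabs k (u : X -> R) (x : X) : \bar R :=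
  (\int[mu]_y `|k (x, y) * u y|%:E)%E.

Lemma kabs_ge0 k u x : (0 <= kabs k u x)%E.
Proof. by apply: integral_ge0 => y _; rewrite lee_fin. Qed.

Section kernel.
Variables (k : X * X -> R) (C : R) (kC : schur_kernel k C).

Let mk : measurable_fun [set: X * X] k. Proof. exact: schur_measurable kC. Qed.
Let C0 : 0 <= C. Proof. exact: schur_ge0 kC. Qed.

Lemma measurable_section x : measurable_fun [set: X] (fun y => k (x, y)).
Proof. by apply: measurableT_comp mk _; exact: measurable_pair1. Qed.

Lemma measurable_section_mul u x : measurable_fun [set: X] (fun y => k (x, y) * u y).
Proof.
by apply: measurable_funM; [exact: measurable_section|exact: measurable_L2].
Qed.

Let measurable_mul2 u : measurable_fun [set: X * X] (fun z => k z * u z.2).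
Proof.
apply: measurable_funM mk _.
exact: measurableT_comp (measurable_L2 u) measurable_snd.
Qed.

Lemma measurable_kop u : measurable_fun [set: X] (kop k u).
Proof.
pose f z := (k z * u z.2)%:E.
have mf : measurable_fun [set: X * X] f.
  by apply/measurable_EFinP; exact: measurable_mul2.
have mp := measurable_partial_integral mu_fin (measurable_funepos mf) (funepos_ge0 f).
have mn := measurable_partial_integral mu_fin (measurable_funeneg mf) (funeneg_ge0 f).
rewrite (_ : kop k u = fine \o (fun x =>
    \int[mu]_y f^\+ (x, y) - \int[mu]_y f^\- (x, y))%E).
  apply: measurableT_comp; first by apply: fine_measurable; exact: measurableT.
  exact: (emeasurable_funB mp mn).
apply/funext => x; rewrite /kop /Rintegral integralE /=.
congr fine; congr (_ - _)%E; apply: eq_integral => y _.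
  by rewrite !funepos.unlock.
by rewrite !funeneg.unlock.
Qed.

Lemma measurable_kabs u : measurable_fun [set: X] (kabs k u).
Proof.
pose f (z : X * X) : \bar R := `|k z * u z.2|%:E.
have mf : measurable_fun [set: X * X] f.
  by apply/measurable_EFinP; exact: measurableT_comp (measurable_mul2 u).
have f0 z : (0 <= f z)%E by rewrite lee_fin.
exact: (measurable_partial_integral mu_fin mf f0).
Qed.

Lemma kop_le_kabs u x : (`|kop k u x|%:E <= kabs k u x)%E.
Proof.
rewrite /kop /Rintegral; set I := (\int[mu]_y _)%E.
apply: (@le_trans _ _ `|I|%E).
  by case: I => [r| |]; rewrite /= ?normr0 ?leey// lee_fin.
by apply: le_abse_integral => //; apply/measurable_EFinP; exact: measurable_section_mul.
Qed.

(** Cauchy-Schwarz for the measure [|k (x, y)| dy]. *)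
Lemma kabs_sqr_le u x : (kabs k u x `^ 2 <=
  (\int[mu]_y `|k (x, y)|%:E) * \int[mu]_y (`|k (x, y)| * u y ^+ 2)%:E)%E.
Proof.
pose f y := Num.sqrt `|k (x, y)|; pose g y := Num.sqrt `|k (x, y)| * u y.
have mf : measurable_fun [set: X] f.
  apply: measurableT_comp; first exact: continuous_measurable_fun (@sqrt_continuous R).
  by apply: measurableT_comp => //; exact: measurable_section.
have mg : measurable_fun [set: X] g.
  by apply: measurable_funM => //; exact: measurable_L2.
have := @hoelder _ _ _ mu f g 2 2 mf mg (ltr0n _ 2) (ltr0n _ 2).
rewrite Lnorm1 => /(_ ltac:(lra)).
have -> : (\int[mu]_y `|(EFin \o (f \* g)%R) y|)%E = kabs k u x.
  apply: eq_integral => y _ /=.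
  by rewrite /f /g mulrA -expr2 sqr_sqrtr// !normrM normr_id.
move=> h; have : (kabs k u x `^ 2 <= ('N[mu]_2%:E [EFin \o f] * 'N[mu]_2%:E [EFin \o g]) `^ 2)%E.
  by apply: gt0_ler_poweR => //; rewrite in_itv/= leey ?mule_ge0 ?kabs_ge0 ?Lnorm_ge0.
rewrite poweRM ?Lnorm_ge0// !poweR_Lnorm//.
rewrite (_ : (\int[mu]_x0 `|(EFin \o f) x0| `^ 2)%E = \int[mu]_y `|k (x, y)|%:E)%E.
  rewrite (_ : (\int[mu]_x0 `|(EFin \o g) x0| `^ 2)%E =
    \int[mu]_y (`|k (x, y)| * u y ^+ 2)%:E)%E//.
  apply: eq_integral => y _ /=.
  by rewrite powR_mulrn// normrM exprMn real_normK ?num_real// sqr_sqrtr// real_normK ?num_real.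
apply: eq_integral => y _ /=.
by rewrite powR_mulrn// real_normK ?num_real// sqr_sqrtr.
Qed.

(** Integrate the previous inequality in [x] and exchange the integrals:
    each of the two integrals of [|k|] contributes a factor [C]. *)
Lemma schur_test u :
  (\int[mu]_x (kabs k u x `^ 2) <= (C ^+ 2 * L2norm u ^+ 2)%:E)%E.
Proof.
pose F2 (z : X * X) : \bar R := (`|k z| * u z.2 ^+ 2)%:E.
have mF2 : measurable_fun [set: X * X] F2.
  apply/measurable_EFinP; apply: measurable_funM; first exact: measurableT_comp.
  apply: measurable_funX.
  exact: measurableT_comp (measurable_L2 u) measurable_snd.
have F20 z : (0 <= F2 z)%E.
  by rewrite lee_fin mulr_ge0// sqr_ge0.
pose F x := (\int[mu]_y F2 (x, y))%E.
have mF : measurable_fun [set: X] F.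
  exact: (measurable_partial_integral mu_fin mF2 F20).
have F0 x : (0 <= F x)%E by apply: integral_ge0 => y _; exact: (F20 (x, y)).
apply: (@le_trans _ _ (\int[mu]_x (C%:E * F x))%E).
  apply: ae_ge0_le_integral => //.
  - by move=> x _; rewrite poweR_ge0.
  - exact: (measurableT_comp (measurable_poweR 2) (measurable_kabs u)).
  - by move=> x _; rewrite mule_ge0.
  - exact: measurable_funeM.
  apply: filterS (schur_bound kC) => x kx _.
  by rewrite (le_trans (kabs_sqr_le _ _))//; apply: lee_wpmul2r => //; exact: F0.
rewrite ge0_integralZl//.
rewrite expr2 -mulrA EFinM; apply: lee_wpmul2l; first by rewrite lee_fin.
rewrite (tonelli mu_fin mF2 F20) EFinM L2norm_sqrE.
rewrite -ge0_integralZl//; last 2 first.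
- by apply/measurable_EFinP; apply: measurable_funX; exact: measurable_L2.
- by move=> x _; rewrite lee_fin sqr_ge0.
apply: ae_ge0_le_integral => //.
- by move=> y _; apply: integral_ge0 => x _; exact: (F20 (x, y)).
- pose F2' (z : X * X) := F2 (z.2, z.1).
  have mF2' : measurable_fun [set: X * X] F2'.
    apply: measurableT_comp mF2 _.
    by apply: measurable_fun_pair; [exact: measurable_snd|exact: measurable_fst].
  have F20' z : (0 <= F2' z)%E by exact: F20.
  exact: (measurable_partial_integral mu_fin mF2' F20').
- by move=> y _; rewrite mule_ge0// lee_fin sqr_ge0.
- apply: measurable_funeM; apply/measurable_EFinP; apply: measurable_funX.
  exact: measurable_L2.
apply: filterS (schur_bound kC) => y ky _.
rewrite (_ : (\int[mu]_x F2 (x, y))%E =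
    (u y ^+ 2)%:E * \int[mu]_x `|k (y, x)|%:E)%E.
  by rewrite muleC; apply: lee_wpmul2r => //; rewrite lee_fin sqr_ge0.
rewrite -ge0_integralZl//; last 2 first.
- by apply/measurable_EFinP; apply: measurableT_comp => //; exact: measurable_section.
- by rewrite lee_fin sqr_ge0.
apply: eq_integral => x _.
by rewrite /F2 (schur_sym kC) /= mulrC.
Qed.

Lemma kabs_fin u : {ae mu, forall x, (kabs k u x < +oo)%E}.
Proof.
have i : mu.-integrable [set: X] (fun x => kabs k u x `^ 2)%E.
  apply/integrableP; split.
    exact: (measurableT_comp (measurable_poweR 2) (measurable_kabs u)).
  under eq_integral do rewrite gee0_abs ?poweR_ge0//.
  exact: le_lt_trans (schur_test u) (ltry _).
apply: filterS (integrable_ae measurableT i) => x /(_ I).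
rewrite ltey; case E : (kabs k u x) => [r| |]//.
by rewrite /poweR/= pnatr_eq0.
Qed.

Lemma kop_integrable u : {ae mu, forall x,
  mu.-integrable [set: X] (EFin \o (fun y => k (x, y) * u y))}.
Proof.
apply: filterS (kabs_fin u) => x kx; apply/integrableP; split => //.
by apply/measurable_EFinP; exact: measurable_section_mul.
Qed.

Lemma kop_sqr_le u :
  (\int[mu]_x (kop k u x ^+ 2)%:E <= (C ^+ 2 * L2norm u ^+ 2)%:E)%E.
Proof.
apply: le_trans (schur_test u); apply: ge0_le_integral => //.
- by move=> x _; rewrite lee_fin sqr_ge0.
- by apply/measurable_EFinP; apply: measurable_funX; exact: measurable_kop.
- exact: (measurableT_comp (measurable_poweR 2) (measurable_kabs u)).
move=> x _; apply: (@le_trans _ _ (`|kop k u x|%:E `^ 2)%E).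
  by rewrite poweR_EFin powR_mulrn// real_normK ?num_real.
apply: gt0_ler_poweR => //; last exact: kop_le_kabs.
  by rewrite in_itv/= leey lee_fin normr_ge0.
by rewrite in_itv/= leey kabs_ge0.
Qed.

Lemma kop_bounded_op : exists2 A : L2 mu -> L2 mu,
  (forall u, A u =1 kop k u) & bounded_op A C.
Proof.
have /choice[A AP] : forall u, exists v : L2 mu, v =1 kop k u.
  move=> u; apply: L2_of_sqr_integrable; first exact: measurable_kop.
  exact: le_lt_trans (kop_sqr_le u) (ltry _).
exists A => //; split=> // [u v|a u|u].
- apply/L2norm_sub_eq0.
  apply: filterS2 (kop_integrable u) (kop_integrable v) => x iu iv _.
  rewrite AP; transitivity (A u x + A v x) => //; rewrite !AP /kop -RintegralD//.
  by apply: eq_Rintegral => y _; rewrite L2D_apply mulrDr.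
- apply/L2norm_sub_eq0; apply: filterS (kop_integrable u) => x iu _.
  rewrite AP; transitivity (a * A u x) => //; rewrite AP /kop -RintegralZl//.
  by apply: eq_Rintegral => y _; rewrite L2Z_apply mulrCA.
- rewrite -(@ler_pXn2r _ 2) ?nnegrE ?mulr_ge0 ?L2norm_ge0//.
  rewrite exprMn -lee_fin L2norm_sqrE.
  under eq_integral do rewrite AP.
  exact: kop_sqr_le.
Qed.

End kernel.

(** Almost everywhere [A1 u - A2 u] is the value at [u] of the operator with kernel
    [k1 - k2], to which Schur's test applies. *)
Lemma kop_difference (k1 k2 : X * X -> R) C1 C2 eps (A1 A2 : L2 mu -> L2 mu) :
  schur_kernel k1 C1 -> schur_kernel k2 C2 ->
  schur_kernel (fun z => k1 z - k2 z) eps ->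
  (forall u, A1 u =1 kop k1 u) -> (forall u, A2 u =1 kop k2 u) ->
  forall u, L2norm (A1 u - A2 u) <= eps * L2norm u.
Proof.
move=> s1 s2 s12 A1P A2P u; have [A AP Ab] := kop_bounded_op s12.
rewrite (le_trans _ (bop_le Ab u))//.
rewrite (le_trans (L2norm_le_dist _ (A u)))// gerDl le_eqVlt; apply/orP; left.
apply/eqP/L2norm_sub_eq0.
apply: filterS2 (kop_integrable s1 u) (kop_integrable s2 u) => x i1 i2 _.
rewrite AP; transitivity (A1 u x - A2 u x) => //; rewrite A1P A2P /kop -RintegralB//.
by apply: eq_Rintegral => y _; rewrite mulrBl.
Qed.

End schur.

(** * Integrability of Riesz kernels on bounded sets *)
Section restricted_measure.
Context d (X : measurableType d) (R : realType).
Variables (mu : {measure set X -> \bar R}) (D : set X) (mD : measurable D).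
Local Open Scope ereal_scope.
Import HBNNSimple.

(** The level sets of [h] and of its restriction to [D] differ only at level 0,
    which does not contribute to the integral. *)
Lemma sintegral_mrestr (h : {nnsfun X >-> R}) :
  sintegral (mrestr mu mD) h = sintegral mu (h \_ D).
Proof.
rewrite !sintegralET; apply: eq_fsbigr => r _; rewrite /mrestr.
have [->|r0] := eqVneq r 0%R; first by rewrite !mul0e.
congr (_ * mu _); apply/seteqP; split => x /=.
  by move=> [<- Dx]; rewrite patchE mem_set.
by rewrite patchE; case: ifPn => [/[!inE] Dx ->//|_ r0']; rewrite -r0' eqxx in r0.
Qed.

Lemma ge0_integral_mrestr (f : X -> \bar R) : (forall x, 0 <= f x) ->
  \int[mrestr mu mD]_x f x = \int[mu]_(x in D) f x.
Proof.
move=> f0; rewrite !ge0_integralE//=; apply/eqP; rewrite eq_le; apply/andP; split.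
  apply: ge_ereal_sup => _ [h hf <-]; apply: ereal_sup_ubound.
  exists (proj_nnsfun h mD); rewrite -?mrestrict.
    move=> x; rewrite -mrestrict !patchE; case: ifPn => // /[!inE] _.
    by have := hf x; rewrite patchE ifT// inE.
  by rewrite sintegral_mrestr mrestrict.
apply: ge_ereal_sup => _ [h hf <-]; apply: ereal_sup_ubound; exists h.
  move=> x; rewrite patchE ifT ?inE// (le_trans (hf x))// patchE.
  by case: ifPn.
rewrite sintegral_mrestr; apply: eq_sintegral => x /=; rewrite patchE.
case: ifPn => // xD; apply/eqP; rewrite eq_le fun_ge0/=.
by have := hf x; rewrite patchE (negbTE xD) lee_fin.
Qed.

Lemma integral_mrestr (f : X -> \bar R) :
  \int[mrestr mu mD]_x f x = \int[mu]_(x in D) f x.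
Proof.
rewrite [RHS]integralE.
rewrite -(ge0_integral_mrestr (funepos_ge0 f)) -(ge0_integral_mrestr (funeneg_ge0 f)).
exact: integralE.
Qed.

Lemma ae_mrestr : {ae mrestr mu mD, forall x, D x}.
Proof.
exists (~` D); split => //; first exact: measurableC.
by rewrite /mrestr setICl measure0.
Qed.

End restricted_measure.

Section euclidean_norm.
Context (R : realType) (n : nat).
Implicit Types x y : 'rV[R]_n.

Lemma enorm_ge0 x : 0 <= enorm x. Proof. exact: sqrtr_ge0. Qed.

Lemma coord_le_enorm x i : `|x 0 i| <= enorm x.
Proof.
rewrite -sqrtr_sqr ler_sqrt ?sumr_ge0// => [|j _]; last exact: sqr_ge0.
by rewrite (bigD1 i)//= lerDl sumr_ge0// => j _; exact: sqr_ge0.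
Qed.

Lemma enorm_eq0 x : enorm x = 0 -> x = 0.
Proof.
move=> x0; apply/rowP => i; rewrite mxE.
by apply/eqP; rewrite -normr_le0 -x0 coord_le_enorm.
Qed.

Lemma enorm_gt0 x y : x <> y -> 0 < enorm (x - y).
Proof.
move=> xy; rewrite lt_neqAle enorm_ge0 andbT eq_sym; apply/eqP => /enorm_eq0.
by move/eqP; rewrite subr_eq0 => /eqP.
Qed.

Lemma enorm_sub_sym x y : enorm (x - y) = enorm (y - x).
Proof.
rewrite /enorm; congr Num.sqrt; apply: eq_bigr => i _.
by rewrite !mxE -sqrrN opprB.
Qed.

Lemma enorm_sub_le x y M : enorm x <= M -> enorm y <= M ->
  enorm (x - y) <= Num.sqrt n%:R * (M *+ 2).
Proof.
move=> xM yM; have M0 : 0 <= M by exact: le_trans (enorm_ge0 x) xM.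
have M2 : 0 <= M *+ 2 by rewrite mulrn_wge0.
rewrite -[M *+ 2]ger0_norm// -sqrtr_sqr -sqrtrM ?ler0n// ler_sqrt; last first.
  by rewrite mulr_ge0// sqr_ge0.
apply: (@le_trans _ _ (\sum_(i < n) (M *+ 2) ^+ 2)); last first.
  by rewrite sumr_const card_ord mulr_natl.
apply: ler_sum => i _; rewrite !mxE -real_normK ?num_real//.
rewrite lerXn2r ?nnegrE// (le_trans (ler_normB _ _))// mulr2n lerD//.
  exact: le_trans (coord_le_enorm x i) xM.
exact: le_trans (coord_le_enorm y i) yM.
Qed.

Lemma measurable_enorm_sub :
  measurable_fun [set: 'rV[R]_n * 'rV[R]_n] (fun z => enorm (z.1 - z.2)).
Proof.
have ms : measurable_fun [set: R] (@Num.sqrt R).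
  exact: continuous_measurable_fun (@sqrt_continuous R).
apply: (measurableT_comp ms).
apply: measurable_sum => i; apply: measurable_funX.
rewrite (_ : (fun z => _) = fun z : 'rV[R]_n * 'rV[R]_n => z.1 0 i - z.2 0 i).
  apply: measurable_funB.
    exact: measurableT_comp (@measurable_coord_rV R n i) measurable_fst.
  exact: measurableT_comp (@measurable_coord_rV R n i) measurable_snd.
by apply/funext => z; rewrite !mxE.
Qed.

Definition box x (r : R) : set 'rV[R]_n := [set y | forall i, `|x 0 i - y 0 i| <= r].

(** Boxes replace balls in the estimates: their measure is known exactly and
    the sup norm is at most the Euclidean norm. *)
Lemma lebesgue_box x r : 0 <= r -> lebesgue_rV n (box x r) = ((2 * r) ^+ n)%:E.
Proof.
move=> r0; pose A (i : 'I_n) := `[x 0 i - r, x 0 i + r]%classic : set R.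
have -> : box x r = [set y | forall i, A i (y 0 i)].
  apply/seteqP; split => y /= h i; have := h i; rewrite /A /= in_itv/=.
    by rewrite ler_distlC.
  by rewrite ler_distlC.
rewrite lebesgue_rV_box; last by move=> i; exact: measurable_itv.
rewrite (eq_bigr (fun=> (2 * r)%:E)) => [|i _].
  by rewrite prodEFin prodr_const card_ord.
rewrite /A lebesgue_measure_itv/= lte_fin; case: ifPn => h.
  by rewrite -EFinB; congr EFin; ring.
congr EFin; apply/eqP; rewrite eq_le; apply/andP; split; lra.
Qed.

Lemma measurable_box x r : measurable (box x r).
Proof.
have -> : box x r = \big[setI/setT]_(i < n)
    ((fun y : 'rV[R]_n => y 0 i) @^-1` `[x 0 i - r, x 0 i + r]).
  rewrite -bigcap_seq; apply/seteqP; split => y h i //=.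
    by move=> _; rewrite in_itv/= -ler_distlC; exact: h.
  by have := h i; rewrite /= mem_index_enum in_itv/= -ler_distlC; exact.
apply: bigsetI_measurable => i _.
by rewrite -[X in measurable X]setTI; apply: measurable_coord_rV.
Qed.

End euclidean_norm.

Section riesz_bound.
Context (R : realType) (d : nat).
Notation leb := (@lebesgue_rV R d).

(** [k.+1] is the least exponent [j] with [2^-j < r]. *)
Lemma dyadic_scale (r : R) : 0 < r -> r < 1 ->
  exists k : nat, 2^-1 ^+ k.+1 < r /\ r <= 2^-1 ^+ k.
Proof.
move=> r0 r1.
have ex : exists k : nat, (2^-1 : R) ^+ k < r.
  have /cvgrPdist_lt/(_ _ r0) : (2^-1 : R) ^+ n @[n --> \oo] --> (0 : R).
    by apply: cvg_expr; rewrite ger0_norm ?invr_ge0// invf_lt1// ltr1n.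
  move=> [n _ /(_ n (leqnn n))]; rewrite sub0r normrN => h.
  by exists n; rewrite (le_lt_trans (ler_norm _)).
case: (ex_minnP ex) => -[|k] kr kmin; first by move: kr; rewrite expr0 ltNge ltW.
exists k; split => //; rewrite leNgt; apply/negP => /kmin; by rewrite ltnn.
Qed.

Section gamma.
Variables (g : R) (g_gt0 : 0 < g) (gd : g < d%:R).
Let p : R := 2 `^ g.
Let q : R := p / 2 ^+ d.

Let p0 : 0 < p. Proof. by rewrite powR_gt0. Qed.

Let q01 : 0 < q < 1.
Proof.
rewrite divr_gt0 ?exprn_gt0//= ltr_pdivrMr ?exprn_gt0// mul1r.
rewrite -powR_mulrn// /p /powR pnatr_eq0/= ltr_expR ltr_pM2r//.
by rewrite ln_gt0// ltr1n.
Qed.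

(** If [2^-(k+1) < r <= 2^-k], the k-th term of the series is already larger than
    [r^-g]; if [1 <= r], the constant 1 is. *)
Lemma inv_powR_le_dyadic (r : R) : 0 <= r ->
  (((r `^ g)^-1)%:E <=
   1 + \sum_(0 <= k <oo) (p ^+ k.+1 * (r <= 2^-1 ^+ k)%R%:R)%:E)%E.
Proof.
move=> r0; have u0 k : (0 <= (p ^+ k.+1 * (r <= 2^-1 ^+ k)%R%:R)%:E)%E.
  by rewrite lee_fin mulr_ge0 ?ler0n// exprn_ge0// ltW.
have S0 : (0 <= \sum_(0 <= k <oo) (p ^+ k.+1 * (r <= 2^-1 ^+ k)%R%:R)%:E)%E.
  by apply: nneseries_ge0 => k _ _; exact: u0.
have [r1|r1] := leP 1 r.
  apply: (@le_trans _ _ 1%E); last by rewrite leeDl.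
  rewrite lee_fin invf_le1 ?powR_gt0 ?(lt_le_trans ltr01)//.
  rewrite (_ : 1 = 1 `^ g); last by rewrite powR1.
  by rewrite ge0_ler_powR ?nnegrE// ltW.
have [re|rn0] := eqVneq r 0.
  rewrite {1}re powR0 ?gt_eqF// invr0.
  by rewrite (@le_trans _ _ 1%E) ?lee_fin ?ler01// leeDl.
have {rn0}r0 : 0 < r by rewrite lt_neqAle eq_sym rn0.
have [k [kr rk]] := dyadic_scale r0 r1.
apply: (@le_trans _ _ (p ^+ k.+1)%:E); last first.
  apply: (@le_trans _ _ (\sum_(0 <= k <oo) (p ^+ k.+1 * (r <= 2^-1 ^+ k)%R%:R)%:E)%E).
    apply: le_trans (nneseries_lim_ge k.+1 (fun i _ _ => u0 i)).
    rewrite big_nat_recr//= rk mulr1 leeDr//; apply: sume_ge0 => i _; exact: u0.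
  by rewrite leeDr.
rewrite lee_fin invf_ple ?posrE ?powR_gt0 ?exprn_gt0//.
have -> : (p ^+ k.+1)^-1 = (2^-1 ^+ k.+1) `^ g.
  have h0 : (0 : R) <= 2^-1 by rewrite invr_ge0.
  rewrite -(powR_mulrn k.+1 h0) powRAC powR_mulrn ?powR_ge0// -exprVn.
  congr (_ ^+ _); rewrite -(powR_inv1 (ltW p0)) /p powRAC.
  by rewrite powR_inv1.
by rewrite ge0_ler_powR ?nnegrE ?exprn_ge0 ?invr_ge0// ltW.
Qed.

Variable m : {measure set 'rV[R]_d -> \bar R}.
Hypothesis m_leb : forall A, measurable A -> (m A <= leb A)%E.
Hypothesis m_fin : (m [set: 'rV[R]_d] < +oo)%E.

Definition riesz_const : R := fine (m [set: 'rV[R]_d]) + p * 2 ^+ d / (1 - q).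

Lemma riesz_const_ge0 : 0 <= riesz_const.
Proof.
have /andP[q0 q1] := q01.
by rewrite addr_ge0 ?fine_ge0// divr_ge0 ?mulr_ge0 ?exprn_ge0 ?subr_ge0 ?ltW.
Qed.

(** The k-th dyadic box has measure at most [(2 * 2^-k)^d], so the integrated
    series is geometric with ratio [2^(g - d) < 1]. *)
Lemma integral_inv_powR_le (x : 'rV[R]_d) :
  (\int[m]_y ((enorm (x - y) `^ g)^-1)%:E <= riesz_const%:E)%E.
Proof.
pose u k (y : 'rV[R]_d) : \bar R := ((p ^+ k.+1)%:E * (\1_(box x (2^-1 ^+ k)) y)%:E)%E.
have u0 k y : (0 <= u k y)%E by rewrite mule_ge0// lee_fin ?ler0n// exprn_ge0// ltW.
have mu_ k : measurable_fun [set: 'rV[R]_d] (u k).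
  apply: measurable_funeM; apply/measurable_EFinP.
  by apply: measurable_indic; exact: measurable_box.
have mS : measurable_fun [set: 'rV[R]_d] (fun y => \sum_(0 <= k <oo) u k y)%E.
  by apply: ge0_emeasurable_sum.
have mE : measurable_fun [set: 'rV[R]_d] (fun y => ((enorm (x - y) `^ g)^-1)%:E).
  apply/measurable_EFinP.
  have me : measurable_fun [set: 'rV[R]_d] (fun y => enorm (x - y)).
    exact: (measurableT_comp (@measurable_enorm_sub R d) (measurable_pair1 x)).
  under eq_fun do rewrite -powRN.
  exact: (measurableT_comp (measurable_powR _) me).
apply: (@le_trans _ _ (\int[m]_y (1 + \sum_(0 <= k <oo) u k y))%E).
  apply: ge0_le_integral => //.
  - by move=> y _; rewrite lee_fin invr_ge0 powR_ge0.
  - by apply: emeasurable_funD.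
  move=> y _; rewrite (le_trans (inv_powR_le_dyadic (enorm_ge0 _)))//.
  apply: leeD => //; apply: lee_nneseries => k _.
    by rewrite lee_fin mulr_ge0 ?ler0n// exprn_ge0// ltW.
  rewrite /u -EFinM lee_fin; apply: ler_wpM2l; first by rewrite exprn_ge0// ltW.
  rewrite indicE.
  case: (leP (enorm _) _) => h; last by case: (_ \in _).
  rewrite mem_set//= => i.
  by rewrite (le_trans _ h)//; have := coord_le_enorm (x - y) i; rewrite !mxE.
rewrite ge0_integralD//; last by move=> y _; exact: nneseries_ge0.
rewrite integral_cst// mul1e EFinD fineK ?ge0_fin_numE//; apply: leeD => //.
rewrite integral_nneseries//.
have /andP[q0 q1] := q01.
apply: (@le_trans _ _ (\sum_(0 <= k <oo) (p * 2 ^+ d * q ^+ k)%:E)%E).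
  apply: lee_nneseries => k _; first by move=> _; apply: integral_ge0 => y _; exact: u0.
  rewrite ge0_integralZl//; last 2 first.
  - by apply/measurable_EFinP; apply: measurable_indic; exact: measurable_box.
  - by rewrite lee_fin exprn_ge0// ltW.
  rewrite integral_indic//; last exact: measurable_box.
  rewrite setIT; apply: (@le_trans _ _ ((p ^+ k.+1)%:E * leb (box x (2^-1 ^+ k)))%E).
    by apply: lee_wpmul2l; [rewrite lee_fin exprn_ge0// ltW|apply: m_leb; exact: measurable_box].
  rewrite lebesgue_box ?exprn_ge0// -EFinM lee_fin.
  have -> : (2 * 2^-1 ^+ k) ^+ d = 2 ^+ d * (2^-1 ^+ d) ^+ k :> R.
    by rewrite exprMn -!exprM mulnC.
  have -> : q ^+ k = p ^+ k * (2^-1 ^+ d) ^+ k by rewrite /q exprMn exprVn.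
  by rewrite exprS le_eqVlt; apply/orP; left; apply/eqP; ring.
apply: lime_le; first by apply: is_cvg_nneseries => k _ _;
  rewrite lee_fin !mulr_ge0 ?exprn_ge0// ltW.
apply: nearW => n; rewrite sumEFin lee_fin.
rewrite (_ : \sum_(0 <= k < n) _ = series (geometric (p * 2 ^+ d) q) n)//.
rewrite geometric_seriesE ?lt_eqF//=.
rewrite ler_pM2r ?invr_gt0 ?subr_gt0//; apply: ler_piMr.
  by rewrite mulr_ge0 ?exprn_ge0// ltW.
by rewrite gerBl exprn_ge0// ltW.
Qed.

End gamma.
End riesz_bound.

(** * The kernels of the evolution equations *)
Section pointwise_estimates.
Context (R : realType).
Implicit Types (s l b r : R).

Lemma expR_sub1_le s : expR s - 1 <= s * expR s.
Proof.
have := expR_ge1Dx (- s); rewrite expRN => h.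
have e0 := expR_gt0 s.
rewrite -(ler_pM2r e0) mulVf ?gt_eqF// in h; lra.
Qed.

(** Both bounds follow from [1 + s <= exp s] at [s] and at [- s]. *)
Lemma expR_taylor1 s : 0 <= expR s - 1 - s <= s ^+ 2 * expR `|s|.
Proof.
have h1 := expR_ge1Dx s; have h2 := expR_sub1_le s.
apply/andP; split; first lra.
apply: (@le_trans _ _ (s * (expR s - 1))); first lra.
have [s0|s0] := leP 0 s.
  by rewrite (ger0_norm s0) expr2 -mulrA ler_wpM2l.
have e1 : 1 <= expR (- s) by have := expR_ge1Dx (- s); lra.
have s2 : 0 <= s ^+ 2 by rewrite sqr_ge0.
apply: (@le_trans _ _ (s ^+ 2)); first by rewrite expr2; nra.
by rewrite (ltr0_norm s0) ler_peMr.
Qed.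

Lemma expR_half_abs l : expR (`|l| / 2) <= expR (l / 2) + expR (- l / 2).
Proof.
have [l0|l0] := leP 0 l.
  by rewrite ger0_norm// lerDl expR_ge0.
by rewrite ltr0_norm// lerDr expR_ge0.
Qed.

Lemma abs_le_expR_half l : `|l| <= 2 * (expR (l / 2) + expR (- l / 2)).
Proof. by have := expR_ge1Dx (`|l| / 2); have := expR_half_abs l; lra. Qed.

Lemma sqr_le_expR l : l ^+ 2 <= 64 * expR (`|l| / 4).
Proof.
have h := expR_ge1Dx (`|l| / 8); have l0 := normr_ge0 l.
have -> : expR (`|l| / 4) = expR (`|l| / 8) * expR (`|l| / 8).
  by rewrite -expRD; congr expR; lra.
rewrite -[l ^+ 2]real_normK ?num_real//; nra.
Qed.

(** [s := b * l] in the previous Taylor estimate gives [b * l^2 * exp (b * |l|)];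
    as [b <= 1/4] and [l^2 <= 64 * exp (|l| / 4)], this is at most
    [64 * b * exp (|l| / 2)]. *)
Lemma difference_quotient_le b l : 0 < b -> b <= 1 / 4 ->
  `|(expR (b * l) - 1) / b - l| <= b * (64 * (expR (l / 2) + expR (- l / 2))).
Proof.
move=> b0 b4; have /andP[h1 h2] := expR_taylor1 (b * l).
have -> : (expR (b * l) - 1) / b - l = (expR (b * l) - 1 - b * l) / b.
  by field; rewrite gt_eqF.
rewrite normrM normfV (gtr0_norm b0) ger0_norm// ler_pdivrMr//.
apply: le_trans h2 _; rewrite normrM (gtr0_norm b0).
rewrite [leLHS](_ : _ = b ^+ 2 * (l ^+ 2 * expR (b * `|l|))); last by ring.
rewrite [leRHS](_ : _ = b ^+ 2 * (64 * (expR (l / 2) + expR (- l / 2)))); last by ring.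
rewrite ler_pM2l ?exprn_gt0//.
have e1 : expR (b * `|l|) <= expR (`|l| / 4).
  rewrite ler_expR mulrC ler_wpM2l//; lra.
have e2 := sqr_le_expR l; have e3 := expR_half_abs l.
have e4 : expR (`|l| / 4) * expR (`|l| / 4) = expR (`|l| / 2).
  by rewrite -expRD; congr expR; lra.
apply: (@le_trans _ _ (64 * expR (`|l| / 4) * expR (`|l| / 4))).
  by apply: ler_pM => //; rewrite ?sqr_ge0 ?expR_ge0.
by rewrite -mulrA e4; lra.
Qed.

Lemma powRN_expR r b : 0 < r -> (r `^ b)^-1 = expR (b * ln (1 / r)).
Proof.
by move=> r0; rewrite -powRN /powR gt_eqF// div1r lnV ?posrE// mulrN mulNr.
Qed.

(** The previous estimate at [l = ln (1 / r)], where [exp (l / 2) = r^(-1/2)]. *)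
Lemma riesz_sub_log_le r b : 0 < r -> 0 < b -> b <= 1 / 4 ->
  `|((r `^ b)^-1 - 1) / b - ln (1 / r)| <=
  b * (64 * ((r `^ 2^-1)^-1 + r `^ 2^-1)).
Proof.
move=> r0 b0 b4; rewrite !powRN_expR//.
have -> : r `^ 2^-1 = expR (- ln (1 / r) / 2).
  rewrite /powR gt_eqF// div1r lnV ?posrE//; congr expR; lra.
rewrite (mulrC 2^-1); exact: difference_quotient_le.
Qed.

Lemma log_le r : 0 < r -> `|ln (1 / r)| <= 2 * ((r `^ 2^-1)^-1 + r `^ 2^-1).
Proof.
move=> r0; rewrite !powRN_expR//.
have -> : r `^ 2^-1 = expR (- ln (1 / r) / 2).
  rewrite /powR gt_eqF// div1r lnV ?posrE//; congr expR; lra.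
rewrite (mulrC 2^-1); exact: abs_le_expR_half.
Qed.

End pointwise_estimates.

Section Rintegral_scaling.
Context d (X : measurableType d) (R : realType).
Variable mu : {measure set X -> \bar R}.

Lemma Rintegral_not_integrable (f : X -> R) : measurable_fun [set: X] f ->
  ~ mu.-integrable [set: X] (EFin \o f) -> \int[mu]_x f x = 0.
Proof.
move=> mf nif; rewrite /Rintegral.
case E : (\int[mu]_x (f x)%:E)%E => [r| |]//; case: nif.
apply/integrableP; split; first exact/measurable_EFinP.
by rewrite (integral_fin_num_abs mu measurableT mf) E.
Qed.

(** If [f] is not integrable, neither is [c * f] for [c != 0], and both real
    integrals are 0 by convention. This makes the formulas
    for the potentials and the energies true at every point. *)
Lemma Rintegral_scale (c : R) (f : X -> R) : measurable_fun [set: X] f ->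
  \int[mu]_x (c * f x) = c * \int[mu]_x f x.
Proof.
move=> mf; have [->|c0] := eqVneq c 0.
  by under eq_Rintegral do rewrite mul0r; rewrite mul0r Rintegral_cst// mul0r.
have [fi|nfi] := pselect (mu.-integrable [set: X] (EFin \o f)).
  exact: RintegralZl.
rewrite !Rintegral_not_integrable ?mulr0//; first exact: measurable_funM.
move=> i; apply: nfi.
rewrite (_ : EFin \o f = fun x => ((c^-1)%:E * (EFin \o (fun x => c * f x)%R) x)%E).
  exact: integrableZl.
by apply/funext => x /=; rewrite -EFinM mulKf.
Qed.

End Rintegral_scaling.

Section kernels_on_bounded_domain.
Context (R : realType) (d : nat) (d_ge1 : (1 <= d)%N).
Variables (Omega : set 'rV[R]_d) (oOmega : open Omega).
Hypothesis bOmega : ebounded Omega.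
Notation leb := (@lebesgue_rV R d).
Notation mu := (lebesgue_on oOmega).
Notation V := (L2 mu).

Lemma lebesgue_on_le (A : set 'rV[R]_d) : measurable A -> (mu A <= leb A)%E.
Proof.
move=> mA; apply: le_measure; rewrite ?inE//.
by apply: measurableI => //; exact: open_measurable_rV.
Qed.

Lemma integral_lebesgue_on (f : 'rV[R]_d -> \bar R) :
  (\int[mu]_x f x = \int[leb]_(x in Omega) f x)%E.
Proof. exact: integral_mrestr. Qed.

Lemma Rintegral_lebesgue_on (f : 'rV[R]_d -> R) :
  \int[mu]_x f x = \int[leb]_(x in Omega) f x.
Proof. by rewrite /Rintegral -integral_lebesgue_on. Qed.

Lemma lebesgue_on_finite : (mu [set: 'rV[R]_d] < +oo)%E.
Proof.
have [M OM] := bOmega.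
have mO : measurable Omega by exact: open_measurable_rV.
apply: (@le_lt_trans _ _ (leb (box 0 `|M|))); last by rewrite lebesgue_box// ltry.
apply: le_measure; rewrite ?inE.
- exact: measurableI.
- exact: measurable_box.
move=> x [_ Ox] i; rewrite mxE sub0r normrN.
by rewrite (le_trans (coord_le_enorm x i))// (le_trans (OM _ Ox))// ler_norm.
Qed.

Lemma ae_in_domain : {ae mu, forall x, Omega x}.
Proof. exact: ae_mrestr. Qed.

Lemma ae_neq (x : 'rV[R]_d) : {ae mu, forall y, x <> y}.
Proof.
exists (box x 0); split; first exact: measurable_box.
  apply/eqP; rewrite eq_le measure_ge0 andbT.
  rewrite (le_trans (lebesgue_on_le (measurable_box x 0)))//.
  by rewrite lebesgue_box// mulr0 expr0n gtn_eqF.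
move=> y /= /contrapT -> i; by rewrite subrr normr0.
Qed.

Definition domain_const (g : R) : R :=
  fine (mu [set: 'rV[R]_d]) + riesz_const g mu.

Lemma domain_const_ge0 g : 0 < g -> g < d%:R -> 0 <= domain_const g.
Proof. by move=> g0 gd; rewrite addr_ge0 ?fine_ge0// riesz_const_ge0. Qed.

Definition kdist (z : 'rV[R]_d * 'rV[R]_d) : R := enorm (z.1 - z.2).

Lemma measurable_kpow g :
  measurable_fun [set: 'rV[R]_d * 'rV[R]_d] (fun z => (kdist z `^ g)^-1).
Proof.
under eq_fun do rewrite -powRN.
exact: (measurableT_comp (measurable_powR _) (@measurable_enorm_sub R d)).
Qed.

(** The bound is required off the diagonal only: the diagonal is where the
    kernels are singular, and single points are null because [1 <= d]. *)
Lemma schur_of_bound (k : 'rV[R]_d * 'rV[R]_d -> R) g D :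
  measurable_fun [set: 'rV[R]_d * 'rV[R]_d] k ->
  (forall x y, k (x, y) = k (y, x)) -> 0 < g -> g < d%:R -> 0 <= D ->
  (forall x y, Omega x -> Omega y -> x <> y ->
    `|k (x, y)| <= D * (1 + (enorm (x - y) `^ g)^-1)) ->
  schur_kernel mu k (D * domain_const g).
Proof.
move=> mk ksym g0 gd D0 kD; split => //.
  by rewrite mulr_ge0// domain_const_ge0.
apply: filterS ae_in_domain => x Ox.
have mx : measurable_fun [set: 'rV[R]_d] (fun y => k (x, y)).
  exact: (measurableT_comp mk (measurable_pair1 x)).
have me : measurable_fun [set: 'rV[R]_d] (fun y => (enorm (x - y) `^ g)^-1).
  exact: (measurableT_comp (measurable_kpow g) (measurable_pair1 x)).
have e0 y : 0 <= (enorm (x - y) `^ g)^-1 by rewrite invr_ge0 powR_ge0.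
apply: (@le_trans _ _ (\int[mu]_y (D%:E * (1 + (enorm (x - y) `^ g)^-1)%:E))%E).
  apply: ae_ge0_le_integral => //.
  - by apply/measurable_EFinP; exact: measurableT_comp.
  - by move=> y _; rewrite -EFinM lee_fin mulr_ge0// addr_ge0.
  - by apply: measurable_funeM; apply/measurable_EFinP; exact: measurable_funD.
  apply: filterS2 ae_in_domain (ae_neq x) => y Oy xy _.
  by rewrite -EFinM lee_fin kD.
rewrite ge0_integralZl//; last 2 first.
- by apply/measurable_EFinP; exact: measurable_funD.
- by move=> y _; rewrite lee_fin addr_ge0.
rewrite EFinM; apply: lee_wpmul2l; first by rewrite lee_fin.
under eq_integral do rewrite EFinD.
rewrite ge0_integralD//; last 2 first.
- by move=> y _; rewrite lee_fin.
- exact/measurable_EFinP.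
rewrite integral_cst// mul1e EFinD; apply: leeD.
  by rewrite fineK// ge0_fin_numE// lebesgue_on_finite.
exact: (integral_inv_powR_le g0 gd lebesgue_on_le lebesgue_on_finite x).
Qed.

Definition pow_kernel (b : R) z := (kdist z `^ b)^-1.
Definition riesz_kernel (b : R) z := 2 / b * (pow_kernel b z - 1).
Definition log_kernel z := 2 * ln (1 / kdist z).

Lemma kdist_sym x y : kdist (x, y) = kdist (y, x).
Proof. exact: enorm_sub_sym. Qed.

Lemma schur_pow b : 0 < b -> b < d%:R ->
  schur_kernel mu (pow_kernel b) (1 * domain_const b).
Proof.
move=> b0 bd; have ksym x y : pow_kernel b (x, y) = pow_kernel b (y, x).
  by rewrite /pow_kernel kdist_sym.
apply: (schur_of_bound (measurable_kpow b) ksym b0 bd ler01) => x y _ _ _.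
rewrite mul1r ger0_norm; first by rewrite lerDr.
by rewrite invr_ge0 powR_ge0.
Qed.

Lemma measurable_riesz_kernel b :
  measurable_fun [set: 'rV[R]_d * 'rV[R]_d] (riesz_kernel b).
Proof.
apply: measurable_funM => //; apply: measurable_funB => //.
exact: measurable_kpow.
Qed.

Lemma schur_riesz b : 0 < b -> b < d%:R ->
  schur_kernel mu (riesz_kernel b) (2 / b * domain_const b).
Proof.
move=> b0 bd; have ksym x y : riesz_kernel b (x, y) = riesz_kernel b (y, x).
  by rewrite /riesz_kernel /pow_kernel kdist_sym.
have D0 : 0 <= 2 / b by rewrite divr_ge0// ltW.
apply: (schur_of_bound (measurable_riesz_kernel b) ksym b0 bd D0) => x y _ _ _.
rewrite normrM (ger0_norm D0); apply: ler_wpM2l => //.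
rewrite (le_trans (ler_normB _ _))// normr1 addrC.
by rewrite lerD2l ger0_norm// invr_ge0 powR_ge0.
Qed.

Let half_gt0 : 0 < 2^-1 :> R. Proof. by rewrite invr_gt0. Qed.

Let half_lt_d : 2^-1 < d%:R :> R.
Proof.
apply: (@lt_le_trans _ _ 1); last by rewrite ler1n.
by rewrite invf_lt1// ltr1n.
Qed.

(** The growth of the kernels at large distance is bounded by that of [r^(1/2)],
    hence by a constant on a bounded set. *)
Lemma diameter_bound : exists2 S : R, 0 <= S & forall x y,
  Omega x -> Omega y -> enorm (x - y) `^ 2^-1 <= S.
Proof.
have [M OM] := bOmega.
exists ((Num.sqrt d%:R * (M *+ 2)) `^ 2^-1); first exact: powR_ge0.
move=> x y Ox Oy; have M0 : 0 <= M := le_trans (enorm_ge0 x) (OM _ Ox).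
rewrite ge0_ler_powR ?nnegrE ?enorm_ge0 ?(ltW half_gt0)//.
  by rewrite mulr_ge0 ?sqrtr_ge0// mulrn_wge0.
by apply: enorm_sub_le; exact: OM.
Qed.

Lemma measurable_log_kernel :
  measurable_fun [set: 'rV[R]_d * 'rV[R]_d] log_kernel.
Proof.
apply: measurable_funM => //.
apply: (measurableT_comp (@measurable_ln R)).
rewrite (_ : (fun z => _) = fun z => kdist z `^ (-1)).
  exact: (measurableT_comp (measurable_powR _) (@measurable_enorm_sub R d)).
by apply/funext => z; rewrite powR_inv1 ?div1r// enorm_ge0.
Qed.

Lemma schur_log : exists C, schur_kernel mu log_kernel C.
Proof.
have [S S0 OS] := diameter_bound.
exists (4 * (1 + S) * domain_const 2^-1).
have ksym x y : log_kernel (x, y) = log_kernel (y, x).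
  by rewrite /log_kernel kdist_sym.
have D0 : 0 <= 4 * (1 + S) by rewrite mulr_ge0// addr_ge0.
apply: (schur_of_bound measurable_log_kernel ksym half_gt0 half_lt_d D0).
move=> x y Ox Oy xy.
have r0 := enorm_gt0 xy; have h := log_le r0; have h' := OS x y Ox Oy.
have p0 : 0 <= (enorm (x - y) `^ 2^-1)^-1 by rewrite invr_ge0 powR_ge0.
rewrite normrM ger0_norm// /kdist/=; nra.
Qed.

(** The operator norm of the difference between the n-th operator and the limit
    one is [O(b)], with [b = d - alpha]. *)
Lemma schur_difference : exists2 D : R, 0 <= D & forall b, 0 < b -> b <= 1 / 4 ->
  schur_kernel mu (fun z => riesz_kernel b z - log_kernel z) (b * D).
Proof.
have [S S0 OS] := diameter_bound.
exists (128 * (1 + S) * domain_const 2^-1).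
  by rewrite mulr_ge0 ?domain_const_ge0// mulr_ge0// addr_ge0.
move=> b b0 b4; rewrite mulrA.
pose k z := riesz_kernel b z - log_kernel z.
have mk : measurable_fun [set: 'rV[R]_d * 'rV[R]_d] k.
  apply: measurable_funB; first exact: measurable_riesz_kernel.
  exact: measurable_log_kernel.
have ksym x y : k (x, y) = k (y, x).
  by rewrite /k /riesz_kernel /pow_kernel /log_kernel kdist_sym.
have D0 : 0 <= b * (128 * (1 + S)) by rewrite !mulr_ge0 ?addr_ge0// ltW.
apply: (schur_of_bound mk ksym half_gt0 half_lt_d D0) => x y Ox Oy xy.
rewrite /k.
have r0 := enorm_gt0 xy; have h := riesz_sub_log_le r0 b0 b4.
have h' := OS x y Ox Oy.
have p0 : 0 <= (enorm (x - y) `^ 2^-1)^-1 by rewrite invr_ge0 powR_ge0.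
rewrite /riesz_kernel /log_kernel /pow_kernel /kdist/=.
have E (p l : R) : 2 / b * (p - 1) - 2 * l = 2 * ((p - 1) / b - l).
  by field; rewrite gt_eqF.
rewrite E.
rewrite normrM ger0_norm//.
apply: (@le_trans _ _ (2 * (b * (64 * ((enorm (x - y) `^ 2^-1)^-1 + enorm (x - y) `^ 2^-1))))).
  by apply: ler_wpM2l.
rewrite [leLHS](_ : _ = b * (128 * ((enorm (x - y) `^ 2^-1)^-1 + enorm (x - y) `^ 2^-1))); last by ring.
rewrite -mulrA -mulrA ler_pM2l//; nra.
Qed.

End kernels_on_bounded_domain.

(** * Identification of the evolution equations and of the energies *)
Section identification.
Context (R : realType) (d : nat) (d_ge1 : (1 <= d)%N).
Variables (Omega : set 'rV[R]_d) (oOmega : open Omega).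
Hypothesis bOmega : ebounded Omega.
Notation leb := (@lebesgue_rV R d).
Notation mu := (lebesgue_on oOmega).
Notation V := (L2 mu).

Let mu_fin : (mu [set: 'rV[R]_d] < +oo)%E := lebesgue_on_finite oOmega bOmega.

Lemma L2_one : exists one : V, forall x, one x = 1.
Proof.
apply: (@L2_of_sqr_integrable _ _ _ mu (cst 1)); first exact: measurable_cst.
under eq_integral do rewrite expr1n.
by rewrite integral_cst// mul1e.
Qed.

Lemma L2_integrable (u : V) : mu.-integrable [set: 'rV[R]_d] (EFin \o u).
Proof.
have [one oneE] := L2_one; have := L2_mul_integrable u one.
by under eq_fun do rewrite oneE mulr1.
Qed.

Lemma riesz_potentialE alpha (u : V) x :
  riesz_potential Omega alpha u x = 2 * kop mu (pow_kernel (d%:R - alpha)) u x.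
Proof.
rewrite /riesz_potential -(Rintegral_lebesgue_on oOmega); congr (_ * _).
by apply: eq_Rintegral => y _; rewrite mulrC.
Qed.

Lemma log_potentialE (u : V) x :
  log_potential Omega u x = kop mu (@log_kernel R d) u x.
Proof.
have [C sC] := schur_log d_ge1 oOmega bOmega.
rewrite /log_potential -(Rintegral_lebesgue_on oOmega).
rewrite -Rintegral_scale; last first.
  have mu2 := measurable_section_mul sC u x.
  have mh : measurable_fun [set: 'rV[R]_d] (fun y => 2^-1 * (log_kernel (x, y) * u y)).
    exact: measurable_funM.
  apply: eq_measurable_fun mh => y _.
  by rewrite /log_kernel /kdist/=; field.
by apply: eq_Rintegral => y _; rewrite /log_kernel /kdist/= -mulrA (mulrC (u y)).
Qed.

(** Where the Riesz potential converges absolutely, the constant 1 can be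
    separated from the kernel. *)
Lemma riesz_kernel_kop b (u : V) : 0 < b -> b < d%:R ->
  {ae mu, forall x, kop mu (riesz_kernel b) u x =
    2 / b * (kop mu (pow_kernel b) u x - \int[mu]_y u y)}.
Proof.
move=> b0 bd; apply: filterS (kop_integrable mu_fin (schur_pow d_ge1 oOmega bOmega b0 bd) u).
move=> x ix.
have iu := L2_integrable u.
have mk : measurable_fun [set: 'rV[R]_d] (fun y => pow_kernel b (x, y) * u y - u y).
  apply: measurable_funB; last exact: measurable_L2.
  by apply/measurable_EFinP; exact: measurable_int ix.
rewrite /kop -RintegralB// -Rintegral_scale//; apply: eq_Rintegral => y _.
by rewrite /riesz_kernel; ring.
Qed.

Lemma riesz_equationE alpha (sigma : R) (u : V) : 0 < alpha < d%:R ->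
  {ae mu, forall x, sigma / (d%:R - alpha) * (riesz_potential Omega alpha u x -
     2 * \int[leb]_(y in Omega) u y) =
   sigma * kop mu (riesz_kernel (d%:R - alpha)) u x}.
Proof.
move=> /andP[a0 ad]; set b := d%:R - alpha.
have b0 : 0 < b by rewrite subr_gt0.
have bd : b < d%:R by rewrite gtrBl.
apply: filterS (riesz_kernel_kop u b0 bd) => x ->.
rewrite riesz_potentialE -(Rintegral_lebesgue_on oOmega); ring.
Qed.

(** [J] is the quadratic form of the kernel [r^(-b)] and [J_d] that of the constant
    kernel 1, up to the sign; their difference quotient has kernel
    [(r^(-b) - 1) / b]. *)
Lemma Jtilde_ip alpha (B : V -> V) (u : V) : 0 < alpha < d%:R ->
  (forall v, B v =1 kop mu (riesz_kernel (d%:R - alpha)) v) ->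
  Jtilde Omega alpha u = - 2^-1 * ip (B u) u.
Proof.
move=> /andP[a0 ad]; set b := d%:R - alpha => BE.
have b0 : 0 < b by rewrite subr_gt0.
have bd : b < d%:R by rewrite gtrBl.
have sP := schur_pow d_ge1 oOmega bOmega b0 bd.
have [P PE _] := kop_bounded_op mu_fin sP.
have [one oneE] := L2_one.
have ipone v : ip one v = \int[mu]_x v x.
  by apply: eq_Rintegral => x _; rewrite oneE mul1r.
have JE : J Omega alpha u = - ip (P u) u.
  rewrite /J -(Rintegral_lebesgue_on oOmega); congr (- _).
  apply: eq_Rintegral => x _; rewrite -(Rintegral_lebesgue_on oOmega) PE mulrC.
  rewrite -Rintegral_scale; last exact: (measurable_section_mul sP u x).
  by apply: eq_Rintegral => y _; rewrite /pow_kernel /kdist/=; ring.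
have BP : L2norm (B u - 2 / b *: (P u - (\int[mu]_y u y) *: one)) = 0.
  apply/L2norm_sub_eq0; apply: filterS (riesz_kernel_kop u b0 bd) => x kx _.
  rewrite BE kx; transitivity (2 / b * (P u x - (\int[mu]_y u y) * one x)) => //.
  by rewrite PE oneE mulr1.
have BE' : ip (B u) u = ip (2 / b *: (P u - (\int[mu]_y u y) *: one)) u.
  apply/eqP; rewrite -subr_eq0 -ipBl -normr_le0.
  by rewrite (le_trans (ip_le _ _))// BP mul0r.
rewrite BE' ipZl ipBl ipZl ipone /Jtilde JE /J_d -(Rintegral_lebesgue_on oOmega) -/b.
by field; rewrite gt_eqF.
Qed.

Lemma Jtilde_d_ip (B : V -> V) (u : V) :
  (forall v, B v =1 kop mu (@log_kernel R d) v) ->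
  Jtilde_d Omega u = - 2^-1 * ip (B u) u.
Proof.
move=> BE; have [C sC] := schur_log d_ge1 oOmega bOmega.
rewrite /Jtilde_d -(Rintegral_lebesgue_on oOmega) mulNr -ipZl; congr (- _).
apply: eq_Rintegral => x _; rewrite -(Rintegral_lebesgue_on oOmega).
transitivity (2^-1 * B u x * u x) => //.
rewrite BE mulrAC /kop -Rintegral_scale; last exact: (measurable_section_mul sC u x).
by apply: eq_Rintegral => y _; rewrite /log_kernel /kdist/=; field.
Qed.

End identification.

(** * Well-posedness and convergence *)
Section limits.
Context d (X : measurableType d) (R : realType).
Variable mu : {measure set X -> \bar R}.

Lemma ip_cvg2 (F G : nat -> L2 mu) (f g : L2 mu) :
  L2norm (F n - f) @[n --> \oo] --> (0 : R) ->
  L2norm (G n - g) @[n --> \oo] --> (0 : R) ->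
  ip (F n) (G n) @[n --> \oo] --> ip f g.
Proof.
move=> Ff Gg; apply/cvgrPdist_le => e e0.
pose r n := L2norm (F n - f) * (L2norm g + L2norm (G n - g)) + L2norm f * L2norm (G n - g).
have : r n @[n --> \oo] --> 0 * (L2norm g + 0) + L2norm f * 0.
  apply: cvgD; last exact: cvgMr.
  by apply: cvgM => //; apply: cvgD => //; exact: cvg_cst.
rewrite mul0r mulr0 addr0 => /cvgrPdist_le/(_ _ e0); apply: filterS => n.
rewrite sub0r normrN => /(le_trans (ler_norm _)); apply: le_trans.
have -> : ip f g - ip (F n) (G n) = - (ip (F n - f) (G n) + ip (G n - g) f).
  by rewrite !ipBl [ip (G n) f]ipC [ip g f]ipC; ring.
rewrite normrN (le_trans (ler_normD _ _))// lerD//.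
  rewrite (le_trans (ip_le _ _))// ler_wpM2l ?L2norm_ge0//.
  exact: L2norm_le_dist.
by rewrite mulrC ip_le.
Qed.

Lemma bop_change_bound (A : L2 mu -> L2 mu) c C : bounded_op A c -> 0 <= C ->
  (forall u, L2norm (A u) <= C * L2norm u) -> bounded_op A C.
Proof. by case=> _ Aadd Ascale _ C0 AC; split. Qed.

Lemma bop_sign (A : L2 mu -> L2 mu) c s : bounded_op A c -> `|s| = 1 ->
  bounded_op (fun u => s *: A u) c.
Proof.
move=> Ac s1; split=> [|u v|a u|u]; first exact: (bop_ge0 Ac).
- by rewrite -scalerDr -scalerBr L2normZ (bop_add Ac) mulr0.
- by rewrite scalerA mulrC -scalerA -scalerBr L2normZ (bop_scale Ac) mulr0.
- by rewrite L2normZ s1 mul1r; exact: (bop_le Ac).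
Qed.

End limits.

Section well_posedness.
Context d (X : measurableType d) (R : realType).
Variable mu : {measure set X -> \bar R}.
Notation leb := (@lebesgue_measure R).
Variables (T : R) (T_gt0 : 0 < T).
Variables (A : L2 mu -> L2 mu) (c : R) (Ac : bounded_op A c) (u0 : L2 mu).

Lemma exp_solution : exists u : H1 mu T,
  has_taylor T (fun k => iter k A u0) u /\ H1_deriv u = A \o u.
Proof.
have [U uU] := taylor_limit_exists T_gt0 (bop_ge0 Ac) (L2norm_ge0 u0)
  (fun k => L2norm_iter_le Ac k u0).
by exists (exp_H1 T_gt0 Ac uU).
Qed.

(** The function [F] of the equation is defined pointwise and has to agree with
    the operator [A] almost everywhere only. *)
Lemma exp_unique_solution (F : (X -> R) -> (X -> R)) (u : H1 mu T) :
  (forall v : L2 mu, {ae mu, forall x, F v x = A v x}) ->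
  has_taylor T (fun k => iter k A u0) u -> H1_deriv u = A \o u ->
  is_unique_solution F u0 u.
Proof.
move=> FA uU du.
have u00 : L2norm (u 0 - u0) = 0 by exact: has_taylor_at0 T_gt0 _ _ uU.
split.
  split; last exact/L2norm_sub_eq0.
  apply: ae_lebW => t _; rewrite du.
  by apply: filterS (FA (u t)) => x /= -> _.
move=> w [sw w0] t tT; apply/L2norm_sub_eq0.
apply: (solution_unique T_gt0 Ac) => //.
- apply: ae_lebS sw => s /[apply] sw.
  apply/L2norm_sub_eq0; apply: filterS2 sw (FA (w s)) => x /(_ I) -> /= -> _.
  by [].
- by apply: ae_lebW => s _; rewrite du /= subrr L2norm0.
apply/eqP; rewrite eq_le L2norm_ge0 andbT.
rewrite (le_trans (L2norm_tri u0 _ _))// [L2norm (u0 - _)]L2normBC u00 addr0.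
by move/L2norm_sub_eq0 : w0 => ->.
Qed.

End well_posedness.

Theorem theorem4p6 (R : realType) (d : nat) (d_ge1 : (1 <= d)%N)
    (Omega : set 'rV[R]_d) (oOmega : open Omega)
    (bOmega : ebounded Omega) (lOmega : lipschitz_boundary Omega)
    (alpha : nat -> R)
    (alpha_range : forall n, 0 < alpha n < d%:R)
    (alpha_lim : alpha n @[n --> \oo] --> (d%:R : R))
    (u0 : nat -> L2 (lebesgue_on oOmega)) (u0oo : L2 (lebesgue_on oOmega))
    (u0_lim : L2norm (u0 n - u0oo) @[n --> \oo] --> (0 : R))
    (T : R) (T_gt0 : 0 < T)
    (sigma : R) (sigma_sign : sigma = 1 \/ sigma = -1) :
  exists (u : nat -> H1 (lebesgue_on oOmega) T)
         (uoo : H1 (lebesgue_on oOmega) T),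
    [/\ forall n, is_unique_solution
          (fun v x => sigma / (d%:R - alpha n) *
             (riesz_potential Omega (alpha n) v x -
              2 * \int[lebesgue_rV d]_(y in Omega) v y))
          (u0 n) (u n),
        is_unique_solution
          (fun v x => sigma * log_potential Omega v x) u0oo uoo,
        H1_dist (u n) uoo @[n --> \oo] --> (0 : \bar R)%E &
        forall t, t \in `[0, T] ->
          L2norm (u n t - uoo t) @[n --> \oo] --> (0 : R) /\
          Jtilde Omega (alpha n) (u n t) @[n --> \oo] -->
            Jtilde_d Omega (uoo t)].
Proof.
have mu_fin := lebesgue_on_finite oOmega bOmega.
have s1 : `|sigma| = 1 by case: sigma_sign => ->; rewrite ?normrN normr1.
have ss : sigma * sigma = 1 by case: sigma_sign => ->; rewrite ?mulrNN mulr1.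
pose b n := d%:R - alpha n.
have b0 n : 0 < b n by rewrite subr_gt0; case/andP: (alpha_range n).
have bd n : b n < d%:R by rewrite gtrBl; case/andP: (alpha_range n).
have b_lim : b n @[n --> \oo] --> (0 : R).
  by rewrite -(subrr (d%:R : R)); apply: cvgB => //; exact: cvg_cst.
have sR n := schur_riesz d_ge1 oOmega bOmega (b0 n) (bd n).
have /choice[B BP] : forall n, exists B : L2 (lebesgue_on oOmega) -> L2 (lebesgue_on oOmega),
    (forall v, B v =1 kop (lebesgue_on oOmega) (riesz_kernel (b n)) v) /\
    bounded_op B (2 / b n * domain_const oOmega (b n)).
  by move=> n; have [B BE Bb] := kop_bounded_op mu_fin (sR n); exists B.
have [C sC] := schur_log d_ge1 oOmega bOmega.
have [B' B'E B'b] := kop_bounded_op mu_fin sC.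
have [D D0 sD] := schur_difference d_ge1 oOmega bOmega.
pose A n v := sigma *: B n v; pose A' v := sigma *: B' v.
have Ab n : bounded_op (A n) _ := bop_sign (BP n).2 s1.
have A'b : bounded_op A' C := bop_sign B'b s1.
have C0 : 0 <= C := bop_ge0 A'b.
have /choice[u uP] n := exp_solution T_gt0 (Ab n) (u0 n).
have [uoo [uooT uooD]] := exp_solution T_gt0 A'b u0oo.
have AA' : \forall n \near \oo, forall v, L2norm (A n v - A' v) <= b n * D * L2norm v.
  have /cvgrPdist_le/(_ (1 / 4)) := b_lim; rewrite divr_gt0// => /(_ isT).
  apply: filterS => n; rewrite sub0r normrN => /(le_trans (ler_norm _)) b4 v.
  rewrite -scalerBr L2normZ s1 mul1r.
  exact: (kop_difference mu_fin (sR n) sC (sD _ (b0 n) b4) (BP n).1 B'E).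
(* Eventually [C + 1] bounds all the operators. *)
pose K := C + 1.
have K0 : 0 <= K by rewrite addr_ge0.
have A'K : bounded_op A' K.
  apply: (bop_change_bound A'b K0) => v.
  by rewrite (le_trans (bop_le A'b v))// ler_wpM2r ?L2norm_ge0// lerDl.
have AK : \forall n \near \oo, bounded_op (A n) K.
  have bD : b n * D @[n --> \oo] --> 0 * D by exact: cvgMl.
  rewrite mul0r in bD; have /cvgrPdist_le/(_ _ ltr01) := bD.
  apply: filterS2 AA' => n AA'n; rewrite sub0r normrN => /(le_trans (ler_norm _)) bD1.
  apply: (bop_change_bound (Ab n) K0) => v.
  rewrite (le_trans (L2norm_le_dist _ (A' v)))// mulrDl lerD ?(bop_le A'b)//.
  by rewrite (le_trans (AA'n v))// ler_wpM2r ?L2norm_ge0.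
pose delta n := (L2norm (u0 n - u0oo) + b n * D * L2norm u0oo) * expR ((K + 1) * T).
pose e n := delta n + (K * delta n + b n * D * (L2norm u0oo * expR (K * T))).
have e_lim : e n @[n --> \oo] --> (0 : R).
  have bD (x : R) : b n * D * x @[n --> \oo] --> 0 * D * x.
    by apply: cvgMl; exact: cvgMl.
  have d_lim : delta n @[n --> \oo] --> (0 + 0 * D * L2norm u0oo) * expR ((K + 1) * T).
    by apply: cvgMl; apply: cvgD => //; exact: bD.
  rewrite !mul0r addr0 mul0r in d_lim.
  have : e n @[n --> \oo] --> 0 + (K * 0 + 0 * D * (L2norm u0oo * expR (K * T))).
    by apply: cvgD => //; apply: cvgD; [exact: cvgMr|exact: bD].
  by rewrite mulr0 !mul0r !addr0.
have bounds : \forall n \near \oo, forall t, t \in `[0, T] ->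
    L2norm (u n t - uoo t) <= e n /\
    L2norm (H1_deriv (u n) t - H1_deriv uoo t) <= e n.
  apply: filterS2 AA' AK => n AA'n AKn t tT.
  have bD0 : 0 <= b n * D by rewrite mulr_ge0// ltW.
  have dn0 : 0 <= delta n.
    rewrite /delta; apply: mulr_ge0; last exact: expR_ge0.
    by apply: addr_ge0; [|apply: mulr_ge0 => //]; exact: L2norm_ge0.
  have p1 := exp_perturbation T_gt0 AKn A'K bD0 AA'n (uP n).1 uooT tT.
  have p2 := exp_image_perturbation T_gt0 AKn A'K bD0 AA'n (uP n).1 uooT tT.
  rewrite (uP n).2 uooD; split.
    rewrite (le_trans p1)// lerDl addr_ge0//; first exact: mulr_ge0.
    by apply: mulr_ge0 => //; rewrite mulr_ge0 ?L2norm_ge0 ?expR_ge0.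
  by rewrite (le_trans p2)// lerDr.
have u_lim t : t \in `[0, T] -> L2norm (u n t - uoo t) @[n --> \oo] --> (0 : R).
  move=> tT; apply: (squeeze_cvgr (f := cst 0) (h := e)) => //; last exact: cvg_cst.
  by apply: filterS bounds => n /(_ t tT)[h _]; rewrite L2norm_ge0.
have du_lim t : t \in `[0, T] ->
    L2norm (A n (u n t) - A' (uoo t)) @[n --> \oo] --> (0 : R).
  move=> tT; apply: (squeeze_cvgr (f := cst 0) (h := e)) => //; last exact: cvg_cst.
  apply: filterS bounds => n /(_ t tT)[_]; rewrite (uP n).2 uooD => h.
  by rewrite L2norm_ge0.
exists u, uoo; split.
- move=> n; apply: (exp_unique_solution T_gt0 (Ab n)) (uP n).1 (uP n).2 => v.
  apply: filterS (riesz_equationE d_ge1 bOmega sigma v (alpha_range n)) => x ->.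
  by transitivity (sigma * B n v x) => //; rewrite (BP n).1.
- apply: (exp_unique_solution T_gt0 A'b) uooT uooD => v.
  apply: aeW => x; rewrite (log_potentialE d_ge1 bOmega).
  by transitivity (sigma * B' v x) => //; rewrite B'E.
- exact: (H1_dist_cvg T_gt0 bounds e_lim).
move=> t tT; split; first exact: u_lim.
have JnE n : Jtilde Omega (alpha n) (u n t) = - (sigma / 2) * ip (A n (u n t)) (u n t).
  rewrite (Jtilde_ip d_ge1 bOmega (u n t) (alpha_range n) (BP n).1) ipZl.
  by rewrite -[in LHS](mul1r (ip _ _)) -ss; ring.
under eq_fun do rewrite JnE.
rewrite (Jtilde_d_ip d_ge1 bOmega (uoo t) B'E).
rewrite (_ : _ * ip _ _ = - (sigma / 2) * ip (A' (uoo t)) (uoo t)); last first.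
  by rewrite ipZl -[in LHS](mul1r (ip _ _)) -ss; ring.
by apply: cvgMr; apply: ip_cvg2; [exact: du_lim|exact: u_lim].
Qed.
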